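(* Let $\mathfrak g$ be a profinite-dimensional real or complex Lie algebra, identified via $\lambda_{\mathfrak g}$ with a closed Lie subalgebra of $[\mathbf U(\mathfrak g)]$. Then the natural unital algebra morphism $\varepsilon_{\mathfrak g}\colon U(|\mathfrak g|)\to|\mathbf U(\mathfrak g)|$ extending the identity of $\mathfrak g$ is injective, and its image is the unital subalgebra $\langle\mathfrak g\rangle$ of $\mathbf U(\mathfrak g)$ algebraically generated by $\mathfrak g$. Thus $\langle\mathfrak g\rangle$ is isomorphic to $U(|\mathfrak g|)$ under an isomorphism fixing the elements of $\mathfrak g$, and $\langle\mathfrak g\rangle$ is dense in $\mathbf U(\mathfrak g)$: $\mathfrak g\subseteq U(|\mathfrak g|)\cong\langle\mathfrak g\rangle\subseteq\mathbf U(\mathfrak g)=\overline{\langle\mathfrak g\rangle}$.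
   Context: $\mathbb K\in\{\mathbb R,\mathbb C\}$. A topological $\mathbb K$-vector space is weakly complete if it is isomorphic to a power $\mathbb K^J$ (with the product topology) for some set $J$. A weakly complete unital algebra is a unital associative $\mathbb K$-algebra $A$ carrying a topology that makes it a weakly complete vector space and makes multiplication continuous; morphisms are continuous unital algebra homomorphisms. For such $A$, $[A]$ denotes the topological Lie algebra with the same underlying topological vector space and bracket $[x,y]=xy-yx$. For a topological $\mathbb K$-Lie algebra $\mathfrak g$ let $\mathcal I(\mathfrak g)$ be the set of closed ideals $I$ of $\mathfrak g$ with $\dim \mathfrak g/I<\infty$; $\mathfrak g$ is profinite-dimensional if the natural map $\mathfrak g\to\lim_{I\in\mathcal I(\mathfrak g)}\mathfrak g/I$ is an isomorphism of topological Lie algebras. The weakly complete enveloping algebra of a profinite-dimensional Lie algebra $\mathfrak g$ is a weakly complete unital algebra $\mathbf U(\mathfrak g)$ together with a continuous Lie algebra morphism $\lambda_{\mathfrak g}\colon\mathfrak g\to[\mathbf U(\mathfrak g)]$ such that for every weakly complete unital algebra $A$ and every continuous Lie algebra morphism $f\colon\mathfrak g\to[A]$ there is a unique continuous unital algebra morphism $f'\colon\mathbf U(\mathfrak g)\to A$ with $f=f'\circ\lambda_{\mathfrak g}$; $\lambda_{\mathfrak g}$ is a topological embedding with closed image. $|\mathfrak g|$ and $|\mathbf U(\mathfrak g)|$ denote the underlying abstract Lie algebra and abstract algebra; for an abstract Lie algebra $L$, $U(L)$ is its classical universal enveloping algebra. *)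

(* Defs.v *)
From HB Require Import structures.
From mathcomp Require Import all_boot all_order all_algebra.
From mathcomp Require Import all_classical all_reals all_analysis.
From mathcomp Require Import complex.

Set Implicit Arguments.
Unset Strict Implicit.
Unset Printing Implicit Defensive.

Import Order.TTheory GRing.Theory Num.Theory.
Import numFieldTopology.Exports numFieldNormedType.Exports.

Local Open Scope classical_set_scope.
Local Open Scope ring_scope.

Definition Kof (R : realType) (isC : bool) : numFieldType :=
  if isC then ((R[i])%C : numFieldType) else (R : numFieldType).

#[short(type="topAlgType")]
HB.structure Definition TopAlgebra (K : numDomainType) :=
  {A of GRing.Algebra K A & TopologicalLmodule K A}.

Section Defs.
Variable K : numFieldType.

Definition lie_bracket_axioms (L : lmodType K) (br : L -> L -> L) : Prop :=
  [/\ (forall (a : K) (x y z : L), br (a *: x + y) z = a *: br x z + br y z),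
      (forall (a : K) (x y z : L), br x (a *: y + z) = a *: br x y + br x z),
      (forall x : L, br x x = 0) &
      (forall x y z : L, br x (br y z) + br y (br z x) + br z (br x y) = 0)].

Definition top_lie_algebra (L : topologicalLmodType K) (br : L -> L -> L) : Prop :=
  lie_bracket_axioms br /\ continuous (fun p : L * L => br p.1 p.2).

Definition commutator (A : algType K) (x y : A) : A := x * y - y * x.

Definition lie_morph (L : lmodType K) (br : L -> L -> L) (A : algType K)
    (f : L -> A) : Prop :=
  (forall (a : K) (x y : L), f (a *: x + y) = a *: f x + f y) /\
  (forall x y : L, f (br x y) = commutator (f x) (f y)).

Definition unital_alg_morph (A B : algType K) (f : A -> B) : Prop :=
  [/\ (forall (a : K) (x y : A), f (a *: x + y) = a *: f x + f y),
      f 1 = 1 &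
      (forall x y : A, f (x * y) = f x * f y)].

Definition classical_UEA (L : lmodType K) (br : L -> L -> L)
    (UL : algType K) (iota : L -> UL) : Prop :=
  lie_morph br iota /\
  forall (A : algType K) (f : L -> A), lie_morph br f ->
    exists! f' : UL -> A, unital_alg_morph f' /\ f = f' \o iota.

Definition weakly_complete (V : topologicalLmodType K) : Prop :=
  exists (J : Type) (phi : V -> {ptws J -> K}) (psi : {ptws J -> K} -> V),
    [/\ (forall (a : K) (x y : V) (j : J), phi (a *: x + y) j = a * phi x j + phi y j),
        cancel phi psi, cancel psi phi, continuous phi & continuous psi].

Definition wc_algebra (A : topAlgType K) : Prop :=
  weakly_complete A /\ continuous (fun p : A * A => p.1 * p.2).

Definition lie_ideal (L : lmodType K) (br : L -> L -> L) (I : set L) : Prop :=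
  [/\ I 0,
      (forall (a : K) (x y : L), I x -> I y -> I (a *: x + y)) &
      (forall x y : L, I y -> I (br x y))].

Definition finite_codim (L : lmodType K) (I : set L) : Prop :=
  exists (n : nat) (v : 'I_n -> L),
    forall x : L, exists c : 'I_n -> K, I (x - \sum_(i < n) c i *: v i).

Definition cofinite_ideals (L : topologicalLmodType K) (br : L -> L -> L)
    : set (set L) :=
  [set I | [/\ lie_ideal br I, closed I & finite_codim I]].

(* g is profinite-dimensional: the natural map g -> lim_{I in I(g)} g/I is *)
(* an isomorphism of topological Lie algebras.  Written out:               *)
(*  (1) injectivity:  the intersection of all I in I(g) is {0};            *)
(*  (2) surjectivity: every compatible family (x_I + I)_I of cosets        *)
(*      (x_I - x_J in J whenever I <= J) is of the form (y + I)_I;         *)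
(*  (3) openness onto the limit: the limit topology (subspace of the       *)
(*      product of the quotient topologies) pulls back to the topology     *)
(*      generated by the open I-saturated sets, I in I(g) (I(g) is         *)
(*      filtered, so these are the preimages of basic open sets); hence   *)
(*      every open set is a union of open I-saturated sets.               *)
(*  (The map is a Lie algebra morphism and is continuous automatically.)   *)
Definition profinite_dim (L : topologicalLmodType K) (br : L -> L -> L) : Prop :=
  let II := cofinite_ideals br in
  [/\ (forall x : L, (forall I, II I -> I x) -> x = 0),
      (forall x : set L -> L,
         (forall I J, II I -> II J -> I `<=` J -> J (x I - x J)) ->
         exists y : L, forall I, II I -> I (y - x I)) &
      (forall (O : set L) (x : L), open O -> O x ->
         exists I V, [/\ II I, open V, V x, V `<=` O &
                         forall v i, V v -> I i -> V (v + i)])].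

Definition wc_UEA (L : topologicalLmodType K) (br : L -> L -> L)
    (U : topAlgType K) (lam : L -> U) : Prop :=
  [/\ wc_algebra U, lie_morph br lam, continuous lam &
      forall A : topAlgType K, wc_algebra A ->
      forall f : L -> A, lie_morph br f -> continuous f ->
        exists! f' : U -> A, [/\ unital_alg_morph f', continuous f' & f = f' \o lam]].

Definition unital_subalg (A : algType K) (B : set A) : Prop :=
  [/\ B 1,
      (forall (a : K) (x y : A), B x -> B y -> B (a *: x + y)) &
      (forall x y : A, B x -> B y -> B (x * y))].

Definition gen_subalg (A : algType K) (S : set A) : set A :=
  \bigcap_(B in [set B : set A | unital_subalg B /\ S `<=` B]) B.

End Defs.

(* Main.v *)
(* Density and the description of the image follow from the uniqueness clauses of the
   two universal properties, applied to the closure of the generated subalgebra (a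
   closed subspace of K^J is again some K^S) and to the subalgebra of U(g) generated
   by g.

   For injectivity, every continuous representation of g on matrices factors through
   U(g) (abstract) and through the weakly complete algebra, so its matrix coefficients
   vanish on ker eps. A closed ideal I of finite codimension gives a continuous
   quotient g -> g / I, and Ado's theorem a faithful representation of g / I, so there
   are matrix coefficients that vanish at 1 and restrict to a given functional of g / I;
   those separate the points of g. Tensor products of representations make matrix
   coefficients stable under the shuffle product on words. Given linearly independent
   e_1, ..., e_m in g and dual coefficients w_1, ..., w_m, the shuffle product of
   w_j1, ..., w_jn kills words of length < n and detects the monomial e_j1 ... e_jn
   among the sorted monomials of length n. Hence an element killed by all matrix
   coefficients descends through the filtration of U(g) by word length and is 0; the
   Poincare-Birkhoff-Witt theorem is not needed.

   Ado's theorem over an algebraically closed field: it is enough to represent every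
   nonzero c by a nonzero operator, and the adjoint representation does so unless c is
   central. For central c write g = s + r by Levi's theorem, start from a nilpotent
   representation of the line K c, and extend it by Zassenhaus' construction, one line
   at a time, to [g, r] + K c and to r, and then by s, keeping [g, r] + K c acting by
   nilpotent operators. The real case follows by complexifying the structure constants. *)
Require Import Defs.
From HB Require Import structures.
From mathcomp Require Import all_boot all_order all_algebra.
From mathcomp Require Import all_classical all_reals all_analysis.
From mathcomp Require Import complex mxtens.
From mathcomp Require Import ring lra zify.
Import Order.TTheory GRing.Theory Num.Theory.
Import numFieldTopology.Exports numFieldNormedType.Exports.
Local Open Scope classical_set_scope.
Local Open Scope ring_scope.
Set Implicit Arguments.
Unset Strict Implicit.
Unset Printing Implicit Defensive.

(** Two obstacles shape the proof. A representation of g helps only if it is continuous; for g / I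
    this comes down to the continuity of finitely many coordinate functionals, which follows from
    the compactness of the closed unit disc of K. That compactness and Ado's theorem, phrased with
    structure constants, are the only facts for which the real and the complex case are treated
    separately.

    The second obstacle is finiteness. Zassenhaus' extension of a representation V from a to a + b
    lives in the coinduced module Hom(U(b), V), which is infinite-dimensional. It is cut down by a
    subspace N, an ideal of a containing [b, a], that acts nilpotently on V. For this reason
    nilpotency is carried through all of Ado's theorem, and N is kept at [g, r] + K c while b runs
    through the lines of r and finally through s, whose own action need not be nilpotent.

    Characteristic 0 is used in the last step too: the shuffle functional takes on its own monomial
    a positive integer value, which must not vanish in K. *)

(** * Equations in abelian groups by reflection *)

Inductive zexpr := ZAtom of nat | ZZero | ZAdd of zexpr & zexpr | ZOpp of zexpr.

Fixpoint zeval (V : zmodType) (e : seq V) (t : zexpr) : V :=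
  match t with
  | ZAtom i => nth 0 e i
  | ZZero => 0
  | ZAdd t u => zeval e t + zeval e u
  | ZOpp t => - zeval e t
  end.

Fixpoint zcoef (i : nat) (t : zexpr) : int :=
  match t with
  | ZAtom j => if i == j then 1 else 0
  | ZZero => 0
  | ZAdd t u => zcoef i t + zcoef i u
  | ZOpp t => - zcoef i t
  end.

Lemma zevalE (V : zmodType) (e : seq V) t :
  zeval e t = \sum_(i < size e) e`_i *~ zcoef i t.
Proof.
elim: t => [j||t IHt u IHu|t IHt] /=; rewrite ?IHt ?IHu.
- have [hj|hj] := ltnP j (size e); last first.
    rewrite nth_default // big1 // => i _; case: eqP => // e1.
    by move: (ltn_ord i); rewrite e1 ltnNge hj.
  rewrite (bigD1 (Ordinal hj)) //= eqxx big1 ?addr0 // => i hi.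
  by case: eqP => // e1; move/eqP: hi => []; apply: val_inj.
- by rewrite big1.
- by rewrite -big_split; apply: eq_bigr => i _; rewrite mulrzDr.
- by rewrite -sumrN; apply: eq_bigr => i _; rewrite mulrNz.
Qed.

(** Atoms are treated as free generators: terms with the same integer coefficients agree in every
    abelian group. *)
Lemma zmodP (V : zmodType) (e : seq V) t u :
  all (fun i => zcoef i t == zcoef i u) (iota 0 (size e)) -> zeval e t = zeval e u.
Proof.
move=> /allP h; rewrite !zevalE; apply: eq_bigr => i _.
by rewrite (eqP (h i _)) // mem_iota add0n ltn_ord.
Qed.

Ltac zsame_syn x y := constr_eq x y.
Ltac zsame_conv x y := first [constr_eq x y | unify x y].

Ltac zpos same x l :=
  match l with
  | ?y :: _ => let _ := match constr:(O) with _ => same x y end in constr:(O)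
  | _ :: ?l' => let n := zpos same x l' in constr:(S n)
  end.

Ltac zatoms same l t :=
  match t with
  | @GRing.add _ ?x ?y => let l1 := zatoms same l x in zatoms same l1 y
  | @GRing.opp _ ?x => zatoms same l x
  | @GRing.zero _ => l
  | _ => match constr:(O) with
         | _ => let n := zpos same t l in l
         | _ => constr:(t :: l)
         end
  end.

Ltac zquote same l t :=
  match t with
  | @GRing.add _ ?x ?y =>
    let u := zquote same l x in let v := zquote same l y in constr:(ZAdd u v)
  | @GRing.opp _ ?x => let u := zquote same l x in constr:(ZOpp u)
  | @GRing.zero _ => constr:(ZZero)
  | _ => let n := zpos same t l in constr:(ZAtom n)
  end.

Ltac zmod_with same :=
  lazymatch goal with
  | |- ?x = ?y :> ?T =>
    let l1 := zatoms same (@nil T) x in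
    let l := zatoms same l1 y in
    let t := zquote same l x in
    let u := zquote same l y in
    refine (@zmodP _ l t u _); vm_compute; reflexivity
  end.

(* Decides equations between signed sums in an abelian group. Atoms are compared
   syntactically first, since unifying large linear-map expressions may not end. *)
Ltac zmod := first [zmod_with zsame_syn | zmod_with zsame_conv].

(** * Linear algebra *)

Lemma bilinear_lfun (K : fieldType) (V W Z : vectType K) (h : V -> W -> Z) :
  (forall a x y w, h (a *: x + y) w = a *: h x w + h y w) ->
  (forall a x w w', h x (a *: w + w') = a *: h x w + h x w') ->
  exists r : 'Hom(V, 'Hom(W, Z)), forall x w, r x w = h x w.
Proof.
move=> hl hr.
have lin1 x : linear (h x) by move=> a w w'; exact: hr.
pose h1 x : 'Hom(W, Z) := linfun (HB.pack (h x) (GRing.isLinear.Build K W Z _ (h x) (lin1 x)) : {linear W -> Z}).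
have h1E x w : h1 x w = h x w by rewrite lfunE.
have lin2 : linear h1.
  by move=> a x y; apply/lfunP => w; rewrite add_lfunE scale_lfunE !h1E hl.
pose r := linfun (HB.pack h1 (GRing.isLinear.Build K V _ _ h1 lin2) : {linear V -> 'Hom(W, Z)}).
by exists r => x w; rewrite lfunE h1E.
Qed.

Lemma lfun_of (K : fieldType) (V W : vectType K) (h : V -> W) :
  linear h -> exists r : 'Hom(V, W), forall x, r x = h x.
Proof.
move=> hl.
exists (linfun (HB.pack h (GRing.isLinear.Build K V W _ h hl) : {linear V -> W})).
by move=> x; rewrite lfunE.
Qed.

(** Annihilators, common kernels and orthogonals are given by propositions; this turns them into
    subspaces. A subspace inside P grows by the line of a missing vector until it exhausts P, and
    its codimension bounds the number of steps. *)
Lemma prop_vspace (K : fieldType) (V : vectType K) (P : V -> Prop) :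
  P 0 -> (forall a u v, P u -> P v -> P (a *: u + v)) ->
  exists U : {vspace V}, forall v, v \in U <-> P v.
Proof.
move=> P0 PL.
suff main n (U : {vspace V}) : (dim V - \dim U <= n)%N ->
    (forall v, v \in U -> P v) -> exists U : {vspace V}, forall v, v \in U <-> P v.
  by apply: (main (dim V) 0%VS) => [|v]; rewrite ?leq_subr // memv0 => /eqP ->.
elim: n U => [|n IH] U hU sU.
  exists U => v; split; first exact: sU.
  move=> _; suff -> : U = fullv by rewrite memvf.
  by apply/eqP; rewrite eqEdim subvf dimvf; move: hU; rewrite leqn0 subn_eq0.
have [all|] := pselect (forall v, P v -> v \in U).
  by exists U => v; split; [exact: sU | exact: all].
move=> /existsNP [v /not_implyP [Pv /negP nv]].
apply: (IH (U + <[v]>)%VS).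
  have : (\dim U < \dim (U + <[v]>))%N.
    rewrite (ltn_leqif (dimv_leqif_eq (addvSl U <[v]>))).
    apply: contra nv => /eqP ->.
    by rewrite (subvP (addvSr _ _)) // memv_line.
  move: hU; lia.
move=> w /memv_addP [u hu [w' /vlineP [k ->] ->]].
by rewrite addrC; apply: PL => //; exact: sU.
Qed.

(** The quotient Y / X, realized on a complement of X in Y: [p] is the projection along X and [s] a
    section with values in Y. *)
Lemma subquotient (K : fieldType) (V : vectType K) (X Y : {vspace V}) :
  (X <= Y)%VS -> exists (T : vectType K) (p : 'Hom(V, T)) (s : 'Hom(T, V)),
  [/\ forall t, p (s t) = t, forall t, s t \in Y,
      forall x, x \in X -> p x = 0 & forall y, y \in Y -> y - s (p y) \in X].
Proof.
move=> XY; pose W := (Y :\: X)%VS.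
have WX0 : (W :&: X = 0)%VS by exact: capv_diff.
have XW0 : (X :&: W = 0)%VS by rewrite capvC.
have WXY : (W + X = Y)%VS by rewrite addv_diff; apply/addv_idPl.
exists (subvs_of W : vectType K), (linfun (vsproj W) \o daddv_pi W X)%VF, (linfun vsval).
split=> [t|t|x hx|y hy].
- rewrite comp_lfunE !lfunE /= daddv_pi_id ?subvsP //.
  by apply: subvs_inj; rewrite vsprojK // subvsP.
- rewrite lfunE /=; apply: (subvP _ _ (subvsP t)).
  by rewrite -WXY addvSl.
- rewrite comp_lfunE lfunE /=.
  suff -> : daddv_pi W X x = 0 by rewrite linear0.
  have := @daddv_pi_add _ _ W X x WX0.
  rewrite (subvP (addvSr W X)) // => /(_ isT).
  rewrite [daddv_pi X W x]daddv_pi_id // => h.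
  by apply: (addIr x); rewrite h add0r.
- rewrite comp_lfunE !lfunE /= vsprojK ?memv_pi //.
  have := @daddv_pi_add _ _ W X y WX0; rewrite WXY hy => /(_ isT) h.
  by rewrite -[X in X - _]h addrAC subrr add0r memv_pi.
Qed.

Section Spans.
Variables (K : fieldType) (F : lmodType K).

(** Impredicative span: the ambient module may be infinite-dimensional, as is the coinduced module
    below, so [{vspace _}] does not apply. *)
Definition inspan (l : seq F) (f : F) := forall P : F -> Prop,
  P 0 -> (forall a u v, P u -> P v -> P (a *: u + v)) ->
  (forall u, u \in l -> P u) -> P f.

Lemma inspan0 l : inspan l 0. Proof. by move=> P. Qed.

Lemma inspanL l a u v : inspan l u -> inspan l v -> inspan l (a *: u + v).
Proof. by move=> hu hv P P0 PL Pl; apply: (PL); [exact: (hu P P0 PL Pl)|exact: (hv P P0 PL Pl)]. Qed.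

Lemma inspanD l u v : inspan l u -> inspan l v -> inspan l (u + v).
Proof. by move=> hu hv; rewrite -[u]scale1r; exact: inspanL. Qed.

Lemma inspanZ l a u : inspan l u -> inspan l (a *: u).
Proof. by move=> hu; rewrite -[_ *: _]addr0; apply: inspanL => //; exact: inspan0. Qed.

Lemma inspan_mem l u : u \in l -> inspan l u.
Proof. by move=> hu P _ _ h; exact: h. Qed.

Lemma inspan_sum l (I : Type) (r : seq I) (P : pred I) (G : I -> F) :
  (forall i, P i -> inspan l (G i)) -> inspan l (\sum_(i <- r | P i) G i).
Proof.
move=> h; elim/big_rec: _ => [|i x Pi hx]; first exact: inspan0.
by apply: inspanD => //; exact: h.
Qed.

Lemma inspan_sub l l' : (forall u, u \in l -> inspan l' u) ->
  forall f, inspan l f -> inspan l' f.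
Proof.
move=> h f hf P P0 PL Pl; apply: (hf P) => // u hu; exact: (h u hu P).
Qed.

(** A finite span becomes a space of row vectors. A generator outside the span of the others adds a
    coordinate; one inside it is dropped. *)
Lemma inspan_coords l : exists (m : nat) (e : 'rV[K]_m -> F),
  [/\ linear e, injective e & forall f, inspan l f <-> exists u, f = e u].
Proof.
elim: l => [|f0 l [m [e [le ie he]]]].
  exists 0, (fun=> 0); split=> [a u v|u v _|f].
  - by rewrite scaler0 addr0.
  - by rewrite [u]thinmx0 [v]thinmx0.
  - split=> [hf|[_ ->]]; last exact: inspan0.
    by exists 0; apply: (hf (fun f => f = 0)) => // a u v -> ->; rewrite scaler0 addr0.
have [h|h] := pselect (inspan l f0).
  exists m, e; split=> // f; rewrite -he; split.
    apply: inspan_sub => u; rewrite inE => /orP[/eqP ->//|]; exact: inspan_mem.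
  by apply: inspan_sub => u hu; apply: inspan_mem; rewrite inE hu orbT.
pose e' (u : 'rV[K]_(1 + m)) := lsubmx u 0 0 *: f0 + e (rsubmx u).
have e0 : e 0 = 0.
  have := le 1 0 0; rewrite !scale1r addr0 => /eqP.
  by rewrite -subr_eq subrr eq_sym => /eqP.
have eN u : e (- u) = - e u.
  by have := le (-1) u 0; rewrite !scaleN1r e0 !addr0.
have le' : linear e'.
  move=> a u v; rewrite /e'.
  have -> : lsubmx (a *: u + v) 0 0 = a * lsubmx u 0 0 + lsubmx v 0 0 by rewrite !mxE.
  have -> : rsubmx (a *: u + v) = a *: rsubmx u + rsubmx v by apply/rowP => j; rewrite !mxE.
  by rewrite le scalerDr scalerDl scalerA addrACA.
exists (1 + m)%N, e'; split=> //.
- move=> u v uv.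
  have : e' (u - v) = 0.
    by rewrite addrC -scaleN1r le' uv scaleN1r addNr.
  rewrite /e' => /eqP; rewrite addr_eq0 -eN => /eqP hw.
  have c0 : lsubmx (u - v) 0 0 = 0.
    apply: contrapT => /eqP c0; apply: h; apply/he.
    exists ((lsubmx (u - v) 0 0)^-1 *: - rsubmx (u - v)).
    rewrite -[_ *: _]addr0 le e0 addr0 -hw scalerA mulVf // scale1r //.
  move: hw; rewrite c0 scale0r -e0 => /ie /eqP; rewrite eq_sym oppr_eq0 => /eqP r0.
  apply/eqP; rewrite -subr_eq0; apply/eqP.
  rewrite -[u - v]hsubmxK r0.
  have -> : lsubmx (u - v) = 0 by apply/matrixP => i j; rewrite !ord1 c0 mxE.
  by rewrite row_mx0.
- move=> f; split.
    move=> hf; apply: (hf (fun f => exists u, f = e' u)) => [|a u v [u' ->] [v' ->]|u].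
    + by exists 0; rewrite /e' !linear0 mxE scale0r e0 addr0.
    + by exists (a *: u' + v'); rewrite le'.
    rewrite inE => /orP[/eqP ->|/inspan_mem /he [u' ->]].
    + exists (row_mx 1%:M 0); rewrite /e' row_mxKl row_mxKr e0 addr0 mxE eqxx.
      by rewrite scale1r.
    + by exists (row_mx 0 u'); rewrite /e' row_mxKl row_mxKr mxE scale0r add0r.
  move=> [u ->]; rewrite /e'; apply: inspanL.
    by apply: inspan_mem; rewrite mem_head.
  have : inspan l (e (rsubmx u)) by apply/he; exists (rsubmx u).
  by apply: inspan_sub => w hw; apply: inspan_mem; rewrite inE hw orbT.
Qed.

End Spans.

Section Bilinear.
Variables (K : fieldType) (V W Z : vectType K) (r : 'Hom(V, 'Hom(W, Z))).

Lemma lfun2D x y w : r (x + y) w = r x w + r y w.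
Proof. by rewrite linearD add_lfunE. Qed.
Lemma lfun2Z a x w : r (a *: x) w = a *: r x w.
Proof. by rewrite linearZ scale_lfunE. Qed.
Lemma lfun20 w : r 0 w = 0.
Proof. by rewrite linear0 zero_lfunE. Qed.
Lemma lfun2_sum (I : Type) (s : seq I) (P : pred I) (G : I -> V) w :
  r (\sum_(i <- s | P i) G i) w = \sum_(i <- s | P i) r (G i) w.
Proof. by rewrite linear_sum sum_lfunE. Qed.

End Bilinear.

(** * Lie algebras and representations *)

Section LieBasics.
Variables (K : fieldType) (g : vectType K) (B : 'Hom(g, 'End(g))).

(** Jacobi's identity in Leibniz form: [B x] is a derivation. *)
Definition lie_alg := (forall x, B x x = 0) /\
  (forall x y z, B x (B y z) = B (B x y) z + B y (B x z)).

Definition brsub (a b c : {vspace g}) :=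
  forall x y, x \in a -> y \in b -> B x y \in c.

(** The map [r] is defined on all of g and constrained on a only, so that subalgebras need no type
    of their own when representations are extended. *)
Definition is_rep (a : {vspace g}) (V : vectType K) (r : 'Hom(g, 'End(V))) :=
  forall x y, x \in a -> y \in a -> forall v, r (B x y) v = r x (r y v) - r y (r x v).

Definition wact (V : vectType K) (r : 'Hom(g, 'End(V))) (s : seq g) (v : V) :=
  foldr (fun x v => r x v) v s.

(** Uniform nilpotency: the associative algebra generated by the operators of N is nilpotent, which
    is stronger than each operator being nilpotent. *)
Definition nilact (N : {vspace g}) (V : vectType K) (r : 'Hom(g, 'End(V))) k :=
  forall s, size s = k -> {subset s <= N} -> forall v, wact r s v = 0.

Lemma wact_cat (V : vectType K) (r : 'Hom(g, 'End(V))) s t v : wact r (s ++ t) v = wact r s (wact r t v).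
Proof. by rewrite /wact foldr_cat. Qed.

Lemma wact_rcons (V : vectType K) (r : 'Hom(g, 'End(V))) s x v : wact r (rcons s x) v = wact r s (r x v).
Proof. by rewrite -cats1 wact_cat. Qed.

Lemma wact_linear (V : vectType K) (r : 'Hom(g, 'End(V))) s : linear (wact r s).
Proof. by move=> a u v; elim: s => //= x s ->; rewrite linearP. Qed.

Lemma wact0 (V : vectType K) (r : 'Hom(g, 'End(V))) s : wact r s 0 = 0.
Proof. by elim: s => //= x s ->; rewrite linear0. Qed.

Hypothesis HB : lie_alg.

Lemma brxx x : B x x = 0. Proof. exact: HB.1. Qed.

Lemma brC x y : B x y = - B y x.
Proof.
apply/eqP; rewrite -addr_eq0; apply/eqP.
by have := brxx (x + y); rewrite lfun2D !linearD /= !brxx addr0 add0r addrC.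
Qed.

Lemma brJ x y z : B x (B y z) = B (B x y) z + B y (B x z).
Proof. exact: HB.2. Qed.

Lemma ad_rep a : is_rep a B.
Proof. by move=> x y _ _ v; rewrite brJ addrK. Qed.

End LieBasics.
Arguments brC {K g B} HB x y.

(** * Extending a representation from an ideal *)

Section Zassenhaus.
Variables (K : fieldType) (g : vectType K) (B : 'Hom(g, 'End(g))).
Hypothesis HB : lie_alg B.
Variables (a b N : {vspace g}) (V : vectType K) (r : 'Hom(g, 'End(V))).
Hypotheses (aa : brsub B a a a) (bb : brsub B b b b) (ba : brsub B b a N).
Hypotheses (Na : (N <= a)%VS) (aN : brsub B a N N) (ab0 : (a :&: b = 0)%VS).
Hypothesis ra : is_rep B a r.

(* F is the model of Hom(T(b), V), T(b) being the tensor algebra of b; a acts on it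
   so that [y, x] is the commutator of y and x when y in b acts by [sh y]. Functions
   satisfying [cocomp] are those factoring through U(b). A finite-dimensional stable
   subspace exists because [act x f - r x o f] drops the level in the filtration of V
   by the kernels of words in N. *)
Let bT := subvs_of b.
Let F := seq bT -> V.

Let sh (y : bT) (f : F) : F := fun w => f (y :: w).

Let act_def := fix act (w : seq bT) (x : g) (f : F) : V :=
  if w is y :: w' then act w' x (sh y f) + act w' (B (vsval y) x) f else r x (f [::]).
Let act x f : F := fun w => act_def w x f.

Let act_nil x f : act x f [::] = r x (f [::]). Proof. by []. Qed.
Let act_cons x f y w : act x f (y :: w) = act x (sh y f) w + act (B (vsval y) x) f w.
Proof. by []. Qed.
Let shL y c f h : sh y (c *: f + h) = c *: sh y f + sh y h. Proof. by []. Qed.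
Let FE c (f h : F) w : (c *: f + h) w = c *: f w + h w. Proof. by []. Qed.

Let FDE (f h : F) w : (f + h) w = f w + h w. Proof. by []. Qed.
Let FNE (f : F) w : (- f) w = - f w. Proof. by []. Qed.
Let FBE (f h : F) w : (f - h) w = f w - h w. Proof. by []. Qed.

Let actL x c f h : act x (c *: f + h) = c *: act x f + act x h.
Proof.
apply: funext => w; elim: w x f h => [|y w IH] x f h.
  by rewrite FE !act_nil FE linearP.
by rewrite FE !act_cons shL !IH !FE scalerDr addrACA.
Qed.

Let actLx c x y f : act (c *: x + y) f = c *: act x f + act y f.
Proof.
apply: funext => w; elim: w x y f => [|z w IH] x y f.
  by rewrite FE !act_nil lfun2D lfun2Z.
by rewrite FE !act_cons linearP !IH !FE scalerDr addrACA.
Qed.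

Let shact y x f : sh y (act x f) = act x (sh y f) + act (B (vsval y) x) f.
Proof. by []. Qed.

Let act0 x : act x 0 = 0.
Proof. by have := actL x 1 0 0; rewrite !scale1r addr0 => /eqP; rewrite -subr_eq subrr eq_sym => /eqP. Qed.
Let actD x f h : act x (f + h) = act x f + act x h.
Proof. by rewrite -[f]scale1r actL !scale1r. Qed.
Let actB x f h : act x (f - h) = act x f - act x h.
Proof. by rewrite addrC -scaleN1r actL scaleN1r addrC. Qed.
Let actDx x y f : act (x + y) f = act x f + act y f.
Proof. by rewrite -[x]scale1r actLx !scale1r. Qed.
Let actBx x y f : act (x - y) f = act x f - act y f.
Proof. by rewrite addrC -scaleN1r actLx scaleN1r addrC. Qed.

Let baa : brsub B b a a.
Proof. by move=> x y hx hy; apply: (subvP Na); apply: ba. Qed.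

Let act_br x y f : x \in a -> y \in a ->
  act (B x y) f = act x (act y f) - act y (act x f).
Proof.
move=> hx hy; apply: funext => w; elim: w x y f hx hy => [|z w IH] x y f hx hy.
  by rewrite !FBE !act_nil ra.
have hzx : B (vsval z) x \in a by apply: baa; rewrite ?subvsP.
have hzy : B (vsval z) y \in a by apply: baa; rewrite ?subvsP.
rewrite !FBE !act_cons !shact !actD (brJ HB) actDx.
by rewrite !FDE (IH x y) // (IH (B _ x) y) // (IH x (B _ y)) // !FBE; zmod.
Qed.

Let brb (y z : bT) : bT := vsproj b (B (vsval y) (vsval z)).

Let brbE y z : vsval (brb y z) = B (vsval y) (vsval z).
Proof. by rewrite vsprojK // bb // subvsP. Qed.

(** Words are read in reverse: [sh y (sh z f)] evaluates f at words starting with z, y. This fixes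
    the sign in the second condition, which makes [sh] a representation of b; the first condition is
    linearity in every letter. *)
Let cocomp (f : F) := forall u : seq bT,
  (forall c x y w, f (u ++ (c *: x + y) :: w) = c *: f (u ++ x :: w) + f (u ++ y :: w)) /\
  (forall y z w, f (u ++ brb y z :: w) = f (u ++ z :: y :: w) - f (u ++ y :: z :: w)).

Let comp_sh y f : cocomp f -> cocomp (sh y f).
Proof. by move=> hf u; exact: (hf (y :: u)). Qed.

Let compL c f h : cocomp f -> cocomp h -> cocomp (c *: f + h).
Proof.
move=> hf hh u; have [f1 f2] := hf u; have [h1 h2] := hh u; split.
- move=> d x y w; rewrite !FE f1 h1 !scalerDr !scalerA [d * c]mulrC; zmod.
- move=> y z w; rewrite !FE f2 // h2 // scalerBr; zmod.
Qed.

Let comp_act x f : x \in a -> cocomp f -> cocomp (act x f).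
Proof.
move=> hx hf u; elim: u x f hx hf => [|v u IH] x f hx hf.
  have [f1 f2] := hf [::].
  split=> [c y z w|y z w]; rewrite !cat0s.
    rewrite !act_cons (_ : vsval (c *: y + z) = c *: vsval y + vsval z) // lfun2D lfun2Z actLx.
    have -> : sh (c *: y + z) f = c *: sh y f + sh z f by apply: funext => t; rewrite FE; apply: f1.
    by rewrite actL !FE scalerDr; zmod.
  rewrite !act_cons brbE.
  have -> : sh (brb y z) f = sh y (sh z f) - sh z (sh y f).
    by apply: funext => t; rewrite FBE; have := f2 y z t; rewrite !cat0s => e; rewrite /sh e.
  have -> : B (B (vsval y) (vsval z)) x = B (vsval y) (B (vsval z) x) - B (vsval z) (B (vsval y) x).
    by rewrite [B _ (B (vsval z) x)](brJ HB) addrK.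
  by rewrite actB actBx !FBE; zmod.
have [p1 p2] := IH x (sh v f) hx (comp_sh v hf).
have [q1 q2] := IH (B (vsval v) x) f (baa (subvsP v) hx) hf.
split=> [c y z w|y z w]; rewrite !cat_cons !act_cons.
- rewrite p1 q1 scalerDr; zmod.
- rewrite p2 // q2 //; zmod.
Qed.

(** Level j of the filtration of V: the vectors killed by all words of length j in N. *)
Let kil j (v : V) := forall s, size s = j -> {subset s <= N} -> wact r s v = 0.

Let kilL j c u v : kil j u -> kil j v -> kil j (c *: u + v).
Proof. by move=> hu hv s hs sN; rewrite wact_linear hu // hv // scaler0 addr0. Qed.

Let kilN j x v : x \in N -> kil j.+1 v -> kil j (r x v).
Proof.
move=> hx hv s hs sN; rewrite -wact_rcons; apply: hv; first by rewrite size_rcons hs.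
by move=> z; rewrite mem_rcons inE => /orP[/eqP ->|/sN].
Qed.

(** Moving x past the last letter z of a word costs a term in [B x z], which is again in N because N
    is an ideal of a. *)
Let kila j x v : x \in a -> kil j v -> kil j (r x v).
Proof.
elim: j v => [|j IH] v hx hv s.
  have -> : v = 0 by exact: (hv [::]).
  by rewrite linear0 wact0.
case/lastP: s => // s z; rewrite size_rcons => -[hs] sN.
have hz : z \in N by apply: sN; rewrite mem_rcons mem_head.
have sN' : {subset s <= N} by move=> t ht; apply: sN; rewrite mem_rcons inE ht orbT.
have hxz : B x z \in N by exact: aN.
have -> : wact r (rcons s z) (r x v) = wact r s (r x (r z v)) - wact r s (r (B x z) v).
  rewrite wact_rcons ra ?(subvP Na z) //.
  have e u w : wact r s (u - w) = wact r s u - wact r s w.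
    by rewrite addrC -scaleN1r wact_linear scaleN1r addrC.
  by rewrite -e opprB addrC subrK.
rewrite (IH _ hx (kilN hz hv)) // (kilN hxz hv) //; by rewrite subr0.
Qed.

(** Along a word the action of x only involves x and its brackets with letters of b, and these stay
    in N because [b, a] lies in N. *)
Let actN j (f : F) x w : x \in N -> (forall w, kil j.+1 (f w)) -> kil j (act x f w).
Proof.
elim: w x f => [|y w IHw] x f hx hf; first by rewrite act_nil; exact: kilN.
rewrite act_cons -[act x _ w]scale1r; apply: kilL; apply: IHw => //.
  by move=> t; exact: hf.
by apply: ba; rewrite ?subvsP // (subvP Na).
Qed.

Let inspan_sh y l f : (forall h, h \in l -> inspan l (sh y h)) ->
  inspan l f -> inspan l (sh y f).
Proof.
move=> hl hf; apply: (hf (fun f => inspan l (sh y f))) => [|c u v hu hv|//].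
  exact: inspan0.
by rewrite shL; exact: inspanL.
Qed.

Let inspan_act (l l' : seq F) : (forall x f, x \in vbasis a -> f \in l -> inspan l' (act x f)) ->
  forall x f, x \in a -> inspan l f -> inspan l' (act x f).
Proof.
move=> h x f hx hf; rewrite (coord_vbasis hx).
have e (I : Type) (s : seq I) (G : I -> K) (X : I -> g) :
    act (\sum_(i <- s) G i *: X i) f = \sum_(i <- s) G i *: act (X i) f.
  elim: s => [|i s IH]; last by rewrite !big_cons actLx IH.
  by rewrite !big_nil; have := actBx 0 0 f; rewrite !subrr.
rewrite e; apply: inspan_sum => i _; apply: inspanZ.
have hi : (vbasis a)`_i \in vbasis a by rewrite mem_nth // size_tuple.
apply: (hf (fun f => inspan l' (act _ f))) => [|c u v hu hv|u hu].
- by rewrite act0; exact: inspan0.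
- by rewrite actL; exact: inspanL.
- exact: h.
Qed.

Let post (T : 'End(V)) (f : F) : F := fun w => T (f w).

Let postL T c f h : post T (c *: f + h) = c *: post T f + post T h.
Proof. by apply: funext => w; rewrite /post FE linearP. Qed.

Let inspan_post (l l' : seq F) (T : 'End(V)) : (forall f, f \in l -> inspan l' (post T f)) ->
  forall f, inspan l f -> inspan l' (post T f).
Proof.
move=> h f hf; apply: (hf (fun f => inspan l' (post T f))) => [|c u v hu hv|//].
- have -> : post T 0 = 0 by apply: funext => w; rewrite /post [LHS]linear0.
  exact: inspan0.
- by rewrite postL; exact: inspanL.
Qed.

(** Induction on a level j containing all values of l; at level 0 all functions vanish. The property
    [Q] rides along, since the final representation needs its space to consist of functions
    satisfying it. *)
Let stable_ext (Q : F -> Prop)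
  (QL : forall c f h, Q f -> Q h -> Q (c *: f + h))
  (QT : forall T f, Q f -> Q (post T f))
  (Qact : forall x f, x \in a -> Q f -> Q (act x f)) j (l : seq F) : (forall f, f \in l -> Q f) ->
  (forall f w, f \in l -> kil j (f w)) ->
  (forall y f, f \in l -> inspan l (sh y f)) ->
  exists l' : seq F, [/\ forall f, f \in l' -> Q f,
    forall f, f \in l -> inspan l' f,
    forall y f, f \in l' -> inspan l' (sh y f) &
    forall x f, x \in a -> f \in l' -> inspan l' (act x f)].
Proof.
elim: j l => [|j IH] l lQ lk lb.
  exists l; split=> // [f|x f hx hf]; first exact: inspan_mem.
  have -> : f = 0 by apply: funext => w; apply: (lk f w hf [::]).
  by rewrite act0; exact: inspan0.
have [U hU] : exists U : {vspace V}, forall v, v \in U <-> kil j.+1 v.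
  by apply: prop_vspace => [s _ _|]; [rewrite wact0 | exact: kilL].
(* Composing with every endomorphism and projecting to level j + 1 closes the family under all
   post-compositions that respect the level, and finitely many generators remain enough. *)
pose E (T : 'End(V)) : 'End(V) := (projv U \o T)%VF.
pose l1 := [seq post (E T) f | T <- vbasis {:'End(V)}, f <- l].
have l1k f w : f \in l1 -> kil j.+1 (f w).
  by move=> /allpairsP [[T h] /= [_ _ ->]]; apply/hU; rewrite /post comp_lfunE memv_proj.
have l1k' f w : inspan l1 f -> kil j.+1 (f w).
  move=> hf; apply: (hf (fun f => kil j.+1 (f w))) => [s _ _|c u v hu hv|u hu].
  - exact: wact0.
  - by rewrite FE; exact: kilL.
  - exact: l1k.
have inE1 T f : f \in l -> inspan l1 (post (E T) f).
  move=> hf; rewrite (coord_vbasis (memvf T)).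
  set c := coord _; have -> : post (E (\sum_(i < _) c i T *: (vbasis {:'End(V)})`_i)) f =
     \sum_(i < \dim {:'End(V)}) c i T *: post (E (vbasis {:'End(V)})`_i) f.
    apply: funext => w; rewrite /post /E comp_lfunE sum_lfunE linear_sum fct_sumE.
    by apply: eq_bigr => i _; rewrite scale_lfunE linearZ /= -comp_lfunE.
  apply: inspan_sum => i _; apply: inspanZ; apply: inspan_mem.
  by apply: allpairs_f => //; rewrite mem_nth // size_tuple.
have inE2 (T : 'End(V)) f : inspan l1 f -> (forall w, kil j.+1 (T (f w))) -> inspan l1 (post T f).
  move=> hf hT; have -> : post T f = post (E T) f.
    by apply: funext => w; rewrite /post comp_lfunE projv_id //; apply/hU.
  move: hf; apply: inspan_post => h /allpairsP [[T' h'] /= [_ hh' ->]].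
  have -> : post (E T) (post (E T') h') = post (E (T \o E T')%VF) h'.
    by apply: funext => w; rewrite /post !comp_lfunE.
  exact: inE1.
have ll1 f : f \in l -> inspan l1 f.
  move=> hf; have -> : f = post (E \1%VF) f.
    by apply: funext => w; rewrite /post comp_lfunE id_lfunE projv_id //; apply/hU/lk.
  exact: inE1.
have l1b y f : f \in l1 -> inspan l1 (sh y f).
  move=> /allpairsP [[T h] /= [_ hh ->]].
  have -> : sh y (post (E T) h) = post (E T) (sh y h) by [].
  by have := lb y h hh; apply: inspan_post => k hk; exact: inE1.
have l1Q f : f \in l1 -> Q f.
  by move=> /allpairsP [[T h] /= [_ hh ->]]; apply: QT; exact: lQ.
(* Both families take values in level j. The second is there for stability under [sh]: shifting
   [act x f - post (r x) f] by y leaves a term [post (r (B y x)) f] with [B y x] in N. *)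
pose l2 := [seq act x f - post (r x) f | x <- vbasis a, f <- l1] ++
           [seq post (r x) f | x <- vbasis N, f <- l1].
have QB (f h : F) : Q f -> Q h -> Q (f - h).
  by move=> hf hh; rewrite addrC -scaleN1r; exact: QL.
have in2N x (f : F) : x \in N -> f \in l1 -> inspan l2 (post (r x) f).
  move=> hx hf; rewrite (coord_vbasis hx).
  set c := coord _; have -> : post (r (\sum_(i < _) c i x *: (vbasis N)`_i)) f =
     \sum_(i < \dim N) c i x *: post (r (vbasis N)`_i) f.
    apply: funext => w; rewrite /post lfun2_sum fct_sumE.
    by apply: eq_bigr => i _; rewrite lfun2Z.
  apply: inspan_sum => i _; apply: inspanZ; apply: inspan_mem.
  rewrite mem_cat; apply/orP; right.
  by apply: allpairs_f => //; rewrite mem_nth // size_tuple.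
have in2N' x (f : F) : x \in N -> inspan l1 f -> inspan l2 (post (r x) f).
  by move=> hx; apply: inspan_post => h; exact: in2N.
have in2a x (f : F) : x \in a -> f \in l1 -> inspan l2 (act x f - post (r x) f).
  move=> hx hf; rewrite (coord_vbasis hx).
  set c := coord _.
  have -> : act (\sum_(i < _) c i x *: (vbasis a)`_i) f -
      post (r (\sum_(i < _) c i x *: (vbasis a)`_i)) f =
     \sum_(i < \dim a) c i x *: (act (vbasis a)`_i f - post (r (vbasis a)`_i) f).
    apply: (big_ind2 (fun X Y => act X f - post (r X) f = Y)) => [|X1 Y1 X2 Y2 <- <-|i _].
    - have -> : act 0 f = 0 by have := actBx 0 0 f; rewrite !subrr.
      by apply: funext => w; rewrite FBE /post lfun20 subrr.
    - rewrite actDx; apply: funext => w; rewrite !FDE !FNE /post lfun2D; zmod.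
    - apply: funext => w; rewrite /post FBE lfun2Z.
      have -> : act (c i x *: (vbasis a)`_i) f = c i x *: act (vbasis a)`_i f.
        have -> : c i x *: (vbasis a)`_i = c i x *: (vbasis a)`_i + (0 - 0) by rewrite subrr addr0.
        by rewrite actLx actBx subrr addr0.
      by rewrite -scalerBr.
  apply: inspan_sum => i _; apply: inspanZ; apply: inspan_mem.
  rewrite mem_cat; apply/orP; left.
  by apply: allpairs_f => //; rewrite mem_nth // size_tuple.
have in2a' x (f : F) : x \in a -> inspan l1 f -> inspan l2 (act x f - post (r x) f).
  move=> hx hf; apply: (hf (fun f => inspan l2 (act x f - post (r x) f))) => //.
  - have -> : act x 0 - post (r x) 0 = 0.
      by rewrite act0; apply: funext => w; rewrite FBE /post [X in _ - X]linear0 subr0.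
    exact: inspan0.
  - move=> c u v hu hv; rewrite actL postL.
    have -> : c *: act x u + act x v - (c *: post (r x) u + post (r x) v) =
      c *: (act x u - post (r x) u) + (act x v - post (r x) v).
      by rewrite scalerBr; zmod.
    exact: inspanL.
  - by move=> u; exact: in2a.
have actd (f : F) x w : x \in a -> (forall w, kil j.+1 (f w)) ->
    kil j (act x f w - r x (f w)).
  elim: w x f => [|y w IHw] x f hx hf.
    by rewrite act_nil subrr => s _ _; rewrite wact0.
  rewrite act_cons.
  have -> : act x (sh y f) w + act (B (vsval y) x) f w - r x (f (y :: w)) =
    1 *: act (B (vsval y) x) f w + (act x (sh y f) w - r x (sh y f w)).
    by rewrite scale1r /sh; zmod.
  apply: kilL; last by apply: IHw => // t; exact: hf.
  by apply: actN => //; apply: ba; rewrite ?subvsP.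
have [||y f|l3 [l3Q l23 l3b l3a]] := IH l2.
- move=> f; rewrite mem_cat => /orP[] /allpairsP [[x h] /= [hx hh ->]].
    by apply: QB; [apply: Qact; [exact: vbasis_mem | exact: l1Q] | apply: QT; exact: l1Q].
  by apply: QT; exact: l1Q.
- move=> f w; rewrite mem_cat => /orP[] /allpairsP [[x h] /= [hx hh ->]]; last first.
    by apply: kilN; [exact: vbasis_mem | exact: l1k].
  rewrite FBE; apply: actd; first exact: vbasis_mem.
  by move=> t; exact: l1k.
- rewrite mem_cat => /orP[] /allpairsP [[x h] /= [/vbasis_mem hx hh ->]]; last first.
    have -> : sh y (post (r x) h) = post (r x) (sh y h) by [].
    by apply: in2N' => //; exact: l1b.
  have hyx : B (vsval y) x \in N by apply: ba; rewrite ?subvsP.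
  have -> : sh y (act x h - post (r x) h) = (act x (sh y h) - post (r x) (sh y h)) +
     ((act (B (vsval y) x) h - post (r (B (vsval y) x)) h) + post (r (B (vsval y) x)) h).
    by rewrite -[LHS]/(sh y (act x h) - post (r x) (sh y h)) shact; zmod.
  apply: inspanD; first by apply: in2a' => //; exact: l1b.
  apply: inspanD; first by apply: in2a => //; exact: (subvP Na).
  exact: in2N.
have s1 f : inspan l1 f -> inspan (l1 ++ l3) f.
  by apply: inspan_sub => u hu; apply: inspan_mem; rewrite mem_cat hu.
have s3 f : inspan l3 f -> inspan (l1 ++ l3) f.
  by apply: inspan_sub => u hu; apply: inspan_mem; rewrite mem_cat hu orbT.
exists (l1 ++ l3); split.
- by move=> f; rewrite mem_cat => /orP[/l1Q|/l3Q].
- by move=> f /ll1 /s1.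
- by move=> y f; rewrite mem_cat => /orP[/l1b /s1|/l3b /s3].
- move=> x f hx; rewrite mem_cat => /orP[hf|/l3a /s3]; last by apply.
  have -> : act x f = (act x f - post (r x) f) + post (r x) f by rewrite subrK.
  apply: inspanD.
    by apply: s3; have := in2a x f hx hf; apply: inspan_sub.
  apply: s1; apply: inE2; first exact: inspan_mem.
  by move=> w; apply: kila => //; exact: l1k.
Qed.

(** The copy of V inside the coinduced module: functions supported on the empty word, which every
    shift kills. *)
Let cst (v : V) : F := fun w => if w is [::] then v else 0.

Let cstL c u v : cst (c *: u + v) = c *: cst u + cst v.
Proof. by apply: funext => -[|y w]; rewrite FE //= scaler0 addr0. Qed.

Let iter_sh m y w f : iter m (sh y) f w = f (nseq m y ++ w).
Proof. by elim: m w f => // m IH w f; rewrite iterSr IH. Qed.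

Let shnil y f := (exists m, forall x, x \in a -> iter m (B (vsval y)) x = 0) ->
  exists m, iter m (sh y) f = 0.

Let iter0 m y : iter m (sh y) 0 = 0.
Proof. by elim: m => // m IH; rewrite iterS IH. Qed.

Let iter_le m n y f : (m <= n)%N -> iter m (sh y) f = 0 -> iter n (sh y) f = 0.
Proof. by move=> /subnK <- h; rewrite iterD h iter0. Qed.

Let iterL m y c f h : iter m (sh y) (c *: f + h) = c *: iter m (sh y) f + iter m (sh y) h.
Proof. by elim: m => // m IH; rewrite !iterS IH shL. Qed.

(** The shift by y is a derivation for the action: it hits either f or x. After p + m shifts f has
    been hit m times or x has been hit p times, and each of these gives 0. *)
Let shnil_act y x f : x \in a -> shnil y f -> shnil y (act x f).
Proof.
move=> hx hf /[dup] /hf [m hm] [p hp]; exists (p + m)%N; move/(_ x hx): hp.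
move: {hf hx} (erefl (p + m)%N); move: {2}(p + m)%N => n.
elim: n p m x f hm => [|n IH] p m x f hm e hp.
  by move: e hm => /eqP; rewrite addn_eq0 => /andP [_ /eqP ->] /= ->; rewrite act0 iter0.
case: p e hp => [|p] e hp; first by rewrite -[x]/(iter 0 (B (vsval y)) x) hp (_ : act 0 f = 0) ?iter0 //;
  have := actBx 0 0 f; rewrite !subrr.
case: m e hm => [|m] e hm; first by rewrite -[f]/(iter 0 (sh y) f) hm act0 iter0.
rewrite addSn iterSr shact -[act x _]scale1r iterL scale1r.
rewrite (_ : (p + m.+1)%N = (p.+1 + m)%N) ?addnS //.
rewrite IH ?add0r //; last 2 first.
- by rewrite -iterSr.
- by move: e; rewrite addnS => -[].
rewrite addSnnS IH //; first by move: e; rewrite addSn => -[].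
by rewrite -iterSr.
Qed.

(** Evaluation at the empty word intertwines the two actions of a, so [cst v] witnesses that c still
    acts nontrivially. The last conclusion lets a line b join the nilpotent part afterwards. *)
Lemma zassenhaus_extension k : nilact N r k ->
  exists (V' : vectType K) (r' : 'Hom(g, 'End(V'))),
  [/\ is_rep B (a + b)%VS r', nilact N r' k,
      forall c v, c \in a -> r c v != 0 -> exists u, r' c u != 0 &
      forall y, y \in b -> (exists m, forall x, x \in a -> iter m (B y) x = 0) ->
        forall u, exists m, iter m (r' y) u = 0].
Proof.
move=> nilr.
pose Q f := cocomp f /\ (forall y, shnil y f).
have Q0 : Q 0.
  split=> [u|y _]; last by exists 0%N.
  by split=> [c x y w|x y w]; rewrite [LHS]/(0 : V) ?[0 _]/(0 : V) ?scaler0 ?addr0 ?subr0.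
have QL c f h : Q f -> Q h -> Q (c *: f + h).
  move=> [f1 f2] [h1 h2]; split; first exact: compL.
  move=> y /[dup] /f2 [m hm] /h2 [n hn]; exists (m + n)%N.
  by rewrite iterL (iter_le _ hm) ?leq_addr // (iter_le _ hn) ?leq_addl // scaler0 addr0.
have QT T f : Q f -> Q (post T f).
  move=> [f1 f2]; split=> [u|y /f2 [m hm]].
    have [e1 e2] := f1 u.
    split=> [c x y w|x y w]; first by rewrite /post e1 linearP.
    by rewrite /post e2 linearB.
  exists m; apply: funext => w; rewrite iter_sh /post -iter_sh hm.
  by rewrite [LHS]linear0.
have Qact x f : x \in a -> Q f -> Q (act x f).
  by move=> hx [f1 f2]; split=> [|y]; [exact: comp_act | exact: shnil_act].
pose l0 := [seq cst v | v <- vbasis {:V}].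
have sh_cst y v : sh y (cst v) = 0 by [].
have [l' [l'Q l0l' l'b l'a]] : exists l' : seq F, [/\ forall f, f \in l' -> Q f,
    forall f, f \in l0 -> inspan l' f,
    forall y f, f \in l' -> inspan l' (sh y f) &
    forall x f, x \in a -> f \in l' -> inspan l' (act x f)].
  apply: (stable_ext QL QT Qact (j := k)).
  - move=> f /mapP [v _ ->]; split=> [u|y _]; last by exists 1%N.
    by case: u => [|z u]; split=> *; rewrite /= ?scaler0 ?addr0 ?subr0.
  - by move=> f w _ s hs sN; apply: nilr.
  - by move=> y f /mapP [v _ ->]; rewrite sh_cst; exact: inspan0.
have [d [e [le ie he]]] := inspan_coords l'.
have eQ u : Q (e u).
  have : inspan l' (e u) by apply/he; exists u.
  by move=> h; apply: (h Q).
(* An element of a + b acts through its a-component by [act] and through its b-component by the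
   shift. *)
pose lb z : bT := vsproj b (daddv_pi b a z).
pose op z f := act (daddv_pi a b z) f + sh (lb z) f.
have ba0 : (b :&: a = 0)%VS by rewrite capvC.
have opE x y f : x \in a -> op (x + vsval y) f = act x f + sh y f.
  move=> hx; rewrite /op /lb !linearD /= (daddv_pi_id ab0 hx) (daddv_pi_id ba0 (subvsP y)).
  have p1 : daddv_pi a b (vsval y) = 0.
    have yab : vsval y \in (a + b)%VS by apply: (subvP (addvSr a b)); exact: subvsP.
    have := daddv_pi_add ab0 yab; rewrite (daddv_pi_id ba0 (subvsP y)) => h.
    by apply: (addIr (vsval y)); rewrite h add0r.
  have p2 : daddv_pi b a x = 0.
    have xab : x \in (a + b)%VS by apply: (subvP (addvSl a b)).
    have := daddv_pi_add ab0 xab; rewrite (daddv_pi_id ab0 hx) => h.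
    by apply: (addrI x); rewrite h addr0.
  by rewrite p1 p2 linear0 addr0 add0r vsvalK.
have opL z c f h : op z (c *: f + h) = c *: op z f + op z h.
  by rewrite /op actL shL scalerDr; zmod.
have opLz f c z z' : Q f -> op (c *: z + z') f = c *: op z f + op z' f.
  move=> [hf _]; rewrite /op linearP actLx /lb !linearP.
  have -> : sh (c *: lb z + lb z') f = c *: sh (lb z) f + sh (lb z') f.
    by apply: funext => t; rewrite FE; have [h _] := hf [::]; apply: h.
  by rewrite scalerDr; zmod.
have op_in z u : exists u', e u' = op z (e u).
  suff : inspan l' (op z (e u)) by move=> /he [u' ->]; exists u'.
  have hu : inspan l' (e u) by apply/he; exists u.
  apply: inspanD; last by apply: inspan_sh => // f; exact: l'b.
  apply: inspan_act hu; last exact: memv_pi.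
  by move=> x f /vbasis_mem; exact: l'a.
pose h z u := projT1 (cid (op_in z u)).
have hE z u : e (h z u) = op z (e u) by rewrite /h; case: cid.
have [|| r' r'E] := @bilinear_lfun K g _ _ h.
- by move=> c x y w; apply: ie; rewrite hE le !hE opLz.
- by move=> c x w w'; apply: ie; rewrite hE !le !hE opL.
have er z u : e (r' z u) = op z (e u) by rewrite r'E hE.
have eB u v : e (u - v) = e u - e v.
  by have := le (-1) v u; rewrite !scaleN1r [- v + u]addrC [- e v + e u]addrC.
have e0 : e 0 = 0 by have := eB 0 0; rewrite !subrr.
have opa x f : x \in a -> op x f = act x f + sh 0 f.
  by move=> hx; rewrite -{1}[x]addr0 -[0 in LHS]/(vsval (0 : bT)) opE.
(* Shifting by the letter 0 is the zero map only on functions linear in their first letter. *)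
have sh0 u : sh 0 (e u) = 0.
  have [hu _] := (eQ u).1 [::].
  apply: funext => w; have := hu 1 0 0 w; rewrite !scale1r addr0 !cat0s => /eqP.
  by rewrite -subr_eq subrr eq_sym => /eqP.
have era x u : x \in a -> e (r' x u) = act x (e u) by move=> hx; rewrite er opa // sh0 addr0.
exists ('rV[K]_d : vectType K), r'; split.
- move=> z z' /memv_addP [x hx [y hy ->]] /memv_addP [x' hx' [y' hy' ->]] u.
  apply: ie; rewrite eB !er.
  have -> : y = vsval (vsproj b y) by rewrite vsprojK.
  have -> : y' = vsval (vsproj b y') by rewrite vsprojK.
  move: (vsproj b y) (vsproj b y') => {hy hy'} {}y {}y'.
  have -> : B (x + vsval y) (x' + vsval y') =
     B x x' - B (vsval y') x + B (vsval y) x' + vsval (brb y y').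
    rewrite brbE !lfun2D !linearD /= [B x (vsval y')](brC HB); zmod.
  have hyx : B (vsval y') x \in a by apply: baa; rewrite ?subvsP.
  have hyx' : B (vsval y) x' \in a by apply: baa; rewrite ?subvsP.
  have hA : B x x' - B (vsval y') x + B (vsval y) x' \in a.
    by apply: memvD => //; apply: memvB => //; exact: aa.
  rewrite (opE _ _ _ hA) (opE _ _ _ hx) !(opE _ _ _ hx') (opE _ _ _ hx) actDx actBx act_br // !actD.
  rewrite -![sh _ (_ + _)]/(sh _ _ + sh _ _) !shact.
  have -> : sh (brb y y') (e u) = sh y (sh y' (e u)) - sh y' (sh y (e u)).
    by apply: funext => t; rewrite FBE; have [_ h2] := (eQ u).1 [::]; apply: h2.
  zmod.
- move=> s hs sN u; apply: ie; rewrite e0; apply: funext => w.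
  suff main j t : {subset t <= N} -> (forall w, kil (size t + j) (e u w)) ->
      forall w, kil j (e (wact r' t u) w).
    apply: (main 0%N s sN _ w [::]) => // w' t; rewrite addn0 hs => ht tN; exact: nilr.
  elim: t j => [|x t IH] j tN hu //=.
  have hx : x \in N by apply: tN; rewrite mem_head.
  move=> w'; rewrite era ?(subvP Na) //; apply: actN => // t'.
  apply: IH; first by move=> z hz; apply: tN; rewrite inE hz orbT.
  by rewrite addnS -addSn.
- move=> c v hc hv.
  have : inspan l' (cst v).
    have : inspan l0 (cst v).
      rewrite {hv} (coord_vbasis (memvf v)).
      apply: (big_ind (fun v => inspan l0 (cst v))) => [|u u' hu hu'|i _].
      - have -> : cst 0 = 0 by apply: funext => -[].
        exact: inspan0.
      - by rewrite -[u]scale1r cstL; apply: inspanL.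
      - rewrite -[_ *: _]addr0 cstL (_ : cst 0 = 0); last by apply: funext => -[].
        rewrite addr0; apply: inspanZ; apply: inspan_mem; apply: map_f.
        by rewrite mem_nth // size_tuple.
    by apply: inspan_sub.
  move=> /he [u hu]; exists u; apply: contra_neq hv => h0.
  have := era c u hc; rewrite h0 e0 -hu => /(congr1 (fun f : F => f [::])).
  by rewrite act_nil => <-.
- move=> y hy /= hn u; have [_ hs] := eQ u.
  have yE : vsval (vsproj b y) = y by rewrite vsprojK.
  have [|m hm] := hs (vsproj b y); first by rewrite yE.
  exists m; apply: ie; rewrite e0 -[RHS]hm; elim: m {hm} => // m IH.
  have ery v : e (r' y v) = sh (vsproj b y) (e v).
    rewrite er -{1}yE -[vsval _]add0r opE ?mem0v //.
    have -> : act 0 (e v) = 0 by have := actBx 0 0 (e v); rewrite !subrr.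
    by rewrite add0r.
  by rewrite !iterS ery IH.
Qed.

End Zassenhaus.

(** * Traces *)

Section TracePowers.
Variable K : numFieldType.

(** Write E = C R with C of full column rank and R of full row rank. Idempotence forces R C = 1, and
    tr (C R) = tr (R C). *)
Lemma idempotent_trace n (E : 'M[K]_n) : E *m E = E -> \tr E = (\rank E)%:R.
Proof.
move=> EE; rewrite -[E in \tr E]mulmx_base mxtrace_mulC.
have -> : row_base E *m col_base E = 1%:M.
  apply: (row_free_inj (row_base_free E)); apply: (row_full_inj (col_base_full E)).
  by rewrite mul1mx -[row_base E *m _ *m _]mulmxA mulmx_base mulmxA mulmx_base.
by rewrite mxtrace1.
Qed.

(** No eigenvalues are needed. Write the characteristic polynomial as q X^e with q(0) nonzero and 1
    = a X^(e+1) + b q. Then a X^(e+1) at A is the projection to the part where A is invertible; it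
    combines positive powers of A (hence e + 1, as e may be 0), so its trace, which is its rank, is
    0. *)
Lemma trace_powers n (A : 'M[K]_n) :
  (forall m, \tr (A ^+ m.+1) = 0) -> exists k, A ^+ k = 0.
Proof.
case: n A => [|n] A trA; first by exists 0%N; rewrite [RHS]flatmx0 [LHS]flatmx0.
 have p0 : char_poly A != 0 by apply: monic_neq0; exact: char_poly_monic.
have [e [q]] := multiplicity_XsubC (char_poly A) 0.
rewrite p0 /= subr0 => q0 pE.
have cop : coprimep 'X^(e.+1) q.
  by apply: coprimep_expl; rewrite coprimep_sym coprimepX.
have [[a b] /= ab] := Bezout_eq1_coprimepP _ _ cop.
have qA : horner_mx A (q * 'X^(e.+1)) = 0.
  by rewrite exprSr mulrA -pE rmorphM /= Cayley_Hamilton mul0r.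
pose E := horner_mx A (a * 'X^(e.+1)).
have E0 : E = 0.
  apply/eqP; rewrite -mxrank_eq0 -(@pnatr_eq0 K) -idempotent_trace; last first.
    have : E * (1 - E) = 0.
      rewrite /E -[1 in X in _ * X](rmorph1 (horner_mx A)) -rmorphB -ab addrAC subrr add0r -rmorphM.
      rewrite (_ : a * 'X^(e.+1) * (b * q) = a * b * (q * 'X^(e.+1))); last by ring.
      by rewrite rmorphM /= qA mulr0.
    by rewrite mulrBr mulr1 => /eqP; rewrite subr_eq0 => /eqP h; exact: (esym h).
  rewrite /E -[a]coefK poly_def mulr_suml rmorph_sum raddf_sum /= big1 // => i _.
  rewrite -scalerAl -exprD linearZ /= rmorphXn /= horner_mx_X addnS.
  by rewrite linearZ /= trA mulr0.
exists e.+1; rewrite -(horner_mx_X A) -rmorphXn /=.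
rewrite -['X^_]mul1r -ab mulrDl rmorphD rmorphM /= -/E E0 mul0r add0r.
rewrite -mulrA rmorphM /= qA mulr0 //.
Qed.

End TracePowers.

Section LfunMatrix.
Import VectorInternalTheory.

Lemma mul_f2mx (K : fieldType) (V W : vectType K) (f : 'Hom(V, W)) (u : 'rV_(dim V)) :
  u *m f2mx f = v2r (f (r2v u)).
Proof. by rewrite unlock /= !r2vK. Qed.

Lemma f2mxM (K : fieldType) (V W Z : vectType K) (f : 'Hom(W, Z)) (h : 'Hom(V, W)) :
  f2mx (f \o h)%VF = f2mx h *m f2mx f.
Proof.
by apply/row_matrixP => i; rewrite !rowE mulmxA !mul_f2mx comp_lfunE v2rK.
Qed.

End LfunMatrix.

Definition ltr (K : fieldType) (V : vectType K) (f : 'End(V)) : K := \tr (VectorInternalTheory.f2mx f).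

Section LfunTrace.
Import VectorInternalTheory.
Variables (K : fieldType) (V : vectType K).
Implicit Types f h : 'End(V).

Lemma ltrC f h : ltr (f \o h)%VF = ltr (h \o f)%VF.
Proof. by rewrite /ltr !f2mxM mxtrace_mulC. Qed.

Lemma f2mxL c f h : f2mx (c *: f + h) = c *: f2mx f + f2mx h.
Proof.
apply/row_matrixP => i; rewrite !rowE; set u := delta_mx 0 i.
by rewrite mulmxDr -scalemxAr !mul_f2mx add_lfunE scale_lfunE linearP.
Qed.

Lemma f2mxB f h : f2mx (f - h) = f2mx f - f2mx h.
Proof. by rewrite addrC -scaleN1r f2mxL scaleN1r addrC. Qed.

Lemma f2mx0 : f2mx (0 : 'End(V)) = 0.
Proof. by have := f2mxB (0 : 'End(V)) 0; rewrite !subrr. Qed.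

Lemma f2mx_sum (I : finType) (a : I -> K) (G : I -> 'End(V)) :
  f2mx (\sum_i a i *: G i) = \sum_i a i *: f2mx (G i).
Proof. by elim/big_rec2: _ => [|i x y _ <-]; rewrite ?f2mx0 // f2mxL. Qed.

Lemma ltrL c f h : ltr (c *: f + h) = c * ltr f + ltr h.
Proof. by rewrite /ltr f2mxL mxtraceD mxtraceZ. Qed.

Lemma ltrD f h : ltr (f + h) = ltr f + ltr h.
Proof. by rewrite -[f]scale1r ltrL mul1r scale1r. Qed.

Lemma ltr0 : ltr (0 : 'End(V)) = 0.
Proof. by have := ltrL (-1) 0 0; rewrite scaleN1r addNr mulN1r addNr. Qed.

Lemma ltrZ c f : ltr (c *: f) = c * ltr f.
Proof. by rewrite -[c *: f]addr0 ltrL ltr0 addr0. Qed.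

Lemma ltrB f h : ltr (f - h) = ltr f - ltr h.
Proof. by rewrite addrC -scaleN1r ltrL mulN1r addrC. Qed.

Lemma ltr_sum (I : Type) (s : seq I) (P : pred I) (G : I -> 'End(V)) :
  ltr (\sum_(i <- s | P i) G i) = \sum_(i <- s | P i) ltr (G i).
Proof.
by apply: (big_morph (@ltr K V)); [exact: ltrD | exact: ltr0].
Qed.

Definition lpow f m : 'End(V) := iter m (fun h => (f \o h)%VF) \1%VF.

Lemma lpowE f m v : lpow f m v = iter m f v.
Proof. by elim: m => [|m IH] /=; rewrite ?id_lfunE // comp_lfunE IH. Qed.

Lemma f2mx1 : f2mx (\1%VF : 'End(V)) = 1%:M.
Proof.
apply/row_matrixP => i; rewrite !rowE mulmx1; set u := delta_mx 0 i.
by rewrite mul_f2mx id_lfunE r2vK.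
Qed.

Lemma f2mx_lpow f m : f2mx (lpow f m) = f2mx f ^+ m.
Proof. by elim: m => [|m IH] /=; rewrite ?f2mx1 // f2mxM IH exprSr. Qed.

Lemma lpow_nil f k : f2mx f ^+ k = 0 -> forall v, iter k f v = 0.
Proof.
by move=> h v; rewrite -lpowE unlock /= f2mx_lpow h mulmx0 linear0.
Qed.

End LfunTrace.

Lemma ltr_powers (K : numFieldType) (V : vectType K) (f : 'End(V)) :
  (forall m, ltr (lpow f m.+1) = 0) -> exists k, forall v, iter k f v = 0.
Proof.
move=> h; have [m|k hk] := @trace_powers K _ (VectorInternalTheory.f2mx f).
  by rewrite -f2mx_lpow; exact: h.
by exists k; exact: lpow_nil.
Qed.

(** * Engel's theorem *)

Lemma cap_line0 (K : fieldType) (V : vectType K) (U : {vspace V}) v :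
  v \notin U -> (U :&: <[v]> = 0)%VS.
Proof.
move=> hv; apply/eqP; rewrite -subv0; apply/subvP => w /memv_capP [hw /vlineP [c e]].
rewrite memv0 e scaler_eq0; apply/orP; left; apply: contraNT hv => c0.
by rewrite -[v]scale1r -(mulVf c0) -scalerA -e memvZ.
Qed.

Lemma dim_add_line (K : fieldType) (V : vectType K) (U : {vspace V}) v :
  v \notin U -> \dim (U + <[v]>) = (\dim U).+1.
Proof.
move=> hv; have v0 : v != 0 by apply: contraNneq hv => ->; exact: mem0v.
by rewrite dimv_disjoint_sum ?dim_vline ?v0 ?addn1 ?cap_line0.
Qed.

(** * Brackets of subspaces, derived series and ideals *)

Section Spans2.
Variables (K : fieldType) (g : vectType K) (B : 'Hom(g, 'End(g))).

Definition brs (U W : {vspace g}) : {vspace g} :=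
  <<[seq B x y | x <- vbasis U, y <- vbasis W]>>%VS.

Lemma mem_brs (U W : {vspace g}) x y : x \in U -> y \in W -> B x y \in brs U W.
Proof.
move=> hx hy; rewrite (coord_vbasis hx) (coord_vbasis hy) lfun2_sum.
apply: memv_suml => i _; rewrite lfun2Z linear_sum; apply: memvZ.
apply: memv_suml => j _; rewrite linearZ; apply: memvZ; apply: memv_span.
by apply: allpairs_f; rewrite mem_nth // size_tuple.
Qed.

Lemma brs_subP (U W Z : {vspace g}) : (forall x y, x \in U -> y \in W -> B x y \in Z) -> (brs U W <= Z)%VS.
Proof.
move=> h; apply/span_subvP => z /allpairsP [[x y] /= [hx hy ->]].
by apply: h; exact: vbasis_mem.
Qed.

Lemma brsS U W U' W' : (U <= U')%VS -> (W <= W')%VS -> (brs U W <= brs U' W')%VS.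
Proof.
move=> /subvP hU /subvP hW; apply: brs_subP => x y /hU hx /hW hy; exact: mem_brs.
Qed.

Definition derived n (U : {vspace g}) := iter n (fun U => brs U U) U.

Definition solvable (U : {vspace g}) := exists n, derived n U = 0%VS.

Definition ideal (U : {vspace g}) := brsub B fullv U U.

Definition stab (M : {vspace g}) (V : vectType K) (r : 'Hom(g, 'End(V))) (X : {vspace V}) :=
  forall x v, x \in M -> v \in X -> r x v \in X.

Lemma derivedS n U W : (U <= W)%VS -> (derived n U <= derived n W)%VS.
Proof. by move=> h; elim: n => //= n IH; exact: brsS. Qed.

Lemma derived_add m n U : derived (m + n) U = derived m (derived n U).
Proof. by rewrite /derived iterD. Qed.

Lemma derived_sub n U : brsub B U U U -> (derived n U <= U)%VS.
Proof.
move=> h; elim: n => //= n IH; apply: brs_subP => x y hx hy.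
by apply: h; apply: (subvP IH).
Qed.

Hypothesis HB : lie_alg B.

Lemma ideal_brs U W : ideal U -> ideal W -> ideal (brs U W).
Proof.
move=> hU hW x z _ hz.
suff : (brs U W <= B x @^-1: brs U W)%VS by move=> /subvP /(_ z hz); rewrite memv_preim.
apply: brs_subP => u w hu hw; rewrite -memv_preim (brJ HB).
by apply: memvD; apply: mem_brs => //; [exact: hU (memvf _) _ | exact: hW (memvf _) _].
Qed.

Lemma ideal_derived n U : ideal U -> ideal (derived n U).
Proof. by move=> h; elim: n => //= n IH; exact: ideal_brs. Qed.

Lemma ideal_full : ideal fullv. Proof. by move=> *; exact: memvf. Qed.

Lemma idealr (U : {vspace g}) x y : ideal U -> x \in U -> B x y \in U.
Proof. by move=> h hx; rewrite (brC HB) memvN; apply: h; rewrite ?memvf. Qed.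

Lemma ideal_sub U : ideal U -> brsub B U U U.
Proof. by move=> h x y _ hy; apply: h; rewrite ?memvf. Qed.

Lemma ideal_brsr U W : ideal W -> (brs U W <= W)%VS.
Proof. by move=> h; apply: brs_subP => x y _; exact: h (memvf _). Qed.

Lemma subalg_add_line (M : {vspace g}) y : brsub B M M M ->
  (forall x, x \in M -> B x y \in M) -> brsub B (M + <[y]>)%VS (M + <[y]>)%VS M.
Proof.
move=> hM hy z z' /memv_addP [x hx [_ /vlineP [c ->] ->]] /memv_addP [x' hx' [_ /vlineP [c' ->] ->]].
have e u : B u (x' + c' *: y) = B u x' + c' *: B u y by rewrite linearD linearZ.
rewrite lfun2D lfun2Z !e (brxx HB) scaler0 addr0.
rewrite [B y x'](brC HB); apply: memvD; last by apply: memvZ; rewrite memvN hy.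
by apply: memvD; [exact: hM | apply: memvZ; exact: hy].
Qed.

End Spans2.

Section Engel.
Variables (K : fieldType).

(** The relative form with X and Y lets the induction apply to the adjoint action of a subalgebra M'
    on M modulo M', which yields y outside M' normalizing it. Adding such lines leads to M' of
    codimension 1 in M. The vectors of Y sent into X by M' are then stable under y, and the last
    iterate under y outside X is sent into X by all of M. *)
Lemma engel_vector n : forall (g : vectType K) (B : 'Hom(g, 'End(g))) (HB : lie_alg B)
  (M : {vspace g}) (V : vectType K) (r : 'Hom(g, 'End(V))) (X Y : {vspace V}),
  (\dim M <= n)%N -> brsub B M M M ->
  (forall x, x \in M -> exists k, forall y, y \in M -> iter k (B x) y = 0) ->
  is_rep B M r -> stab M r X -> stab M r Y ->
  (forall x, x \in M -> exists k, forall v, v \in Y -> iter k (r x) v \in X) ->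
  ~~ (Y <= X)%VS ->
  exists v, [/\ v \in Y, v \notin X & forall x, x \in M -> r x v \in X].
Proof.
elim: n => [|n IH] g B HB M V r X Y dM MM adM rM sX sY nY /subvPn [v0 hv0 nv0].
  move: dM; rewrite leqn0 dimv_eq0 => /eqP M0; exists v0; split=> // x.
  by rewrite M0 memv0 => /eqP ->; rewrite lfun20 mem0v.
have [M0|M0] := eqVneq M 0%VS.
  by exists v0; split=> // x; rewrite M0 memv0 => /eqP ->; rewrite lfun20 mem0v.
have step (M' : {vspace g}) : (M' <= M)%VS -> brsub B M' M' M' -> (\dim M' < \dim M)%N ->
    exists y, [/\ y \in M, y \notin M' & forall x, x \in M' -> B x y \in M'].
  move=> M'M sM' dM'.
  apply: (IH g B HB M' g B M' M).
  - by rewrite -ltnS; exact: leq_trans dM' dM.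
  - exact: sM'.
  - move=> x hx; have [k hk] := adM x (subvP M'M x hx).
    by exists k => y hy; apply: hk; exact: (subvP M'M).
  - exact: ad_rep.
  - exact: sM'.
  - by move=> x y hx hy; apply: MM => //; exact: (subvP M'M).
  - move=> x hx; have [k hk] := adM x (subvP M'M x hx).
    by exists k => y hy; rewrite hk // mem0v.
  - by apply: contraL dM' => /dimvS; rewrite leqNgt.
have chain j : (j < \dim M)%N -> exists M' : {vspace g},
    [/\ (M' <= M)%VS, brsub B M' M' M' & \dim M' = j].
  elim: j => [|j IHj] hj.
    exists 0%VS; split; rewrite ?sub0v ?dimv0 // => x y.
    by rewrite !memv0 => /eqP -> _; rewrite lfun20.
  have [M' [M'M sM' dM']] := IHj (ltnW hj).
  have [|y [hy ny hMy]] := step M' M'M sM'; first by rewrite dM' ltnW.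
  exists (M' + <[y]>)%VS; split.
  - by rewrite subv_add M'M; apply/subvP => z /vlineP [c ->]; exact: memvZ.
  - by move=> z z' hz hz'; apply: (subvP (addvSl _ _)); apply: (subalg_add_line HB sM' hMy).
  - by rewrite dim_add_line // dM'.
have dM0 : (0 < \dim M)%N by rewrite lt0n dimv_eq0.
have [|M' [M'M sM' dM']] := chain (\dim M).-1; first by rewrite prednK.
have [|y [hy ny hMy]] := step M' M'M sM'; first by rewrite dM' prednK.
have ME : (M' + <[y]>)%VS = M.
  apply/eqP; rewrite eqEdim dim_add_line // dM' prednK // leqnn andbT.
  by rewrite subv_add M'M; apply/subvP => z /vlineP [c ->]; exact: memvZ.
have [||||||||v [vY vX vM']] := IH g B HB M' V r X Y.
- by rewrite dM' -ltnS prednK.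
- by [].
- move=> x hx; have [k hk] := adM x (subvP M'M x hx).
  by exists k => z hz; apply: hk; exact: (subvP M'M).
- by move=> x z hx hz; apply: rM; exact: (subvP M'M).
- by move=> x z hx; apply: sX; exact: (subvP M'M).
- by move=> x z hx; apply: sY; exact: (subvP M'M).
- by move=> x hx; apply: nY; exact: (subvP M'M).
- by apply/subvPn; exists v0.
have W m : iter m (r y) v \in Y /\ forall x, x \in M' -> r x (iter m (r y) v) \in X.
  elim: m => [//|m [hY hX]]; rewrite iterS; split; first exact: sY.
  move=> x hx; have hxM := subvP M'M x hx.
  have -> : r x (r y (iter m (r y) v)) = r (B x y) (iter m (r y) v) + r y (r x (iter m (r y) v)).
    by rewrite (rM _ _ hxM hy) subrK.
  by apply: memvD; [apply: hX; exact: hMy | apply: sX => //; exact: hX].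
have exk : exists k, iter k (r y) v \in X.
  by have [k hk] := nY y hy; exists k; exact: hk.
case: (ex_minnP exk) => -[|k] hk mink; first by rewrite hk in vX.
exists (iter k (r y) v); split; first exact: (W k).1.
  by apply/negP => /mink; rewrite ltnn.
move=> x; rewrite -ME => /memv_addP [x' hx' [_ /vlineP [c ->] ->]].
by rewrite lfun2D lfun2Z; apply: memvD; [exact: (W k).2 | exact: memvZ].
Qed.

Section Flag.
Variables (g : vectType K) (B : 'Hom(g, 'End(g))) (M N : {vspace g}).
Variables (V : vectType K) (r : 'Hom(g, 'End(V))).

(** The hypothesis builds a stable flag upwards, on which each letter of N goes down one step;
    [dim V] letters reach 0. *)
Lemma flag_nilact : (forall X : {vspace V}, stab M r X -> X != fullv ->
    exists Y : {vspace V}, [/\ stab M r Y, (X <= Y)%VS, X != Y &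
       forall x v, x \in N -> v \in Y -> r x v \in X]) ->
  exists k, nilact N r k.
Proof.
move=> h; exists (dim V) => s hs sN v.
suff main d (X : {vspace V}) : (dim V - \dim X <= d)%N -> stab M r X ->
    forall s, size s = d -> {subset s <= N} -> forall v, wact r s v \in X.
  apply/eqP; rewrite -memv0; apply: main hs sN v; first exact: leq_subr.
  by move=> x w _; rewrite !memv0 => /eqP ->; rewrite linear0.
elim: d X => [|d IH] X hd sX t ht tN w.
  suff -> : X = fullv by rewrite memvf.
  by apply/eqP; rewrite eqEdim subvf dimvf; move: hd; rewrite leqn0 subn_eq0.
have [->|nX] := eqVneq X fullv; first exact: memvf.
have [Y [sY XY nXY hN]] := h X sX nX.
case: t ht tN => //= x t [ht] tN; apply: hN; first by apply: tN; rewrite mem_head.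
apply: IH => //; last by move=> z hz; apply: tN; rewrite inE hz orbT.
have : (\dim X < \dim Y)%N by rewrite (ltn_leqif (dimv_leqif_eq XY)).
move: hd; lia.
Qed.

End Flag.

Lemma nilact_kernel (g : vectType K) (N : {vspace g}) (V : vectType K)
    (r : 'Hom(g, 'End(V))) k (v : V) : nilact N r k -> v != 0 ->
  exists2 w, w != 0 & forall x, x \in N -> r x w = 0.
Proof.
elim: k v => [|k IH] v nk v0.
  have e : v = 0 by apply: (nk [::]) => // z; rewrite in_nil.
  by rewrite e eqxx in v0.
have [nk'|/existsNP [s /not_implyP [hs /not_implyP [sN /existsNP [w /eqP hw]]]]] :=
    pselect (nilact N r k); first exact: IH nk' v0.
exists (wact r s w) => // x hx.
apply: (nk (x :: s)); rewrite /= ?hs // => z.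
by rewrite inE => /orP [/eqP ->|/sN].
Qed.

Lemma engel_ad (g : vectType K) (B : 'Hom(g, 'End(g))) (HB : lie_alg B) (M : {vspace g})
    (V : vectType K) (r : 'Hom(g, 'End(V))) :
  brsub B M M M -> is_rep B M r ->
  (forall x, x \in M -> exists k, forall y, y \in M -> iter k (B x) y = 0) ->
  (forall x, x \in M -> exists k, forall v, iter k (r x) v = 0) ->
  exists k, nilact M r k.
Proof.
move=> MM rM adM nM; apply: (@flag_nilact g M M) => X sX nX.
have [||||||||v [_ nv hv]] := @engel_vector (\dim M) g B HB M V r X fullv; try by [].
- by move=> *; exact: memvf.
- by move=> x hx; have [k hk] := nM x hx; exists k => w _; rewrite hk mem0v.
- by apply: contra nX => h; apply/eqP/subv_anti; rewrite subvf h.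
have inX x w : x \in M -> w \in (X + <[v]>)%VS -> r x w \in X.
  move=> hx /memv_addP [u hu [_ /vlineP [c ->] ->]]; rewrite linearD linearZ /=.
  by apply: memvD; [exact: sX | apply: memvZ; exact: hv].
exists (X + <[v]>)%VS; split=> //.
- by move=> x w hx hw; apply: (subvP (addvSl _ _)); exact: inX.
- exact: addvSl.
- by apply: contraNneq nv => ->; apply: (subvP (addvSr _ _)); exact: memv_line.
Qed.

End Engel.

Section EngelLinear.
Variables (K : fieldType) (V : vectType K).

Lemma commutator_lie : exists2 C : 'Hom('End(V), 'End('End(V))),
  forall S T : 'End(V), C S T = (S \o T)%VF - (T \o S)%VF & lie_alg C.
Proof.
have [||C CE] := @bilinear_lfun K _ _ _ (fun S T : 'End(V) => (S \o T)%VF - (T \o S)%VF).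
- move=> c S S' T; rewrite comp_lfunDl comp_lfunDr -comp_lfunZl -comp_lfunZr scalerBr; zmod.
- move=> c S T T'; rewrite comp_lfunDl comp_lfunDr -comp_lfunZl -comp_lfunZr scalerBr; zmod.
exists C => //; split=> [S|S T U]; first by rewrite CE subrr.
rewrite !CE !comp_lfunDl !comp_lfunDr !comp_lfunNl !comp_lfunNr !comp_lfunA; zmod.
Qed.

(** The m-th iterate of ad T at S combines the products of T^i, S and T^j with i + j = m; for m = k
    + k one exponent is at least k. *)
Lemma ad_nilpotent (C : 'Hom('End(V), 'End('End(V)))) (T : 'End(V)) k :
  (forall S T : 'End(V), C S T = (S \o T)%VF - (T \o S)%VF) ->
  (forall v, iter k T v = 0) -> forall S, iter (k + k) (C T) S = 0.
Proof.
move=> CE hk.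
have tow m (S : 'End(V)) : (forall i j, (i + j)%N = m -> forall v, iter i T (S (iter j T v)) = 0) ->
    iter m (C T) S = 0.
  elim: m S => [|m IH] S hS; first by apply/lfunP => v; rewrite zero_lfunE; apply: (hS 0%N 0%N).
  rewrite iterSr; apply: IH => i j ij v.
  rewrite CE add_lfunE opp_lfunE !comp_lfunE -iterS.
  have e n u w : iter n T (u - w) = iter n T u - iter n T w.
    by elim: n => //= n ->; rewrite linearB.
  by rewrite e -iterSr (hS i.+1 j) ?(hS i j.+1) ?subrr //= ?addnS ?addSn ij.
move=> S; apply: tow => i j ij v.
have [hi|hi] := leqP k i.
  have e n : iter n T 0 = 0 by elim: n => //= n ->; rewrite linear0.
  have e' u : iter i T u = 0 by rewrite -(subnK hi) iterD hk e.
  exact: e'.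
have hj : (k <= j)%N by lia.
have e n : iter n T 0 = 0 by elim: n => //= n ->; rewrite linear0.
by rewrite -(subnK hj) iterD hk e linear0 e.
Qed.

(** Passing to the image of M in End(V) removes the hypothesis on the adjoint action: there a
    nilpotent T has a nilpotent ad T. *)
Lemma engel (g : vectType K) (B : 'Hom(g, 'End(g))) (M : {vspace g}) (r : 'Hom(g, 'End(V))) :
  brsub B M M M -> is_rep B M r ->
  (forall x, x \in M -> exists k, forall v, iter k (r x) v = 0) ->
  exists k, nilact M r k.
Proof.
move=> MM rM nM; have [C CE CL] := commutator_lie.
pose M' := (r @: M)%VS; pose i : 'Hom('End(V), 'End(V)) := \1%VF.
have [||||k hk] := @engel_ad K _ C CL M' V i.
- move=> _ _ /memv_imgP [x hx ->] /memv_imgP [y hy ->].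
  apply/memv_imgP; exists (B x y); first exact: MM.
  by apply/lfunP => v; rewrite rM // CE add_lfunE opp_lfunE !comp_lfunE.
- by move=> S T _ _ v; rewrite !id_lfunE CE add_lfunE opp_lfunE !comp_lfunE.
- move=> _ /memv_imgP [x hx ->]; have [k hk] := nM x hx.
  by exists (k + k)%N => T _; apply: ad_nilpotent.
- by move=> _ /memv_imgP [x hx ->]; rewrite id_lfunE; exact: nM.
exists k => s hs sM v.
have := hk (map r s); rewrite size_map => /(_ hs) h.
rewrite -[RHS](h _ v); first by elim: s {hs sM h} => //= x s ->; rewrite id_lfunE.
by move=> _ /mapP [x /sM hx ->]; exact: memv_img.
Qed.

End EngelLinear.

(** * Action of the radical *)

Section NilpotentAction.
Variables (K : numFieldType) (g : vectType K) (B : 'Hom(g, 'End(g))).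
Hypothesis HB : lie_alg B.

Definition irreducible (V : vectType K) (r : 'Hom(g, 'End(V))) :=
  forall W : {vspace V}, stab fullv r W -> W = 0%VS \/ W = fullv.

(** The common kernel of the ideal c is a subrepresentation; by Engel it is nonzero when V is, hence
    it is V. *)
Lemma irreducible_nil (V : vectType K) (r : 'Hom(g, 'End(V))) (c : {vspace g}) :
  is_rep B fullv r -> irreducible r -> ideal B c ->
  (forall x, x \in c -> exists k, forall v, iter k (r x) v = 0) ->
  forall x, x \in c -> r x = 0.
Proof.
move=> rr irr ic nc.
have [|k hk] := @engel K V g B c r (ideal_sub ic) _ nc.
  by move=> x y _ _ v; rewrite rr ?memvf.
have [W hW] : exists W : {vspace V}, forall v, v \in W <-> (forall x, x \in c -> r x v = 0).
  apply: prop_vspace => [x _|a u v hu hv x hx]; first exact: linear0.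
  by rewrite linearP /= hu // hv // scaler0 addr0.
have sW : stab fullv r W.
  move=> y v _ /hW hv; apply/hW => x hx.
  have -> : r x (r y v) = r (B x y) v + r y (r x v) by rewrite rr ?memvf // subrK.
  by rewrite (hv _ hx) linear0 addr0 hv //; exact: (idealr HB).
case: (irr W sW) => W0 x hx; apply/lfunP => v; rewrite zero_lfunE; last first.
  by apply: (iffLR (hW v)) => //; rewrite W0 memvf.
have [->|v0] := eqVneq v 0; first exact: linear0.
have [w w0 hw] := nilact_kernel hk v0.
by move: w0; rewrite -memv0 -W0 => /negP []; apply/hW.
Qed.

Lemma ltr_bracket (V : vectType K) (f h P : 'End(V)) :
  (h \o P)%VF = (P \o h)%VF -> ltr (((f \o h) - (h \o f)) \o P)%VF = 0.
Proof.
move=> e; rewrite comp_lfunDl comp_lfunNl ltrB -!comp_lfunA e.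
by rewrite [ltr (h \o _)%VF]ltrC comp_lfunA subrr.
Qed.

Lemma comm_lpow (V : vectType K) (f h : 'End(V)) m :
  (h \o f = f \o h)%VF -> (h \o lpow f m = lpow f m \o h)%VF.
Proof.
move=> e; elim: m => [|m IH] /=; first by rewrite comp_lfun1l comp_lfun1r.
by rewrite -/(lpow f m) comp_lfunA e -!comp_lfunA IH.
Qed.

Lemma rep_lfun (V : vectType K) (r : 'Hom(g, 'End(V))) a x y : is_rep B a r ->
  x \in a -> y \in a -> r (B x y) = ((r x \o r y) - (r y \o r x))%VF.
Proof.
by move=> ra hx hy; apply/lfunP => v; rewrite ra // add_lfunE opp_lfunE !comp_lfunE.
Qed.

(** For z' = [x, y] with x in b and y in a, the power P of [r z] commutes with [r y], so tr
    ([r x, r y] P) = 0. Hence the traces of all positive powers of [r z] vanish. *)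
Lemma brs_nilpotent (V : vectType K) (r : 'Hom(g, 'End(V))) (a b c : {vspace g}) :
  is_rep B fullv r -> (brs B b a <= c)%VS ->
  (forall y z, y \in a -> z \in brs B b a -> (r y \o r z = r z \o r y)%VF) ->
  forall z, z \in brs B b a -> exists k, forall v, iter k (r z) v = 0.
Proof.
move=> rr _ com z hz; apply: ltr_powers => m.
suff main z' : z' \in brs B b a -> ltr (r z' \o lpow (r z) m)%VF = 0 by exact: main.
have [Z hZ] : exists Z : {vspace g}, forall x, x \in Z <-> ltr (r x \o lpow (r z) m)%VF = 0.
  apply: prop_vspace => [|c0 u v hu hv]; first by rewrite linear0 comp_lfun0l ltr0.
  by rewrite linearP /= comp_lfunDl -comp_lfunZl ltrL hu hv mulr0 addr0.
move=> hz'; apply/hZ; apply: (subvP _ _ hz'); apply: brs_subP => x y hx hy; apply/hZ.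
rewrite (rep_lfun rr) ?memvf // ltr_bracket //; apply: comm_lpow; exact: com.
Qed.

(** Let a be the last term of the derived series of s that does not act by 0. It acts by commuting
    operators, so [g, a] acts nilpotently, hence by 0, and a commutes with the action of g. If a = s
    this is the claim. Otherwise a is a bracket of two earlier terms, so it acts nilpotently as
    well, hence by 0, which contradicts its choice. *)
Lemma irreducible_radical (V : vectType K) (r : 'Hom(g, 'End(V))) (s : {vspace g}) :
  is_rep B fullv r -> irreducible r -> ideal B s -> solvable B s ->
  forall x, x \in brs B fullv s -> r x = 0.
Proof.
move=> rr irr ids [n sn].
have com0 y z : r (B y z) = 0 -> (r y \o r z = r z \o r y)%VF.
  move=> h; apply/eqP; rewrite -subr_eq0; apply/eqP.
  by rewrite -(rep_lfun rr) ?memvf.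
have exi : exists i, `[< forall x, x \in derived B i s -> r x = 0 >].
  by exists n; apply/asboolP => x; rewrite sn memv0 => /eqP ->; rewrite linear0.
case: (ex_minnP exi) => -[|i] /asboolP hi mini x hx.
  by apply: hi; apply: (subvP (@ideal_brsr _ _ _ fullv _ ids)).
set a := derived B i s in hi mini.
have ia : ideal B a by exact: ideal_derived.
have acom y z : y \in a -> z \in a -> (r y \o r z = r z \o r y)%VF.
  by move=> hy hz; apply: com0; apply: hi; exact: mem_brs.
have ga0 y : y \in brs B fullv a -> r y = 0.
  apply: (irreducible_nil rr irr).
    exact: ideal_brs (@ideal_full _ _ _) ia.
  apply: (brs_nilpotent (c := a) rr); first exact: ideal_brsr.
  by move=> y' z hy' hz; apply: acom => //; apply: (subvP (@ideal_brsr _ _ _ fullv _ ia)).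
move: mini ga0 ia acom hi; rewrite /a; case: i {a} => [|i] mini ga0 ia acom hi; first exact: ga0.
suff : forall x, x \in derived B i.+1 s -> r x = 0.
  by move=> /asboolP /mini; rewrite ltnn.
apply: (irreducible_nil rr irr ia).
apply: (brs_nilpotent (c := fullv) rr); first exact: subvf.
move=> y z hy hz; apply: com0; apply: ga0; apply: mem_brs => //; exact: memvf.
Qed.

Lemma sub_minimal (V : vectType K) (P : {vspace V} -> Prop) (Y : {vspace V}) : P Y ->
  exists Z : {vspace V}, [/\ P Z, (Z <= Y)%VS & forall W, P W -> (W <= Z)%VS -> W = Z].
Proof.
move: {2}(\dim Y) (leqnn (\dim Y)) => n; elim: n Y => [|n IH] Y hn PY.
  exists Y; split=> // W _ WY; apply/eqP; rewrite eqEdim WY.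
  by move: hn; rewrite leqn0 => /eqP ->.
have [h|/existsNP [W /not_implyP [PW /not_implyP [WY /eqP nW]]]] :=
    pselect (forall W, P W -> (W <= Y)%VS -> W = Y); first by exists Y.
have [|Z [PZ ZW hZ]] := IH W _ PW.
  by rewrite -ltnS; apply: leq_trans hn; rewrite (ltn_leqif (dimv_leqif_eq WY)).
by exists Z; split=> //; exact: subv_trans ZW WY.
Qed.

(** A minimal g-stable Z above X gives an irreducible subquotient Z / X, on which [g, s] acts by 0;
    these Z are the steps of a flag. *)
Lemma radical_nilact (V : vectType K) (r : 'Hom(g, 'End(V))) (s : {vspace g}) :
  is_rep B fullv r -> ideal B s -> solvable B s -> exists k, nilact (brs B fullv s) r k.
Proof.
move=> rr ids ss; apply: (@flag_nilact K g fullv) => X sX nX.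
have [Z [[sZ XZ nXZ] _ minZ]] :=
  @sub_minimal V (fun Y => [/\ stab fullv r Y, (X <= Y)%VS & X != Y]) fullv
   (And3 (fun x v _ _ => memvf _) (subvf X) nX).
exists Z; split=> //.
have [T [p [t [pt tZ pX tpX]]]] := subquotient XZ.
have [||q qE] := @bilinear_lfun K g T T (fun x u => p (r x (t u))).
- by move=> c x y u; rewrite lfun2D lfun2Z linearP.
- by move=> c x u v; rewrite !linearP.
have pr x v : v \in Z -> q x (p v) = p (r x v).
  move=> hv; rewrite qE; apply/eqP; rewrite -subr_eq0 -!linearB; apply/eqP; apply: pX.
  by apply: sX; rewrite ?memvf // -memvN opprB; exact: tpX.
have qr : is_rep B fullv q.
  move=> x y _ _ u; rewrite -[u]pt !pr ?sZ ?memvf ?tZ //.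
  by rewrite -linearB -rr ?memvf.
have irr : irreducible q.
  move=> W sW; pose Y := ((p @^-1: W) :&: Z)%VS.
  have sY : stab fullv r Y.
    move=> x v _ /memv_capP [hv hZ]; apply/memv_capP; split; last by apply: sZ; rewrite ?memvf.
    by rewrite -memv_preim -pr //; apply: sW; rewrite ?memvf // memv_preim.
  have XY : (X <= Y)%VS.
    apply/subvP => v hv; apply/memv_capP; split; last exact: (subvP XZ).
    by rewrite -memv_preim pX // mem0v.
  have [eXY|nXY] := eqVneq X Y.
    left; apply/eqP; rewrite -subv0; apply/subvP => u hu; rewrite memv0.
    by rewrite -[u]pt pX // eXY; apply/memv_capP; split; rewrite // -memv_preim pt.
  right; have YZ : Y = Z by apply: minZ; [split | exact: capvSr].
  apply/eqP; rewrite eqEsubv subvf /=; apply/subvP => u _.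
  by have := tZ u; rewrite -YZ => /memv_capP [+ _]; rewrite -memv_preim pt.
move=> x v hx hv.
have qx := irreducible_radical qr irr ids ss hx.
have := tpX (r x v) (sZ _ _ (memvf x) hv).
by rewrite -pr // qx zero_lfunE linear0 subr0.
Qed.

End NilpotentAction.

(** * Cartan's criterion *)

Section PolyAction.
Variables (K : fieldType) (V : lmodType K) (f : V -> V).
Hypothesis fL : linear f.

(** The vector q(f) v, for operators such as ad A on a space of matrices. *)
Definition polyact (q : {poly K}) v := \sum_(i < size q) q`_i *: iter i f v.

Lemma polyact_bound n (q : {poly K}) v : (size q <= n)%N ->
  polyact q v = \sum_(i < n) q`_i *: iter i f v.
Proof.
move=> h; rewrite /polyact (big_ord_widen n (fun i => q`_i *: iter i f v) h) big_mkcond /=.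
apply: eq_bigr => i _; case: ifP => // /negbT; rewrite -leqNgt => hi.
by rewrite nth_default // scale0r.
Qed.

Lemma polyactD p q v : polyact (p + q) v = polyact p v + polyact q v.
Proof.
rewrite !(@polyact_bound (maxn (size p) (size q))) ?leq_maxl ?leq_maxr ?size_polyD //.
by rewrite -big_split; apply: eq_bigr => i _; rewrite coefD scalerDl.
Qed.

Lemma polyactZ c q v : polyact (c *: q) v = c *: polyact q v.
Proof.
rewrite !(@polyact_bound (size q)) ?size_scale_leq // scaler_sumr.
by apply: eq_bigr => i _; rewrite coefZ scalerA.
Qed.

Lemma polyactC c v : polyact c%:P v = c *: v.
Proof. by rewrite (@polyact_bound 1) ?size_polyC_leq1 // big_ord1 coefC. Qed.

Lemma polyactMX q v : polyact (q * 'X) v = polyact q (f v).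
Proof.
rewrite (@polyact_bound (size q).+1) ?size_mul_leq //; last first.
  by apply: leq_trans (size_mul_leq _ _) _; rewrite size_polyX addn2.
rewrite big_ord_recl coefMX eqxx scale0r add0r /polyact.
by apply: eq_bigr => i _; rewrite coefMX /= -iterSr.
Qed.

Let f0 : f 0 = 0.
Proof. by have := fL (-1) 0 0; rewrite !scaleN1r !addNr. Qed.

Lemma polyact0 q : polyact q 0 = 0.
Proof.
rewrite /polyact big1 // => i _.
have -> : iter i f 0 = 0 by elim: (i : nat) => //= n ->.
by rewrite scaler0.
Qed.

Lemma polyact_vL q a u v : polyact q (a *: u + v) = a *: polyact q u + polyact q v.
Proof.
rewrite /polyact scaler_sumr -big_split; apply: eq_bigr => i _ /=.
have -> : iter i f (a *: u + v) = a *: iter i f u + iter i f v.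
  by elim: (i : nat) => //= n ->; rewrite fL.
by rewrite scalerDr !scalerA mulrC.
Qed.

Lemma polyact_eigen k a c (q : {poly K}) v : ('X - a%:P) ^+ k %| q - c%:P ->
  iter k (fun u => f u - a *: u) v = 0 -> polyact q v = c *: v.
Proof.
move=> /dvdpP [h e] hv.
have -> : q = h * ('X - a%:P) ^+ k + c%:P by rewrite -e subrK.
rewrite polyactD polyactC -[RHS]add0r; congr (_ + _).
elim: k v hv {e} => [|k IH] v hv; first by rewrite (_ : v = 0) ?polyact0.
have -> : h * ('X - a%:P) ^+ k.+1 =
    h * ('X - a%:P) ^+ k * 'X + (- a) *: (h * ('X - a%:P) ^+ k).
  by rewrite exprSr mulrA mulrBr scaleNr -mul_polyC [a%:P * _]mulrC.
rewrite polyactD polyactMX polyactZ addrC -polyact_vL.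
rewrite scaleNr [_ + f v]addrC; apply: IH. by rewrite -iterSr.
Qed.

End PolyAction.

Section PolyCRT.
Variable K : fieldType.

Lemma coprimep_prod_XsubC (s : seq K) N a : a \notin s ->
  coprimep (('X - a%:P) ^+ N) (\prod_(b <- s) ('X - b%:P) ^+ N).
Proof.
elim: s => [|b s IH]; first by rewrite big_nil coprimep1.
rewrite inE negb_or => /andP [ab /IH h]; rewrite big_cons coprimepMr h andbT.
apply: coprimep_expl; apply: coprimep_expr.
by rewrite coprimep_XsubC root_XsubC eq_sym.
Qed.

Lemma poly_crt (s : seq K) N (c : K -> K) :
  exists q, forall a, a \in s -> ('X - a%:P) ^+ N %| q - (c a)%:P.
Proof.
elim: s => [|b s [q hq]]; first by exists 0.
have [bs|bs] := boolP (b \in s).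
  by exists q => a; rewrite inE => /orP [/eqP ->|]; apply: hq.
set P := \prod_(a <- s) ('X - a%:P) ^+ N.
have [[u w] /= uw] := Bezout_eq1_coprimepP _ _ (coprimep_prod_XsubC N bs).
exists (q + w * P * ((c b)%:P - q)) => a; rewrite inE => /orP [/eqP ->|ha].
  have -> : q + w * P * ((c b)%:P - q) - (c b)%:P = (w * P - 1) * ((c b)%:P - q) by ring.
  apply: dvdp_mulr; rewrite -uw opprD addrCA subrr addr0 dvdpNr.
  exact: dvdp_mull.
rewrite addrAC; apply: dvdp_add; first exact: hq.
apply: dvdp_mulr; apply: dvdp_mull; rewrite /P (big_rem a) //=.
exact: dvdp_mulr.
Qed.

Lemma dvdp_prod_XsubC (s : seq K) N p : uniq s ->
  (forall a, a \in s -> ('X - a%:P) ^+ N %| p) -> \prod_(a <- s) ('X - a%:P) ^+ N %| p.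
Proof.
elim: s => [|b s IH]; first by rewrite big_nil dvd1p.
move=> /= /andP [bs us] h; rewrite big_cons Gauss_dvdp ?coprimep_prod_XsubC //.
rewrite h ?mem_head // IH // => a ha; apply: h; by rewrite inE ha orbT.
Qed.

Lemma dvdp_prod_undup (r : seq K) :
  \prod_(a <- r) ('X - a%:P) %| \prod_(a <- undup r) ('X - a%:P) ^+ size r.
Proof.
have <- : \prod_(a <- undup r) ('X - a%:P) ^+ count_mem a r = \prod_(a <- r) ('X - a%:P).
  rewrite big_undup_iterop_count; exact: eq_bigr.
elim/big_rec2: _ => // a p q _ h; apply: dvdp_mul => //.
by apply: dvdp_exp2l; exact: count_size.
Qed.

End PolyCRT.

Section ConjugatePart.
Variable K : numClosedFieldType.

Lemma trace_nilpotent n (A : 'M[K]_n) k : A ^+ k = 0 -> \tr A = 0.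
Proof.
case: n A => [|n] A hA; first by rewrite /mxtrace big_ord0.
have [r hr] := closed_field_poly_normal (char_poly A).
move: hr; rewrite (monicP (char_poly_monic A)) scale1r => hr.
have r0 a : a \in r -> a = 0.
  move=> ha; have : root (char_poly A) a by rewrite hr root_prod_XsubC.
  rewrite -eigenvalue_root_char => /eigenvalueP [v vA v0].
  have e i : v *m A ^+ i = a ^+ i *: v.
    elim: i => [|i IH]; first by rewrite !expr0 mulmx1 scale1r.
    by rewrite exprSr mulmxA IH -scalemxAl vA scalerA exprSr.
  move: (e k); rewrite hA mulmx0 => /esym/eqP.
  by rewrite scaler_eq0 (negPf v0) orbF expf_eq0 => /andP [_ /eqP].
have hX : char_poly A = 'X^(n.+1).
  have : size (char_poly A) = n.+2 by exact: size_char_poly.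
  rewrite hr size_prod_XsubC => -[<-].
  rewrite (eq_big_seq (fun=> 'X)) => [|a /r0 ->]; last by rewrite subr0.
  by rewrite big_const_seq count_predT iter_mulr_1.
have := char_poly_trace A; rewrite ltn0Sn => /(_ isT) /=.
by rewrite hX coefXn /= ltn_eqF // => /esym/eqP; rewrite oppr_eq0 => /eqP.
Qed.

(* D has the generalized eigenspaces of A, with conjugate eigenvalues; hence ad D
   is a polynomial in ad A, and tr (D A) is the sum of the squared moduli of the
   eigenvalues. *)
Lemma conjugate_part n (A : 'M[K]_n) : exists (D : 'M[K]_n) (q : {poly K}),
  (forall X, D *m X - X *m D = polyact (fun X => A *m X - X *m A) q X) /\
  (\tr (D *m A) = 0 -> exists k, A ^+ k = 0).
Proof.
case: n A => [|n] A.
  exists 0, 0; split=> [X|_]; first by rewrite [LHS]flatmx0 [RHS]flatmx0.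
  by exists 0%N; rewrite [LHS]flatmx0 [RHS]flatmx0.
have [r hr] := closed_field_poly_normal (char_poly A).
move: hr; rewrite (monicP (char_poly_monic A)) scale1r => hr.
pose s := undup r; pose N := size r.
have ann p : (forall a, a \in s -> ('X - a%:P) ^+ N %| p) -> horner_mx A p = 0.
  move=> /(dvdp_prod_XsubC (undup_uniq r)) h.
  have /dvdpP [c ->] : char_poly A %| p by rewrite hr; apply: dvdp_trans h; exact: dvdp_prod_undup.
  by rewrite rmorphM /= Cayley_Hamilton mulr0.
(* Interpolating the Kronecker symbol at b to order N, which bounds every multiplicity, yields the
   projection [E b] to the generalized eigenspace of b. *)
have he b : exists p, forall a, a \in s -> ('X - a%:P) ^+ N %| p - (a == b)%:R%:P.
  exact: poly_crt s N (fun a => (a == b)%:R).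
pose e b := projT1 (cid (he b)).
have eP b a : a \in s -> ('X - a%:P) ^+ N %| e b - (a == b)%:R%:P.
  by rewrite /e; case: cid => p /= h; exact: h.
pose E b := horner_mx A (e b).
have [q1 q1P] := poly_crt s N Num.conj.
pose D := horner_mx A q1.
have hornerB p p' : (forall a, a \in s -> ('X - a%:P) ^+ N %| p - p') ->
    horner_mx A p = horner_mx A p'.
  by move=> /ann; rewrite rmorphB => /eqP; rewrite subr_eq0 => /eqP.
have E1 : \sum_(b <- s) E b = 1.
  rewrite -[1 in RHS](rmorph1 (horner_mx A)) /E -raddf_sum /=; apply: hornerB => a ha.
  rewrite (bigD1_seq a) ?undup_uniq //= addrAC; apply: dvdp_add.
    by have := eP a a ha; rewrite eqxx.
  apply: (big_ind (fun p => _ %| p)) => [|p p' hp hp'|b ba]; rewrite ?dvdp0 ?dvdp_add //.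
  by have := eP b a ha; rewrite eq_sym (negPf ba) subr0.
have NE b : b \in s -> (A - b%:M) ^+ N * E b = 0.
  move=> hb; have -> : A - b%:M = horner_mx A ('X - b%:P) by rewrite rmorphB /= horner_mx_X horner_mx_C.
  rewrite -rmorphXn -rmorphM /=; apply: ann => a ha.
  have [->|ab] := eqVneq a b; first exact: dvdp_mulr.
  by apply: dvdp_mull; have := eP b a ha; rewrite (negPf ab) subr0.
have EE b : b \in s -> E b * E b = E b.
  move=> hb; rewrite -rmorphM; apply: hornerB => a ha.
  have -> : e b * e b - e b = (e b - (a == b)%:R%:P) * (e b + (a == b)%:R%:P - 1).
    have [_|_] := eqVneq a b; rewrite ?polyC1 ?polyC0; ring.
  by apply: dvdp_mulr; exact: eP.
have DE b : b \in s -> D * E b = b^* *: E b.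
  move=> hb; rewrite -linearZ -rmorphM /=; apply: hornerB => a ha.
  have -> : q1 * e b - b^* *: e b = (q1 - (b^*)%:P) * e b by rewrite mulrBl mul_polyC.
  have [->|ab] := eqVneq a b; first by apply: dvdp_mulr; exact: q1P.
  by apply: dvdp_mull; have := eP b a ha; rewrite (negPf ab) subr0.
have comE b : E b * A = A * E b by have := comm_horner_mx2 A (e b) 'X; rewrite /GRing.comm horner_mx_X.
have comED b : E b * D = D * E b by exact: comm_horner_mx2.
(* On [E b * X * E c] the operator ad A has the single eigenvalue b - c, with nilpotency order at
   most N + N, and ad D has the eigenvalue b^* - c^*. As conjugation is additive, one q serves all
   pairs. *)
have [q qP] := poly_crt [seq a - b | a <- s, b <- s] (N + N) Num.conj.
exists D, q; split.
  move=> X; rewrite !mulmxE.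
  pose adA (Y : 'M[K]_n.+1) := A * Y - Y * A.
  have adAL : linear adA.
    by move=> c u v; rewrite /adA mulrDr mulrDl -scalerAl -scalerAr scalerBr; zmod.
  have -> : X = \sum_(b <- s) \sum_(c <- s) E b * X * E c.
    rewrite -[LHS]mul1r -[LHS]mulr1 -E1 mulr_suml mulr_suml.
    by apply: eq_bigr => b _; rewrite mulr_sumr.
  have act_sum (I : Type) (t : seq I) (G : I -> 'M[K]_n.+1) :
      polyact adA q (\sum_(i <- t) G i) = \sum_(i <- t) polyact adA q (G i).
    elim/big_rec2: _ => [|i y1 y2 _ <-]; first exact: polyact0.
    by rewrite -[G i]scale1r polyact_vL // !scale1r.
  rewrite mulr_sumr mulr_suml -sumrB act_sum; apply: eq_big_seq => b hb.
  rewrite mulr_sumr mulr_suml -sumrB act_sum; apply: eq_big_seq => c hc.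
  pose Y := E b * X * E c; rewrite -/Y.
  have DY : D * Y = b^* *: Y by rewrite /Y !mulrA DE // !scalerAl.
  have YD : Y * D = c^* *: Y by rewrite /Y -mulrA comED DE // scalerAr.
  rewrite DY YD -scalerBl -rmorphB /=.
  apply/esym/(polyact_eigen adAL (qP _ (allpairs_f (fun a b => a - b) hb hc))).
  have tow m Z : (forall i j, (i + j)%N = m -> (A - b%:M) ^+ i * Z * (A - c%:M) ^+ j = 0) ->
      iter m (fun u => adA u - (b - c) *: u) Z = 0.
    elim: m Z => [|m IH] Z hZ; first by have := hZ 0%N 0%N erefl; rewrite !expr0 mul1r mulr1.
    rewrite iterSr; apply: IH => i j ij.
    have -> : adA Z - (b - c) *: Z = (A - b%:M) * Z - Z * (A - c%:M).
      rewrite /adA mulrBl mulrBr scalerBl -!mulmxE mul_scalar_mx mul_mx_scalar; zmod.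
    rewrite mulrBr mulrBl !mulrA -exprSr -[_ * (A - c%:M) * _]mulrA -exprS.
    by rewrite (hZ i.+1 j) ?(hZ i j.+1) ?subrr //= ?addnS ?addSn ij.
  apply: tow => i j ij.
  have [hi|hi] := leqP N i.
    by rewrite -(subnK hi) exprD /Y -!mulrA [X in _ * X]mulrA NE // mul0r mulr0.
  have hj : (N <= j)%N by lia.
  have cE : E c * (A - c%:M) ^+ N = 0.
    rewrite -(NE c hc) /E; have -> : A - c%:M = horner_mx A ('X - c%:P).
      by rewrite rmorphB /= horner_mx_X horner_mx_C.
    by rewrite -rmorphXn; exact: comm_horner_mx2.
  by rewrite -(subnKC hj) exprD /Y -!mulrA [X in _ * (_ * (_ * X))]mulrA cE mul0r !mulr0.
move=> trDA; exists N.
(* On the generalized eigenspace A differs from b by a nilpotent matrix, which has trace 0. *)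
have trE b : b \in s -> \tr (E b * A) = b * (\rank (E b))%:R.
  move=> hb; rewrite -idempotent_trace; last exact: EE.
  have -> : E b * A = (A - b%:M) * E b + b *: E b.
    by rewrite mulrBl -comE -!mulmxE mul_scalar_mx subrK.
  rewrite mxtraceD mxtraceZ (@trace_nilpotent _ ((A - b%:M) * E b) N) ?add0r //.
  have cE : GRing.comm (A - b%:M) (E b).
    have -> : A - b%:M = horner_mx A ('X - b%:P) by rewrite rmorphB /= horner_mx_X horner_mx_C.
    exact: comm_horner_mx2.
  have N0 : (0 < N)%N.
    by rewrite lt0n size_eq0; apply: contraTneq hb => r0; rewrite /s r0.
  by rewrite exprMn_comm // -[in E b ^+ _](prednK N0) exprS mulrA NE // mul0r.
have D_sum : D = \sum_(b <- s) b^* *: E b.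
  by rewrite -[LHS]mulr1 -E1 mulr_sumr; apply: eq_big_seq => b /DE.
have rk0 b : b \in s -> b != 0 -> E b = 0.
  move=> hb b0; apply/eqP; rewrite -mxrank_eq0.
  have : \sum_(b <- s) `|b| ^+ 2 * (\rank (E b))%:R = 0.
    rewrite -[RHS]trDA D_sum mulmxE mulr_suml raddf_sum /=; apply: eq_big_seq => c hc.
    have -> : (c^* *: E c) * A = c^* *: (E c * A) by rewrite -scalerAl.
    by rewrite mxtraceZ (trE _ hc) mulrA normCKC.
  rewrite big_seq_cond => /eqP; rewrite psumr_eq0.
    move=> /allP /(_ b hb); rewrite hb /= mulf_eq0 expf_eq0 /= normr_eq0 (negPf b0) /=.
    by rewrite pnatr_eq0.
  by move=> c _; rewrite mulr_ge0 // exprn_ge0.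
rewrite -[LHS]mulr1 -E1 mulr_sumr big_seq big1 // => b hb.
have [b0|b0] := eqVneq b 0; last by rewrite rk0 // mulr0.
by have := NE b hb; rewrite b0 raddf0 subr0.
Qed.

End ConjugatePart.

Section Cartan.
Variables (K : numClosedFieldType) (g : vectType K) (B : 'Hom(g, 'End(g))).
Hypothesis HB : lie_alg B.
Variables (j : {vspace g}) (V : vectType K) (r : 'Hom(g, 'End(V))).
Hypotheses (jj : brsub B j j j) (rj : is_rep B j r).
Hypothesis tr0 : forall x y, x \in j -> y \in j -> ltr (r x \o r y)%VF = 0.

(** With D the conjugate part of x, tr (D [y, z]) equals tr ([D, y] z) up to sign. As ad D is a
    polynomial in ad x, the commutator [D, y] is again the operator of an element of j, and the
    trace form vanishes on j. By linearity tr (D x) = 0. *)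
Lemma cartan_nilpotent x : x \in brs B j j -> exists k, forall v, iter k (r x) v = 0.
Proof.
move=> hx; have hxj : x \in j by apply: (subvP (brs_subP jj)).
pose m y := VectorInternalTheory.f2mx (r y).
have mL c y z : m (c *: y + z) = c *: m y + m z.
  by rewrite /m linearP f2mxL.
(* Matrices act on rows, so m reverses products; this is why the iterates below bracket with x on
   the right. *)
have mB y z : y \in j -> z \in j -> m (B y z) = m z *m m y - m y *m m z.
  by move=> hy hz; rewrite /m (rep_lfun rj) // f2mxB !f2mxM.
have [D [q [DE Dnil]]] := conjugate_part (m x).
have adE y : y \in j -> exists2 u, u \in j & D *m m y - m y *m D = m u.
  move=> hy; rewrite DE /polyact.
  have it i : iter i (B^~ x) y \in j /\
      iter i (fun X => m x *m X - X *m m x) (m y) = m (iter i (B^~ x) y).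
    elim: i => [//|i [h1 h2]]; rewrite !iterS; split; first exact: jj.
    by rewrite h2 mB.
  exists (\sum_(i < size q) q`_i *: iter i (B^~ x) y).
    by apply: memv_suml => i _; apply: memvZ; exact: (it i).1.
  have m0 : m 0 = 0 by rewrite -[RHS](subrr (m 0)) -{1}[0](subrr 0) -scaleN1r addrC mL scaleN1r addNr subrr.
  elim/big_rec2: _ => [|i u X _ ->]; first by rewrite m0.
  by rewrite mL (it i).2.
suff /Dnil [k hk] : \tr (D *m m x) = 0 by exists k; exact: lpow_nil.
have [Z hZ] : exists Z : {vspace g}, forall y, y \in Z <-> \tr (D *m m y) = 0.
  apply: prop_vspace => [|c y z hy hz].
    have -> : m 0 = 0 by rewrite -[RHS](subrr (m 0)) -{1}[0](subrr 0) -scaleN1r addrC mL scaleN1r addNr subrr.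
    by rewrite mulmx0 mxtrace0.
  by rewrite mL mulmxDr -scalemxAr mxtraceD mxtraceZ hy hz mulr0 addr0.
apply/hZ; apply: (subvP _ _ hx); apply: brs_subP => y z hy hz; apply/hZ.
have [u hu uE] := adE y hy.
rewrite mB // mulmxBr raddfB /= mulmxA mxtrace_mulC mulmxA -mulmxA.
have -> : \tr (m y *m (D *m m z)) - \tr (D *m (m y *m m z)) = - \tr (m u *m m z).
  by rewrite -uE mulmxBl raddfB /= opprB !mulmxA.
by apply/eqP; rewrite oppr_eq0 -f2mxM; apply/eqP; exact: tr0.
Qed.

Let Kil (N : {vspace g}) t v := forall s, size s = t -> {subset s <= N} -> wact r s v = 0.

(** The i-th derived term lowers the level by i + 1: a bracket of two elements that each lower it by
    i + 1 lowers it by 2i + 2, which is at least i + 2. *)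
Lemma nilact_derived (N : {vspace g}) k : nilact N r k -> is_rep B N r -> brsub B N N N ->
  forall x, x \in derived B k N -> r x = 0.
Proof.
move=> nk rN NN.
have Kmono a b (v : V) : (a <= b)%N -> Kil N a v -> Kil N b v.
  move=> ab hv s hs sN; rewrite -(cat_take_drop (b - a) s) wact_cat.
  rewrite (hv (drop _ s)) ?wact0 // ?size_drop ?hs ?subKn // => z /mem_drop; exact: sN.
have KL a c (u v : V) : Kil N a u -> Kil N a v -> Kil N a (c *: u + v).
  by move=> hu hv s hs sN; rewrite wact_linear hu // hv // scaler0 addr0.
suff main i x : x \in derived B i N -> forall t v, Kil N t v -> Kil N (t - i.+1) (r x v).
  move=> x hx; apply/lfunP => v; rewrite zero_lfunE.
  have : Kil N k v by move=> s hs sN; exact: nk.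
  by move=> /(main _ _ hx); rewrite subnS subnn => h; apply: (h [::]).
elim: i x => [|i IH] x hx t v hv.
  case: t hv => [|t] hv.
    have -> : v = 0 by apply: (hv [::]) => // z; rewrite in_nil.
    by rewrite linear0 => s _ _; rewrite wact0.
  rewrite subn1 => s hs sN; rewrite -wact_rcons; apply: hv; first by rewrite size_rcons hs.
  by move=> z; rewrite mem_rcons inE => /orP [/eqP ->|/sN].
have [Z hZ] : exists Z : {vspace g}, forall y, y \in Z <-> Kil N (t - i.+2) (r y v).
  apply: prop_vspace => [s _ _|c y z hy hz]; first by rewrite lfun20 wact0.
  by rewrite lfun2D lfun2Z; exact: KL.
apply/hZ; apply: (subvP _ _ hx); apply: brs_subP => y z hy hz; apply/hZ.
have yN : y \in N by apply: (subvP (derived_sub i NN)).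
have zN : z \in N by apply: (subvP (derived_sub i NN)).
rewrite rN // addrC -scaleN1r; apply: KL.
- by apply: Kmono (IH _ hz _ _ (IH _ hy _ _ hv)); lia.
- by apply: Kmono (IH _ hy _ _ (IH _ hz _ _ hv)); lia.
Qed.

Lemma cartan_criterion : exists k, forall x, x \in derived B k j -> r x = 0.
Proof.
have NN : brsub B (brs B j j) (brs B j j) (brs B j j).
  by move=> x y hx hy; apply: mem_brs; apply: (subvP (brs_subP jj)).
have rN : is_rep B (brs B j j) r.
  by move=> x y hx hy; apply: rj; apply: (subvP (brs_subP jj)).
have [k nk] := engel NN rN cartan_nilpotent.
exists (k + 1)%N => x; rewrite derived_add; exact: (nilact_derived nk rN NN).
Qed.

End Cartan.

(** * Casimir operators and Levi's theorem *)

Section TraceForm.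
Variables (K : numFieldType) (g : vectType K) (B : 'Hom(g, 'End(g))).
Hypothesis HB : lie_alg B.
Variables (V : vectType K) (r : 'Hom(g, 'End(V))).
Hypothesis rr : is_rep B fullv r.

Definition trform x y := ltr (r x \o r y)%VF.

Lemma trformC x y : trform x y = trform y x.
Proof. exact: ltrC. Qed.

Lemma trformL c x y z : trform (c *: x + y) z = c * trform x z + trform y z.
Proof. by rewrite /trform linearP comp_lfunDl -comp_lfunZl ltrL. Qed.

Lemma trform0 z : trform 0 z = 0.
Proof. by rewrite /trform linear0 comp_lfun0l ltr0. Qed.

Lemma trform_sum (I : finType) (c : I -> K) (G : I -> g) z :
  trform (\sum_i c i *: G i) z = \sum_i c i * trform (G i) z.
Proof.
elim/big_rec2: _ => [|i y x _ <-]; first exact: trform0.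
by rewrite trformL.
Qed.

Lemma trform_sumr (I : finType) (c : I -> K) (G : I -> g) z :
  trform z (\sum_i c i *: G i) = \sum_i c i * trform z (G i).
Proof. by rewrite trformC trform_sum; apply: eq_bigr => i _; rewrite trformC. Qed.

Lemma trformB x y z : trform (x - y) z = trform x z - trform y z.
Proof. by rewrite addrC -scaleN1r trformL mulN1r addrC. Qed.

Lemma trformN x z : trform (- x) z = - trform x z.
Proof. by rewrite -sub0r trformB trform0 sub0r. Qed.

Lemma trform_inv x y z : trform (B x y) z = trform x (B y z).
Proof.
rewrite /trform !(rep_lfun rr) ?memvf // !comp_lfunDl !comp_lfunDr comp_lfunNl comp_lfunNr !ltrB.
by rewrite !comp_lfunA; congr (_ - _); rewrite [RHS]ltrC comp_lfunA.
Qed.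

Lemma trform_anti x y z : trform (B x y) z = - trform y (B x z).
Proof. by rewrite (brC HB) trformN trform_inv. Qed.

Variables p q : {vspace g}.
Hypotheses (qp : (q <= p)%VS)
  (q0 : forall x y, x \in q -> y \in p -> trform x y = 0)
  (nd : forall x, x \in p -> (forall y, y \in p -> trform x y = 0) -> x \in q).

(** The trace form is nondegenerate on p / q. The dual bases are taken in a complement of q in p by
    inverting the Gram matrix, so expansions hold modulo q only. *)
Lemma dual_basis : exists (e e' : 'I_(\dim (p :\: q)) -> g),
  [/\ forall i, e i \in p /\ e' i \in p, forall i k, trform (e i) (e' k) = (i == k)%:R,
      forall z, z \in p -> z - \sum_i trform z (e' i) *: e i \in q &
      forall z, z \in p -> z - \sum_i trform (e i) z *: e' i \in q].
Proof.
set W := (p :\: q)%VS; set m := \dim W.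
pose e (i : 'I_m) := (vbasis W)`_i.
have eW i : e i \in W by apply: vbasis_mem; rewrite mem_nth // size_tuple.
have Wp : (W <= p)%VS by exact: diffvSl.
have ep i : e i \in p by exact: (subvP Wp).
have decomp z : z \in p -> exists2 w, w \in W & z - w \in q.
  have <- : (W + q)%VS = p by rewrite addv_diff; apply/addv_idPl.
  by move=> /memv_addP [w hw [u hu ->]]; exists w => //; rewrite addrAC subrr add0r.
have zeroW x : x \in p -> (forall i, trform (e i) x = 0) -> x \in q.
  move=> hx h; apply: nd => // y /decomp [w hw hyw].
  rewrite trformC -[y](subrK w) addrC -[y - w]scale1r -[w in w + _]scale1r trformL !scale1r mul1r.
  rewrite (q0 hyw) // addr0 (coord_vbasis hw) trform_sum big1 // => i _.
  by rewrite h mulr0.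
pose G := \matrix_(i < m, k < m) trform (e i) (e k).
have Gu : G \in unitmx.
  rewrite -row_free_unit -kermx_eq0; apply/eqP/row_matrixP => i; rewrite row0.
  set c := row i _; have cG : c *m G = 0.
    by rewrite /c -row_mul mulmx_ker row0.
  pose x := \sum_k c 0 k *: e k.
  have xW : x \in W by apply: memv_suml => k _; exact: memvZ.
  have xq : x \in q.
    apply: zeroW; first exact: (subvP Wp).
    move=> k; rewrite trformC trform_sum; have := congr1 (fun M : 'rV_m => M 0 k) cG.
    rewrite [LHS]mxE [RHS]mxE => h; rewrite -[RHS]h; apply: eq_bigr => l _. by rewrite [G _ _]mxE.
  have x0 : x = 0.
    by apply/eqP; rewrite -memv0 -(capv_diff p q); apply/memv_capP.
  apply/rowP => k; rewrite [RHS]mxE.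
  have /freeP h := basis_free (vbasisP W).
  by apply: (h (fun k => c 0 k)); rewrite -[RHS]x0.
pose e' (k : 'I_m) := \sum_l (invmx G) l k *: e l.
have e'p k : e' k \in p by apply: memv_suml => l _; exact: memvZ.
have ee i k : trform (e i) (e' k) = (i == k)%:R.
  rewrite trform_sumr; have := congr1 (fun M : 'M[K]_m => M i k) (mulmxV Gu).
  by rewrite [LHS]mxE [RHS]mxE => <-; apply: eq_bigr => l _; rewrite [G _ _]mxE mulrC.
exists e, e'; split=> //.
- move=> z /[dup] hz /decomp [w hw hzw].
  have wE : w = \sum_i trform z (e' i) *: e i.
    rewrite [LHS](coord_vbasis hw); apply: eq_bigr => i _; congr (_ *: _).
    have -> : trform z (e' i) = trform w (e' i).
      by apply/eqP; rewrite -subr_eq0 -trformB q0.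
    rewrite [in RHS](coord_vbasis hw) trform_sum (bigD1 i) //= ee eqxx mulr1 big1 ?addr0 //.
    by move=> k ki; rewrite ee (negPf ki) mulr0.
  by rewrite -wE.
- move=> z hz; apply: zeroW.
    by apply: memvB => //; apply: memv_suml => i _; exact: memvZ.
  move=> k; rewrite trformC trformB trform_sum (bigD1 k) //=.
  rewrite [trform (e' k) _]trformC ee eqxx mulr1 big1 ?addr0 => [|i ik].
    by rewrite trformC subrr.
  by rewrite [trform (e' i) _]trformC ee eq_sym (negPf ik) mulr0.
Qed.

(** Invariance of the Casimir tensor, the sum of e_i ⊗ e'_i, tested on a bilinear F that factors
    through p / q. Expanding both sides in the dual bases reduces it to the invariance of the trace
    form. *)
Lemma casimir_invariant (m : nat) (e e' : 'I_m -> g) (T : vectType K) (F : g -> g -> T) x :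
  ideal B p ->
  (forall i, e i \in p /\ e' i \in p) ->
  (forall z, z \in p -> z - \sum_i trform z (e' i) *: e i \in q) ->
  (forall z, z \in p -> z - \sum_i trform (e i) z *: e' i \in q) ->
  (forall c u v w, F (c *: u + v) w = c *: F u w + F v w) ->
  (forall c u v w, F u (c *: v + w) = c *: F u v + F u w) ->
  (forall u v, u \in q -> v \in p -> F u v = 0) ->
  (forall u v, u \in p -> v \in q -> F u v = 0) ->
  \sum_i F (B x (e i)) (e' i) = - \sum_i F (e i) (B x (e' i)).
Proof.
move=> ip hp h1 h2 FL FR Fq qF.
have F0 w : F 0 w = 0.
  by have := FL (-1) 0 0 w; rewrite !scaleN1r !addNr.
have F0r w : F w 0 = 0.
  by have := FR (-1) w 0 0; rewrite !scaleN1r !addNr.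
have FLs c (G : 'I_m -> g) w : F (\sum_i c i *: G i) w = \sum_i c i *: F (G i) w.
  by elim/big_rec2: _ => [|i y z _ <-].
have FRs c (G : 'I_m -> g) w : F w (\sum_i c i *: G i) = \sum_i c i *: F w (G i).
  by elim/big_rec2: _ => [|i y z _ <-].
have FB u v w : F (u - v) w = F u w - F v w.
  by rewrite addrC -scaleN1r FL scaleN1r addrC.
have FBr u v w : F w (u - v) = F w u - F w v.
  by rewrite addrC -scaleN1r FR scaleN1r addrC.
have eq1 i : F (B x (e i)) (e' i) = \sum_k trform (B x (e i)) (e' k) *: F (e k) (e' i).
  have xp : B x (e i) \in p by apply: ip (memvf _) _; exact: (hp i).1.
  by apply/eqP; rewrite -subr_eq0 -FLs -FB Fq //; [exact: h1 | exact: (hp i).2].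
have eq2 i : F (e i) (B x (e' i)) = \sum_k trform (e k) (B x (e' i)) *: F (e i) (e' k).
  have xp : B x (e' i) \in p by apply: ip (memvf _) _; exact: (hp i).2.
  by apply/eqP; rewrite -subr_eq0 -FRs -FBr qF //; [exact: (hp i).1 | exact: h2].
rewrite (eq_bigr _ (fun i _ => eq1 i)) (eq_bigr _ (fun i _ => eq2 i)) [in RHS]exchange_big /= -sumrN.
apply: eq_bigr => i _; rewrite -sumrN; apply: eq_bigr => k _.
by rewrite trform_anti scaleNr.
Qed.

End TraceForm.

Lemma ltr_rank1 (K : fieldType) (V : vectType K) (f : 'End(V)) (phi : 'Hom(V, K^o)) v :
  (forall z, f z = phi z *: v) -> ltr f = phi v.
Proof.
move=> hf; have [i iE] : exists i : 'Hom(K^o, V), forall c, i c = (c : K) *: v.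
  by apply: lfun_of => a c d; rewrite scalerDl scalerA.
have -> : f = (i \o phi)%VF by apply/lfunP => z; rewrite hf comp_lfunE iE.
rewrite /ltr f2mxM mxtrace_mulC -f2mxM -/(ltr _).
have -> : (phi \o i)%VF = phi v *: \1%VF.
  apply/lfunP => c; rewrite comp_lfunE iE linearZ scale_lfunE id_lfunE /=.
  exact: mulrC.
by rewrite ltrZ /ltr f2mx1 mxtrace1 mulr1.
Qed.

Section LeviStep.
Variables (K : numClosedFieldType) (g : vectType K) (B : 'Hom(g, 'End(g))).
Hypothesis HB : lie_alg B.
Variable q : {vspace g}.
Hypotheses (iq : ideal B q) (qq : forall x y, x \in q -> y \in q -> B x y = 0)
  (radq : forall I, ideal B I -> solvable B I -> (I <= q)%VS) (qn0 : q != 0%VS).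

Let rad_ideal : is_rep B fullv B. Proof. exact: ad_rep. Qed.

Lemma ad_kernel_solvable (I : {vspace g}) n : ideal B I ->
  (forall x, x \in derived B n I -> forall v, v \in I -> B x v = 0) -> solvable B I.
Proof.
move=> iI h; exists n.+1; apply/eqP; rewrite -subv0; apply: brs_subP => x y hx hy.
by rewrite memv0 h // (subvP (derived_sub n (ideal_sub iI))).
Qed.

Lemma ideal_perp (V : vectType K) (r : 'Hom(g, 'End(V))) (k p : {vspace g}) :
  is_rep B fullv r -> ideal B k -> ideal B p ->
  exists R : {vspace g}, ideal B R /\
    forall x, x \in R <-> x \in p /\ forall y, y \in k -> trform r x y = 0.
Proof.
move=> rr ik ip.
have [R hR] : exists R : {vspace g}, forall x, x \in R <-> (x \in p /\ forall y, y \in k -> trform r x y = 0).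
  apply: prop_vspace => [|c u v [up hu] [vp hv]].
    by split=> [|y _]; [exact: mem0v | exact: trform0].
  split=> [|y hy]; first by rewrite memvD // memvZ.
  by rewrite trformL hu // hv // mulr0 addr0.
exists R; split=> // x y _ /hR [yp hy]; apply/hR; split; first exact: ip (memvf _) _.
move=> z hz; rewrite (trform_anti HB rr) hy ?oppr0 //.
exact: ik (memvf _) _.
Qed.

Lemma killing_isotropic_solvable (I : {vspace g}) : ideal B I ->
  (forall x y, x \in I -> y \in I -> trform B x y = 0) -> solvable B I.
Proof.
move=> iI h; have [n hn] := cartan_criterion (ideal_sub iI) (fun x y _ _ => ad_rep HB (memvf x) (memvf y)) h.
by apply: (ad_kernel_solvable (n := n) iI) => x hx v _; rewrite hn // zero_lfunE.
Qed.

(** If x is in the abelian ideal q, then ad x ad y maps g into q and has square 0, hence trace 0.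
    Conversely the radical of the Killing form is an ideal, solvable by Cartan's criterion. *)
Lemma killing_radical x : (x \in q) <-> forall y, trform B x y = 0.
Proof.
split=> [hx y|].
  apply: (@trace_nilpotent K _ _ 2).
  rewrite expr2 -mulmxE -f2mxM -[RHS](_ : VectorInternalTheory.f2mx (0 : 'End(g)) = 0).
    congr VectorInternalTheory.f2mx; apply/lfunP => z; rewrite zero_lfunE !comp_lfunE.
    by apply: qq => //; apply: iq; rewrite ?memvf // (idealr HB _ iq).
  by have := f2mxB (0 : 'End(g)) 0; rewrite !subrr.
have [R [iR hR]] := ideal_perp rad_ideal (@ideal_full _ _ B) (@ideal_full _ _ B).
move=> h; apply: (subvP (radq iR _)); last by apply/hR; split=> // *; rewrite ?memvf.
by apply: killing_isotropic_solvable => // u v /hR [_ hu] _; rewrite hu ?memvf.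
Qed.

Let kd_q0 x y : x \in q -> y \in fullv -> trform B x y = 0.
Proof. by move=> /killing_radical h _. Qed.

Let kd_nd x : x \in fullv -> (forall y, y \in fullv -> trform B x y = 0) -> x \in q.
Proof. by move=> _ h; apply/killing_radical => y; rewrite h ?memvf. Qed.

(* For a central radical the Casimir operator of the Killing form is the identity
   modulo the radical, so its image is a complement. *)
Lemma levi_central : (forall x y, y \in q -> B x y = 0) ->
  exists h : {vspace g}, [/\ brsub B h h h, h != fullv & (h + q)%VS = fullv].
Proof.
move=> cq; have cq' x y : x \in q -> B x y = 0 by move=> hx; rewrite (brC HB) cq ?oppr0.
have [e [e' [hp ee h1 h2]]] := dual_basis (subvf q) kd_q0 kd_nd.
have [C CE] : exists C : 'End(g), forall z, C z = \sum_i B (e i) (B (e' i) z).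
  apply: lfun_of => c u v; rewrite scaler_sumr -big_split; apply: eq_bigr => i _.
  by rewrite !linearP.
have Ccom x z : B x (C z) = C (B x z).
  rewrite !CE linear_sum.
  have e1 i : B x (B (e i) (B (e' i) z)) = B (B x (e i)) (B (e' i) z) +
      (B (e i) (B (B x (e' i)) z) + B (e i) (B (e' i) (B x z))).
    by rewrite (brJ HB x) (brJ HB x (e' i)) linearD.
  rewrite (eq_bigr _ (fun i _ => e1 i)) !big_split /= addrA.
  rewrite (casimir_invariant HB rad_ideal (F := fun u v => B u (B v z)) x (@ideal_full _ _ B) hp h1 h2).
  - by rewrite addNr add0r.
  - by move=> c u v w; rewrite lfun2D lfun2Z.
  - by move=> c u v w; rewrite lfun2D lfun2Z linearP.
  - by move=> u v hu _; rewrite cq'.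
  - by move=> u v _ hv; rewrite (cq' v) // linear0.
(* Tested with the Killing form, whose radical is q. As q is central, [B y] depends on its argument
   modulo q only, so [B z \o B y] is a sum of rank one operators along the dual basis, and its trace
   is the Casimir sum. *)
have Cmod z : C z - z \in q.
  apply: kd_nd; rewrite ?memvf // => y _; rewrite trformB; apply/eqP; rewrite subr_eq0; apply/eqP.
  have -> : trform B z y = \sum_i trform B (B z (B y (e i))) (e' i).
    rewrite {1}/trform.
    have [phi phiE] : exists phi : 'I_(\dim (fullv :\: q)) -> 'Hom(g, K^o),
        forall i x, phi i x = trform B x (e' i).
      have h i : exists f : 'Hom(g, K^o), forall x, f x = trform B x (e' i).
        by apply: lfun_of => c u v; rewrite trformL.
      by exists (fun i => projT1 (cid (h i))) => i x; case: cid.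
    have [P PE] : exists P : 'I_(\dim (fullv :\: q)) -> 'End(g),
        forall i x, P i x = phi i x *: B z (B y (e i)).
      have h i : exists f : 'End(g), forall x, f x = phi i x *: B z (B y (e i)).
        by apply: lfun_of => c u v; rewrite linearP /= scalerDl scalerA.
      by exists (fun i => projT1 (cid (h i))) => i x; case: cid.
    have -> : (B z \o B y)%VF = \sum_i P i.
      apply/lfunP => x; rewrite comp_lfunE sum_lfunE.
      have := cq y _ (h1 x (memvf x)); rewrite linearB linear_sum /= => /eqP.
      rewrite subr_eq0 => /eqP ->; rewrite linear_sum; apply: eq_bigr => i _.
      by rewrite PE phiE !linearZ.
    by rewrite ltr_sum; apply: eq_bigr => i _; rewrite (ltr_rank1 (PE i)) phiE.
  have -> : trform B (C z) y = \sum_i trform B (B (e i) (B (e' i) z)) y.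
    have := trform_sum B (fun=> 1) (fun i => B (e i) (B (e' i) z)) y.
    rewrite CE; under eq_bigr => i _ do rewrite scale1r.
    by move=> ->; apply: eq_bigr => i _; rewrite mul1r.
  apply: eq_bigr => i _.
  rewrite (trform_inv rad_ideal) !(trform_anti HB rad_ideal) opprK; congr (trform B _ _).
  by rewrite (brC HB _ y) [B (e' i) z](brC HB) linearN opprK.
exists (limg C); split.
- move=> _ _ /memv_imgP [x _ ->] /memv_imgP [y _ ->].
  by rewrite Ccom memv_img ?memvf.
(* C kills the nonzero central q, so its image is proper. *)
- have hk : (0 < \dim (lker C))%N.
    have qk : (q <= lker C)%VS.
      apply/subvP => v hv; rewrite memv_ker CE big1 // => i _.
      by rewrite (cq (e' i)) // linear0.
    by apply: leq_trans (dimvS qk); rewrite lt0n dimv_eq0.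
  apply: contraTneq hk => hC; have := limg_ker_dim C fullv.
  by rewrite hC capfv -[X in _ = X]add0n => /addIn ->.
- apply/eqP; rewrite eqEsubv subvf /=; apply/subvP => z _.
  have -> : z = C z + - (C z - z) by rewrite opprB addrC subrK.
  by rewrite memv_add ?memv_img ?memvf // memvN.
Qed.

(* The Casimir operator of the trace form on q, taken on a complement p / q of the
   centralizer of q, is invertible on q and gives the homotopy killing the cocycle
   D = dP of a projection P onto q; the kernel of C P - psi is the complement. *)
Lemma levi_noncentral : (forall I, ideal B I -> (I <= q)%VS -> I = 0%VS \/ I = q) ->
  (exists x y, y \in q /\ B x y <> 0) ->
  exists h : {vspace g}, [/\ brsub B h h h, h != fullv & (h + q)%VS = fullv].
Proof.
move=> minq [x0 [y0 [hy0 xy0]]].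
(* T is a copy of q and r the representation of g on it; the kernel of r is the centralizer k of
   q. *)
have [T [p0 [s [ps sq _ ps0]]]] := subquotient (sub0v q).
have sp y : y \in q -> s (p0 y) = y.
  by move=> /ps0; rewrite memv0 subr_eq0 => /eqP.
have [||r rE] := @bilinear_lfun K g T T (fun x t => p0 (B x (s t))).
- by move=> c x y t; rewrite lfun2D lfun2Z linearP.
- by move=> c x t u; rewrite !linearP.
have sr x t : s (r x t) = B x (s t) by rewrite rE sp //; apply: iq; rewrite ?memvf.
have rr : is_rep B fullv r.
  move=> x y _ _ t; rewrite -[LHS]ps -[RHS]ps; congr (p0 _); rewrite linearB /= !sr.
  by rewrite (brJ HB x) addrK.
have [k hk] : exists k : {vspace g}, forall x, x \in k <-> (forall y, y \in q -> B x y = 0).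
  apply: prop_vspace => [y _|c u v hu hv y hy]; first by rewrite lfun20.
  by rewrite lfun2D lfun2Z hu // hv // scaler0 addr0.
have rk x : r x = 0 -> x \in k.
  move=> h; apply/hk => y hy; rewrite -(sp _ hy) -sr h zero_lfunE linear0 //.
have kr x : x \in k -> r x = 0.
  move=> /hk h; apply/lfunP => t; rewrite zero_lfunE -[LHS]ps sr h // linear0 //.
have ik : ideal B k.
  move=> x y _ /hk hy; apply/hk => z hz.
  have -> : B (B x y) z = B x (B y z) - B y (B x z) by rewrite [B x (B y z)](brJ HB) addrK.
  by rewrite hy // linear0 hy ?subr0 //; apply: iq; rewrite ?memvf.
have qk : (q <= k)%VS by apply/subvP => v hv; apply/hk => y hy; exact: qq.
(* The Killing orthogonal p of k meets k exactly in q. *)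
have [p [ip hp]] := ideal_perp rad_ideal ik (@ideal_full _ _ B).
have qp : (q <= p)%VS.
  by apply/subvP => v hv; apply/hp; split; rewrite ?memvf // => y _; move/killing_radical: hv.
have pk x : x \in p -> x \in k -> x \in q.
  move=> xp xk.
  have iI : ideal B (p :&: k)%VS.
    move=> u v _ /memv_capP [vp vk]; apply/memv_capP; split; [exact: ip (memvf _) _ | exact: ik (memvf _) _].
  apply: (subvP (radq iI _)); last by apply/memv_capP.
  apply: killing_isotropic_solvable => // u v /memv_capP [/hp [_ hu] _] /memv_capP [_ vk].
  exact: hu.
(* A functional that vanishes on k but not at [x0] is represented through the Killing form by an
   element of p, which is not in q. *)
have pq : p != q.
  have x0k : x0 \notin k by apply: contra_notN xy0 => /hk; exact.
  have [e [e' [_ ee h1 h2]]] := dual_basis (subvf q) kd_q0 kd_nd.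
  have [phi [phik phi1]] : exists phi : 'Hom(g, K^o), (forall x, x \in k -> phi x = 0) /\ phi x0 = 1.
    pose w := x0 - projv k x0.
    have w0 : w != 0.
      by apply: contraNneq x0k => /eqP; rewrite subr_eq0 => /eqP ->; exact: memv_proj.
    have hW : coord [tuple w] ord0 w = 1.
      have fw : free [:: w] by rewrite seq1_free.
      by have := coord_free ord0 ord0 fw; rewrite eqxx.
    have [f fE] : exists f : 'Hom(g, K^o), forall x, f x = coord [tuple w] ord0 (x - projv k x).
      apply: lfun_of => c u v.
      have -> : c *: u + v - projv k (c *: u + v) = c *: (u - projv k u) + (v - projv k v).
        by rewrite linearP scalerBr; zmod.
      by rewrite linearP.
    exists f; split=> [x xk|]; rewrite fE //.
    by rewrite projv_id // subrr linear0.
  pose x := \sum_i phi (e i) *: e' i.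
  have hx z : trform B z x = phi z.
    rewrite trform_sumr.
    have := phik _ (subvP qk _ (h1 z (memvf z))).
    rewrite linearB linear_sum /= => /eqP; rewrite subr_eq0 => /eqP ->.
    by apply: eq_bigr => i _; rewrite linearZ /= mulrC.
  have xp : x \in p.
    by apply/hp; split; rewrite ?memvf // => y yk; rewrite trformC hx phik.
  apply: contraTneq xp => ->; apply/negP => /killing_radical /(_ x0).
  by rewrite trformC hx phi1 => /eqP; rewrite oner_eq0.
have bd0 x y : x \in q -> y \in p -> trform r x y = 0.
  by move=> hx _; rewrite /trform kr ?comp_lfun0l ?ltr0 // (subvP qk).
(* The radical R of the trace form on p is solvable: by Cartan's criterion a derived term of R lies
   in the kernel k of r, hence in q, which is abelian. *)
have bnd x : x \in p -> (forall y, y \in p -> trform r x y = 0) -> x \in q.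
  move=> xp hx; have [R [iR hR]] := ideal_perp rr ip ip.
  apply: (subvP (radq iR _)); last exact/hR.
  have Rp u : u \in R -> u \in p by move=> /hR [].
  have [n hn] := cartan_criterion (ideal_sub iR) (fun x y _ _ => rr x y (memvf x) (memvf y))
    (fun u v hu hv => (proj2 (proj1 (hR u) hu)) v (Rp v hv)).
  exists n.+1; apply/eqP; rewrite -subv0; apply: brs_subP => u v hu hv.
  have inq w : w \in derived B n R -> w \in q.
    move=> hw; apply: pk; last by apply: rk; exact: hn.
    by apply: Rp; apply: (subvP (derived_sub n (ideal_sub iR))).
  by rewrite memv0 qq ?inq.
have [e [e' [ep ee h1 h2]]] := dual_basis qp bd0 bnd.
have qB x y : y \in q -> B x y \in q by move=> hy; apply: iq; rewrite ?memvf.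
have [C CE] : exists C : 'End(g), forall z, C z = \sum_i B (e i) (B (e' i) z).
  apply: lfun_of => c u v; rewrite scaler_sumr -big_split; apply: eq_bigr => i _.
  by rewrite !linearP.
have Cq v : v \in q -> C v \in q by move=> hv; rewrite CE; apply: memv_suml => i _; rewrite !qB.
have Ccom x z : z \in q -> B x (C z) = C (B x z).
  move=> hz; rewrite !CE linear_sum.
  have e1 i : B x (B (e i) (B (e' i) z)) = B (B x (e i)) (B (e' i) z) +
      (B (e i) (B (B x (e' i)) z) + B (e i) (B (e' i) (B x z))).
    by rewrite (brJ HB x) (brJ HB x (e' i)) linearD.
  rewrite (eq_bigr _ (fun i _ => e1 i)) !big_split /= addrA.
  rewrite (casimir_invariant HB rr (F := fun u v => B u (B v z)) x ip ep h1 h2).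
  - by rewrite addNr add0r.
  - by move=> c u v w; rewrite lfun2D lfun2Z.
  - by move=> c u v w; rewrite lfun2D lfun2Z linearP.
  - by move=> u v hu _; rewrite qq // qB.
  - by move=> u v _ hv; rewrite (qq hv hz) linear0.
(* The kernel of C in q is an ideal, so by minimality it is 0 or q. The second case is excluded
   because the Casimir operator has trace dim (p / q), which is nonzero. *)
have Cinj v : v \in q -> C v = 0 -> v = 0.
  have iL : ideal B (q :&: lker C)%VS.
    move=> x y _ /memv_capP [yq]; rewrite memv_ker => /eqP Cy0; apply/memv_capP; split; first exact: qB.
    by rewrite memv_ker -Ccom // Cy0 linear0.
  have [L0|Lq] := minq _ iL (capvSl _ _).
    move=> vq Cv; apply/eqP; rewrite -memv0 -L0; apply/memv_capP; split=> //.
    by rewrite memv_ker Cv.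
  have : ltr (\sum_i (r (e i) \o r (e' i))%VF) = 0.
    have -> : \sum_i (r (e i) \o r (e' i))%VF = 0; last exact: ltr0.
    apply/lfunP => t; rewrite sum_lfunE zero_lfunE -[LHS]ps linear_sum /=.
    have : s t \in (q :&: lker C)%VS by rewrite Lq.
    move=> /memv_capP [_]; rewrite memv_ker CE => /eqP h.
    rewrite (eq_bigr (fun i => B (e i) (B (e' i) (s t)))) ?h ?linear0 // => i _.
    by rewrite comp_lfunE !sr.
  rewrite ltr_sum (eq_bigr (fun=> 1)) => [|i _]; last first.
    by have := ee i i; rewrite eqxx.
  rewrite sumr_const card_ord => /eqP; rewrite pnatr_eq0 dimv_eq0 diffv_eq0 => pq'.
  by move: pq; rewrite eqEsubv qp pq'.
pose P := projv q.
have Pq x : P x \in q by exact: memv_proj.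
pose D x y := B x (P y) - B y (P x) - P (B x y).
have DL c u v w : D (c *: u + v) w = c *: D u w + D v w.
  by rewrite /D !lfun2D !lfun2Z !linearP /= !scalerBr !scalerN; zmod.
have DR c u v w : D u (c *: v + w) = c *: D u v + D u w.
  by rewrite /D !lfun2D !lfun2Z !linearP /= !scalerBr !scalerN; zmod.
have Dq x y : D x y \in q by rewrite !memvB ?qB ?Pq.
have D0 x y : x \in q -> D x y = 0.
  move=> hx; rewrite /D (qq hx) // sub0r /P [projv q x]projv_id //.
  by rewrite projv_id ?(idealr HB _ iq) // [B y x](brC HB) opprK subrr.
have D0r x y : y \in q -> D x y = 0.
  move=> hy; rewrite /D (qq hy) // subr0 /P [projv q y]projv_id //.
  by rewrite projv_id ?qB // subrr.
(* The cocycle identity, in a form ready for contraction with the Casimir tensor. It holds because D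
   is the coboundary of P in the adjoint module. *)
have cocyc a x y : B a (D x y) = B x (D a y) - D (B x a) y - B y (D a x) + D (B y a) x - D a (B x y).
  have h1' : B x a = - B a x by rewrite (brC HB).
  have h2' : B y a = - B a y by rewrite (brC HB).
  have h3 : B a (B x y) = B x (B a y) - B y (B a x).
    by rewrite (brJ HB a) [B (B a x) y](brC HB) addrC.
  have k1 : B (B x a) y = B y (B a x) by rewrite (brC HB) h1' linearN opprK.
  have k2 : B (B y a) x = B x (B a y) by rewrite (brC HB) h2' linearN opprK.
  have brJl u v z : B (B u v) z = B u (B v z) - B v (B u z) by rewrite (brJ HB u) addrK.
  have B3 u v w z : B u (v - w - z) = B u v - B u w - B u z by rewrite !linearB.
  have p1 : B y (P (B x a)) = - B y (P (B a x)) by rewrite h1' !linearN.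
  have p2 : B x (P (B y a)) = - B x (P (B a y)) by rewrite h2' !linearN.
  have p3 : P (B a (B x y)) = P (B x (B a y)) - P (B y (B a x)) by rewrite h3 linearB.
  rewrite /D !B3 k1 k2 p1 p2 p3 (brJl x a) (brJl y a) (brJl x y).
  zmod_with zsame_syn.
(* The contraction of D with the Casimir tensor; [dpsi] says that its coboundary is C applied to
   D. *)
have [psi psiE] : exists f : 'End(g), forall x, f x = \sum_i B (e i) (D (e' i) x).
  apply: lfun_of => c u v; rewrite scaler_sumr -big_split; apply: eq_bigr => i _.
  by rewrite DR linearP.
have dpsi x y : C (D x y) = B x (psi y) - B y (psi x) - psi (B x y).
  have half u v : B u (psi v) = \sum_i B (e i) (B u (D (e' i) v) - D (B u (e' i)) v).
    rewrite psiE linear_sum.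
    have e1 i : B u (B (e i) (D (e' i) v)) = B (B u (e i)) (D (e' i) v) + B (e i) (B u (D (e' i) v)).
      by rewrite (brJ HB u).
    rewrite (eq_bigr _ (fun i _ => e1 i)) big_split /=.
    rewrite (casimir_invariant HB rr (F := fun a b => B a (D b v)) u ip ep h1 h2).
    - by rewrite -sumrN -big_split /=; apply: eq_bigr => i _; rewrite [RHS]linearB [RHS]addrC.
    - by move=> c a b w; rewrite lfun2D lfun2Z.
    - by move=> c a b w; rewrite DL linearP.
    - by move=> a b ha _; rewrite qq.
    - by move=> a b _ hb; rewrite D0 // linear0.
  rewrite !half psiE CE -!sumrB; apply: eq_bigr => i _.
  rewrite cocyc -!linearB; congr (B _ _); zmod.
(* C P and psi have the same coboundary, so Q is a derivation from g to q. On q it agrees with the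
   invertible C, so its kernel is a subalgebra complementing q. *)
have [Q QE] : exists f : 'End(g), forall x, f x = C (P x) - psi x.
  by apply: lfun_of => c u v; rewrite [P _]linearP [C _]linearP [psi _]linearP scalerBr; zmod.
have Qq x : Q x \in q.
  by rewrite QE psiE memvB ?Cq //; apply: memv_suml => i _; rewrite qB.
have QCq v : v \in q -> Q v = C v.
  move=> hv; rewrite QE /P projv_id // psiE big1 ?subr0 // => i _.
  by rewrite D0r // linear0.
have Qder x y : Q (B x y) = B x (Q y) - B y (Q x).
  rewrite !QE !linearB /= !Ccom //.
  have -> : C (P (B x y)) = C (B x (P y)) - C (B y (P x)) - C (D x y).
    by rewrite /D !linearB /=; zmod.
  by rewrite dpsi; zmod.
exists (lker Q); split.
- by move=> x y; rewrite !memv_ker Qder => /eqP -> /eqP ->; rewrite ![B _ 0]linear0 subrr.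
- apply: contraNneq qn0 => kQ; rewrite -subv0; apply/subvP => v hv; rewrite memv0.
  apply/eqP/Cinj => //; rewrite -QCq //; apply/eqP; rewrite -memv_ker kQ; exact: memvf.
- apply/eqP; rewrite eqEsubv subvf /=; apply/subvP => z _.
  have : Q z \in (C @: q)%VS.
    have -> : (C @: q)%VS = q; last exact: Qq.
    apply/eqP; rewrite eqEdim; apply/andP; split.
      by apply/subvP => _ /memv_imgP [v hv ->]; exact: Cq.
    rewrite limg_dim_eq //; apply/eqP; rewrite -subv0; apply/subvP => v /memv_capP [hv].
    by rewrite memv_ker memv0 => /eqP /(Cinj _ hv) ->.
  move=> /memv_imgP [v hv e0].
  rewrite -[z](subrK v) memv_add // memv_ker linearB /= e0 QCq //.
  by rewrite subrr.
Qed.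

Lemma levi_step : (forall I, ideal B I -> (I <= q)%VS -> I = 0%VS \/ I = q) ->
  exists h : {vspace g}, [/\ brsub B h h h, h != fullv & (h + q)%VS = fullv].
Proof.
move=> minq; have [h|/existsNP [x /existsNP [y /not_implyP [hy hxy]]]] :=
  pselect (forall x y, y \in q -> B x y = 0); first exact: levi_central.
by apply: levi_noncentral => //; exists x, y.
Qed.

End LeviStep.

Lemma sub_maximal (K : fieldType) (V : vectType K) (P : {vspace V} -> Prop) (Y : {vspace V}) : P Y ->
  exists Z : {vspace V}, [/\ P Z, (Y <= Z)%VS & forall W, P W -> (Z <= W)%VS -> W = Z].
Proof.
move: {2}(dim V - \dim Y)%N (leqnn (dim V - \dim Y)) => n; elim: n Y => [|n IH] Y hn PY.
  exists Y; split=> // W _ YW; apply/eqP; rewrite eq_sym eqEdim YW /=.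
  apply: leq_trans (dimvS (subvf W)) _; rewrite dimvf.
  by move: hn; rewrite leqn0 subn_eq0.
have [h|/existsNP [W /not_implyP [PW /not_implyP [YW /eqP nW]]]] :=
    pselect (forall W, P W -> (Y <= W)%VS -> W = Y); first by exists Y.
have [|Z [PZ WZ hZ]] := IH W _ PW.
  have : (\dim Y < \dim W)%N by rewrite (ltn_leqif (dimv_leqif_eq YW)) eq_sym.
  by move: hn; lia.
by exists Z; split=> //; exact: subv_trans YW WZ.
Qed.

Section Levi.
Variables (K : numClosedFieldType) (g : vectType K) (B : 'Hom(g, 'End(g))).
Hypothesis HB : lie_alg B.

Lemma derived_sum n (J R : {vspace g}) : ideal B R ->
  (derived B n (J + R) <= derived B n J + R)%VS.
Proof.
move=> iR; elim: n => [|n IH]; first exact: subvv.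
apply: brs_subP => x y /(subvP IH) /memv_addP [x1 hx1 [x2 hx2 ->]].
move=> /(subvP IH) /memv_addP [y1 hy1 [y2 hy2 ->]].
rewrite lfun2D !linearD /= -addrA; apply: memv_add; first exact: mem_brs.
by apply: memvD; [exact: iR (memvf _) _ | apply: memvD; [exact: (idealr HB) | exact: iR (memvf _) _]].
Qed.

Lemma solvable_sum (J R : {vspace g}) : ideal B R -> solvable B J -> solvable B R ->
  solvable B (J + R)%VS.
Proof.
move=> iR [n hn] [m hm]; exists (m + n)%N; apply/eqP; rewrite -subv0 -hm derived_add.
by apply: derivedS; apply: subv_trans (derived_sum n J iR) _; rewrite hn add0v.
Qed.

Lemma ideal_sum (J R : {vspace g}) : ideal B J -> ideal B R -> ideal B (J + R)%VS.
Proof.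
move=> iJ iR x y _ /memv_addP [u hu [v hv ->]]; rewrite linearD.
by apply: memv_add; [exact: iJ (memvf _) _ | exact: iR (memvf _) _].
Qed.

Lemma radical_exists : exists R : {vspace g}, [/\ ideal B R, solvable B R &
  forall I, ideal B I -> solvable B I -> (I <= R)%VS].
Proof.
have [|R [[iR sR] _ hR]] := @sub_maximal K g (fun R => ideal B R /\ solvable B R) 0%VS.
  split; last by exists 0%N.
  by move=> x y _; rewrite !memv0 => /eqP ->; rewrite linear0.
exists R; split=> // I iI sI.
have <- : (I + R)%VS = R; last exact: addvSl.
by apply: hR; [split; [exact: ideal_sum | exact: solvable_sum] | exact: addvSr].
Qed.

Section Reduction.
Variables R s : {vspace g}.
Hypotheses (iR : ideal B R) (sR : solvable B R) (maxR : forall I, ideal B I -> solvable B I -> (I <= R)%VS).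
Hypotheses (ss : brsub B s s s) (sRf : (s + R)%VS = fullv) (sR0 : (s :&: R)%VS != 0%VS).

(** Dividing s by an ideal a that is maximal among those properly inside q, where q is the
    intersection of s and R, makes q / a a minimal ideal. A proper supplement of q / a in s / a
    pulls back to a smaller s'. *)
Lemma levi_reduction : exists s' : {vspace g},
  [/\ brsub B s' s' s', (s' <= s)%VS, s' != s & (s' + R)%VS = fullv].
Proof.
pose q := (s :&: R)%VS; have qn0 : q != 0%VS := sR0.
have qs : (q <= s)%VS by exact: capvSl.
have iq : brsub B s q q.
  move=> x y hx /memv_capP [ys yR]; apply/memv_capP; split; first exact: ss.
  exact: iR (memvf _) _.
have [|a [[ia aq naq] _ maxa]] :=
    @sub_maximal K g (fun I => [/\ brsub B s I I, (I <= q)%VS & I != q]) 0%VS.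
  split; rewrite ?sub0v // 1?eq_sym // => x y _; rewrite !memv0 => /eqP ->.
  by rewrite linear0.
have as_ : (a <= s)%VS by exact: subv_trans aq qs.
have [T [p [t [pt ts pa tp]]]] := subquotient as_.
have [||C CE] := @bilinear_lfun K T T T (fun u v => p (B (t u) (t v))).
- by move=> c u v w; rewrite linearP lfun2D lfun2Z linearP.
- by move=> c u v w; rewrite !linearP.
have pker x : x \in s -> p x = 0 -> x \in a.
  by move=> /tp + px; rewrite px linear0 subr0.
have peq x y : x - y \in a -> p x = p y.
  by move=> /pa; rewrite linearB => /eqP; rewrite subr_eq0 => /eqP.
have pB x y : x \in s -> y \in s -> p (B x y) = C (p x) (p y).
  move=> hx hy; rewrite CE; apply: peq.
  have -> : B x y - B (t (p x)) (t (p y)) = B x (y - t (p y)) - B (t (p y)) (x - t (p x)).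
    by rewrite !linearB /= [B (t (p y)) x](brC HB) [B (t (p y)) (t (p x))](brC HB); zmod.
  by apply: memvB; apply: ia => //; exact: tp.
have HC : lie_alg C.
  split=> [u|u v w]; first by rewrite CE (brxx HB) linear0.
  rewrite -[u]pt -[v]pt -[w]pt -!pB ?ss // (brJ HB) linearD //.
have pull (I : {vspace T}) : exists J : {vspace g},
    (forall x, x \in J <-> x \in s /\ p x \in I).
  apply: prop_vspace => [|c x y [hx px] [hy py]].
    by rewrite mem0v linear0 mem0v.
  by rewrite linearP !memvD ?memvZ.
pose qT := (p @: q)%VS.
have iqT : ideal C qT.
  move=> u _ _ /memv_imgP [y hy ->]; rewrite -[u]pt -(pB _ _ (ts u) (subvP qs y hy)).
  by apply: memv_img; apply: iq.
have qTn0 : qT != 0%VS.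
  apply: contraNneq naq => q0; rewrite eqEsubv aq; apply/subvP => x hx.
  apply: pker; first exact: (subvP qs).
  by apply/eqP; rewrite -memv0 -q0 memv_img.
have minq (I : {vspace T}) : ideal C I -> (I <= qT)%VS -> I = 0%VS \/ I = qT.
  move=> iI Iq; have [J hJ] := pull I.
  have [aJ|aJ] := eqVneq (J :&: q)%VS q.
    right; apply/eqP; rewrite eqEsubv Iq /=; apply/subvP => _ /memv_imgP [x hx ->].
    by move: hx; rewrite -aJ => /memv_capP [/hJ []].
  left; have eqa : (J :&: q)%VS = a.
    apply: maxa.
      split; [|exact: capvSr|exact: aJ] => x z hx /memv_capP [/hJ [ys py] yq].
      apply/memv_capP; split; last exact: iq.
      by apply/hJ; rewrite pB // ss //; split=> //; apply: iI (memvf _) _.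
    apply/subvP => x hx; apply/memv_capP; split; last exact: (subvP aq).
    by apply/hJ; rewrite pa // mem0v (subvP as_).
  apply/eqP; rewrite -subv0; apply/subvP => u hu; rewrite memv0.
  have := subvP Iq u hu => /memv_imgP [x hx ux].
  rewrite ux pa // -eqa; apply/memv_capP; split=> //; apply/hJ.
  by rewrite (subvP qs) // -ux.
have derp n (J : {vspace g}) : (J <= s)%VS -> (p @: derived B n J <= derived C n (p @: J))%VS /\
   (derived C n (p @: J) <= p @: derived B n J)%VS.
  move=> Js; elim: n => [|n [IH1 IH2]]; first by split; exact: subvv.
  have ds : (derived B n J <= s)%VS.
    elim: (n) => //= m IHm; apply: brs_subP => x y hx hy; apply: ss; exact: (subvP IHm).
  split=> /=.
    apply/subvP => _ /memv_imgP [z hz ->].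
    suff : (brs B (derived B n J) (derived B n J) <= p @^-1: brs C (derived C n (p @: J)) (derived C n (p @: J)))%VS.
      by move=> /subvP /(_ z hz); rewrite memv_preim.
    apply: brs_subP => x y hx hy; rewrite -memv_preim pB ?(subvP ds) //.
    by apply: mem_brs; apply: (subvP IH1); exact: memv_img.
  apply: brs_subP => u v /(subvP IH2) /memv_imgP [x hx ->] /(subvP IH2) /memv_imgP [y hy ->].
  by rewrite -pB ?(subvP ds) //; apply: memv_img; exact: mem_brs.
have [m hm] := sR.
have solq : solvable C qT.
  exists m; apply/eqP; rewrite -subv0; apply: subv_trans (derp m q qs).2 _.
  suff -> : derived B m q = 0%VS by rewrite limg0 subvv.
  by apply/eqP; rewrite -subv0 -hm; apply: derivedS; exact: capvSr.
(* By minimality [qT, qT] is 0 or qT, and solvability excludes the latter. *)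
have abq x y : x \in qT -> y \in qT -> C x y = 0.
  have [||q0|qq] := minq (brs C qT qT).
  - exact: ideal_brs.
  - exact: ideal_brsr.
  - by move=> hx hy; apply/eqP; rewrite -memv0 -q0; exact: mem_brs.
  have [n hn] := solq; have : derived C n qT = qT by elim: (n) => //= k ->.
  by rewrite hn => q0; move: qTn0; rewrite -q0 eqxx.
(* If J is the preimage of I in s, then J + R is an ideal of g because s + R = g. It is solvable, so
   it lies in R. *)
have radT (I : {vspace T}) : ideal C I -> solvable C I -> (I <= qT)%VS.
  move=> iI [n hn]; have [J hJ] := pull I.
  have Js : (J <= s)%VS by apply/subvP => x /hJ [].
  have pJ : (p @: J <= I)%VS by apply/subvP => _ /memv_imgP [x /hJ [_ hx] ->].
  have dJ : (derived B n J <= R)%VS.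
    apply: (@subv_trans _ _ a); last by apply: subv_trans aq _; exact: capvSr.
    apply/subvP => x hx; apply: pker.
      have ds : (derived B n J <= s)%VS.
        elim: (n) => //= k IHk; apply: brs_subP => u v hu hv; apply: ss; exact: (subvP IHk).
      exact: (subvP ds).
    apply/eqP; rewrite -memv0 -hn; apply: (subvP (derivedS C n pJ)).
    by apply: (subvP (derp n J Js).1); exact: memv_img.
  have JR : (J + R <= R)%VS.
    apply: maxR.
      move=> x y _ /memv_addP [u hu [v hv ->]]; rewrite linearD /=.
      have : x \in (s + R)%VS by rewrite sRf memvf.
      move=> /memv_addP [x1 hx1 [x2 hx2 ->]]; rewrite lfun2D -addrA; apply: memv_add.
        apply/hJ; have [us pu] := (proj1 (hJ u)) hu; rewrite pB // ss //; split=> //.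
        exact: iI (memvf _) _.
      by apply: memvD; [exact: (idealr HB) | exact: iR (memvf _) _].
    apply: solvable_sum => //; exists (m + n)%N; apply/eqP; rewrite -subv0 -hm derived_add.
    exact: derivedS.
  apply/subvP => u hu; rewrite -[u]pt; apply: memv_img; apply/memv_capP; split; first exact: ts.
  apply: (subvP JR); apply: (subvP (addvSl _ _)); apply/hJ; rewrite pt; split=> //; exact: ts.
have [h [hh hf hq]] := levi_step HC iqT abq radT qTn0 minq.
have [s' hs'] := pull h.
exists s'; split.
- move=> x y /hs' [xs px] /hs' [ys py]; apply/hs'; rewrite pB // ss //; split=> //; exact: hh.
- by apply/subvP => x /hs' [].
- apply: contraNneq hf => e; rewrite eqEsubv subvf; apply/subvP => u _.
  by have := ts u; rewrite -e => /hs' [_]; rewrite pt.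
- apply/eqP; rewrite eqEsubv subvf /= -sRf subv_add addvSr andbT; apply/subvP => x hx.
  have : p x \in (h + qT)%VS by rewrite hq memvf.
  move=> /memv_addP [u hu [_ /memv_imgP [y hy ->] e]].
  rewrite -[x](subrK y) memv_add //.
    apply/hs'; rewrite linearB /= e addrK; split=> //.
    by rewrite memvB // (subvP qs).
  by apply: (subvP (capvSr s R)).
Qed.

End Reduction.

(** A subalgebra s minimal with s + R = g meets R in 0, since the reduction would shrink it
    otherwise. *)
Lemma levi : exists R s : {vspace g},
  [/\ ideal B R, solvable B R, forall I, ideal B I -> solvable B I -> (I <= R)%VS &
      [/\ brsub B s s s, (s + R)%VS = fullv & (s :&: R = 0)%VS]].
Proof.
have [R [iR sR maxR]] := radical_exists.
have [|s [[ss sf] _ mins]] :=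
    @sub_minimal K g (fun s => brsub B s s s /\ (s + R)%VS = fullv) fullv.
  by split; [move=> *; exact: memvf | exact: sumfv].
exists R, s; split=> //; split=> //.
apply/eqP; apply: contrapT => /negP s0.
have [s' [ss' s's ns' sf']] := levi_reduction iR sR maxR ss sf s0.
by move: ns'; rewrite (mins s') ?eqxx.
Qed.

End Levi.

(** * Ado's theorem *)

Section NilpotentChain.
Variables (K : fieldType) (g : vectType K) (B : 'Hom(g, 'End(g))).
Hypothesis HB : lie_alg B.

(** Apply to a vector of Y outside X a longest word that does not send it into X. *)
Lemma longest_word (M : {vspace g}) (V : vectType K) (r : 'Hom(g, 'End(V))) k (X Y : {vspace V}) :
  nilact M r k -> stab M r Y -> ~~ (Y <= X)%VS ->
  exists v, [/\ v \in Y, v \notin X & forall x, x \in M -> r x v \in X].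
Proof.
move=> nk sY /subvPn [v hv nv].
have exj : exists j, `[< forall s, size s = j -> {subset s <= M} -> wact r s v \in X >].
  by exists k; apply/asboolP => s hs sM; rewrite nk // mem0v.
case: (ex_minnP exj) => -[|j] /asboolP hj minj.
  by move: nv; rewrite (hj [::]) // => z; rewrite in_nil.
have [h|/existsNP [s /not_implyP [hs /not_implyP [sM /negP hX]]]] :=
    pselect (forall s, size s = j -> {subset s <= M} -> wact r s v \in X).
  by have := minj j; rewrite ltnn => /(_ (asboolT h)).
exists (wact r s v); split=> //.
  elim: s {hs hX} sM => [|x s IH] sM //=; apply: sY; first by apply: sM; rewrite mem_head.
  by apply: IH => z hz; apply: sM; rewrite inE hz orbT.
move=> x hx; apply: (hj (x :: s)); rewrite /= ?hs // => z.
by rewrite inE => /orP [/eqP ->|/sM].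
Qed.

(** Modulo a stable X, the iterates under y of a vector sent into X by a are sent into X as well,
    because y normalizes a. The last iterate outside X gives the next step of a flag. *)
Lemma nilact_add_line (a : {vspace g}) y (V : vectType K) (r : 'Hom(g, 'End(V))) k :
  is_rep B (a + <[y]>)%VS r -> (forall x, x \in a -> B x y \in a) -> nilact a r k ->
  (forall v, exists m, iter m (r y) v = 0) -> exists k', nilact (a + <[y]>)%VS r k'.
Proof.
move=> rA ya nk yn; set A := (a + <[y]>)%VS in rA *.
have aA : (a <= A)%VS by exact: addvSl.
have yA : y \in A by apply: (subvP (addvSr _ _)); exact: memv_line.
apply: (@flag_nilact K g A A) => X sX nX.
have [||v [_ nv hv]] := @longest_word a V r k X fullv nk.
- by move=> *; exact: memvf.
- by apply: contra nX => h; apply/eqP/subv_anti; rewrite subvf h.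
have W m x : x \in a -> r x (iter m (r y) v) \in X.
  elim: m x => [|m IH] x hx; first exact: hv.
  rewrite iterS; set w := iter m _ _ in IH *.
  have -> : r x (r y w) = r (B x y) w + r y (r x w) by rewrite (rA _ _ (subvP aA x hx) yA) subrK.
  by apply: memvD; [apply: IH; exact: ya | apply: sX => //; exact: IH].
have exm : exists m, iter m (r y) v \in X by have [m hm] := yn v; exists m; rewrite hm mem0v.
case: (ex_minnP exm) => -[|m] hm minm; first by rewrite hm in nv.
set w := iter m (r y) v in hm *.
have nw : w \notin X by apply/negP => /minm; rewrite ltnn.
have inX x u : x \in A -> u \in (X + <[w]>)%VS -> r x u \in X.
  move=> hx /memv_addP [u1 hu1 [_ /vlineP [d ->] ->]]; rewrite linearD linearZ /=.
  apply: memvD; first exact: sX.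
  move: hx => /memv_addP [x1 hx1 [_ /vlineP [c ->] ->]]; rewrite lfun2D lfun2Z.
  by apply: memvZ; apply: memvD; [exact: W | apply: memvZ; exact: hm].
exists (X + <[w]>)%VS; split=> //.
- by move=> x u hx hu; apply: (subvP (addvSl _ _)); exact: inX.
- exact: addvSl.
- by apply: contraNneq nw => ->; apply: (subvP (addvSr _ _)); exact: memv_line.
Qed.

(** Ado's theorem for a single element c, with the nilpotency on N that the next extension needs. *)
Definition represents (a N : {vspace g}) (c : g) := exists (V : vectType K) (r : 'Hom(g, 'End(V))),
  [/\ is_rep B a r, exists k, nilact N r k & exists v, r c v != 0].

(** On K^2 the element c acts by a nonzero matrix of square 0. *)
Lemma represents_line c : c != 0 -> represents <[c]>%VS <[c]>%VS c.
Proof.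
move=> c0; pose V : vectType K := (K^o * K^o)%type.
pose phi (x : g) : K := coord [tuple c] ord0 x.
have phic : phi c = 1.
  have fc : free [:: c] by rewrite seq1_free.
  by have := coord_free ord0 ord0 fc; rewrite eqxx.
have phiL a x y : phi (a *: x + y) = a * phi x + phi y by rewrite /phi linearP.
have [||r rE] := @bilinear_lfun K g V V (fun x v => (0, phi x * v.1)).
- move=> a x y v; rewrite phiL; apply: (congr2 pair); first by rewrite /= scaler0 addr0.
  by rewrite mulrDl -mulrA.
- move=> a x v w; apply: (congr2 pair); first by rewrite /= scaler0 addr0.
  by rewrite /= mulrDr; congr (_ + _); exact: mulrCA.
have rr x y v : r x (r y v) = 0 by rewrite !rE /= mulr0.
exists V, r; split.
- move=> _ _ /vlineP [a ->] /vlineP [b ->] v.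
  have -> : B (a *: c) (b *: c) = 0 by rewrite lfun2Z linearZ /= (brxx HB) !scaler0.
  by rewrite lfun20 !rr subrr.
- by exists 2%N => -[|x [|y []]] // _ _ v; exact: rr.
- exists (1, 0); rewrite rE phic mul1r; apply/eqP => /(congr1 snd) /= /eqP.
  by rewrite oner_eq0.
Qed.

(** An ideal a of n containing c grows by lines: nilpotency of n gives y outside a with [n, y]
    inside a. Zassenhaus' extension applies with N = a, and since ad y is nilpotent on a, all of a +
    K y acts nilpotently again. *)
Lemma represents_nilpotent (n : {vspace g}) k c : ideal B n -> nilact n B k ->
  c != 0 -> c \in n -> (forall x, B x c = 0) -> represents n n c.
Proof.
move=> idn nk c0 cn cc.
suff main d (a : {vspace g}) : (\dim n - \dim a <= d)%N -> (<[c]> <= a)%VS -> (a <= n)%VS ->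
    brsub B n a a -> represents a a c -> represents n n c.
  apply: (main _ <[c]>%VS (leqnn _)) (represents_line c0); rewrite ?subvv //.
  by move=> x _ _ /vlineP [d ->]; rewrite linearZ /= cc scaler0 mem0v.
elim: d a => [|d IH] a hd ca an na ra.
  suff -> : n = a by [].
  by apply/eqP; rewrite eq_sym eqEdim an; move: hd; rewrite leqn0 subn_eq0.
have [an'|an'] := boolP (n <= a)%VS.
  suff -> : n = a by [].
  by apply/eqP; rewrite eqEsubv an' an.
have [|y [yn ya hy]] := longest_word nk _ an'; first exact: ideal_sub.
have [V [r [rr [k0 nk0] [v rv]]]] := ra.
have aa : brsub B a a a by move=> x z hx hz; apply: na => //; exact: (subvP an).
have [|||||V' [r' [rr' nk' rc' ry']]] := @zassenhaus_extension K g B HB a <[y]>%VS a V r aa _ _ _ _ _ rr k0 nk0.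
- by move=> _ _ /vlineP [s ->] /vlineP [t ->]; rewrite lfun2Z linearZ /= (brxx HB) !scaler0 mem0v.
- by move=> _ x /vlineP [s ->] hx; rewrite lfun2Z; apply: memvZ; apply: na.
- exact: subvv.
- exact: aa.
- exact: cap_line0.
have yn0 : exists m, forall x, x \in a -> iter m (B y) x = 0.
  exists k => x hx; have <- : wact B (nseq k y) x = iter k (B y) x by elim: (k) => //= j ->.
  by apply: nk; rewrite ?size_nseq // => z /nseqP [->].
have [k' hk'] := nilact_add_line rr' (fun x hx => hy x (subvP an x hx)) nk' (ry' y (memv_line y) yn0).
apply: (IH (a + <[y]>)%VS).
- by rewrite dim_add_line //; move: hd; lia.
- exact: subv_trans ca (addvSl _ _).
- by rewrite subv_add an; apply/subvP => _ /vlineP [t ->]; exact: memvZ.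
- move=> x _ hx /memv_addP [u hu [_ /vlineP [t ->] ->]]; apply: (subvP (addvSl _ _)).
  by rewrite linearD linearZ /=; apply: memvD; [exact: na | apply: memvZ; exact: hy].
- by exists V', r'; split=> //; [exists k' | apply: rc' rv; apply: (subvP ca); exact: memv_line].
Qed.

End NilpotentChain.

Section Ado.
Variables (K : numClosedFieldType) (g : vectType K) (B : 'Hom(g, 'End(g))).
Hypothesis HB : lie_alg B.

Lemma nilact_add_kernel (N : {vspace g}) (V : vectType K) (r : 'Hom(g, 'End(V))) k c :
  nilact N r k -> r c = 0 -> nilact (N + <[c]>)%VS r k.
Proof.
move=> nk rc s hs sN v.
have [s' [hs' s'N ->]] : exists s', [/\ size s' = size s, {subset s' <= N} & wact r s v = wact r s' v].
  elim: s sN {hs} => [|x s IH] sN; first by exists [::].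
  have [|s' [h1 h2 h3]] := IH; first by move=> z hz; apply: sN; rewrite inE hz orbT.
  have /memv_addP [u hu [_ /vlineP [d ->] xE]] : x \in (N + <[c]>)%VS by apply: sN; rewrite mem_head.
  exists (u :: s'); split; rewrite /= ?h1 //.
    by move=> z; rewrite inE => /orP [/eqP ->|/h2].
  by rewrite xE linearD linearZ /= rc scaler0 addr0 h3.
by apply: nk; rewrite // hs' hs.
Qed.

Lemma ado_central c : c != 0 -> (forall x, B x c = 0) ->
  exists (V : vectType K) (r : 'Hom(g, 'End(V))), is_rep B fullv r /\ exists v, r c v != 0.
Proof.
move=> c0 cc; have [R [s [iR sR maxR [ss sRf sR0]]]] := levi HB.
have ic : ideal B <[c]>%VS.
  by move=> x _ _ /vlineP [d ->]; rewrite linearZ /= cc scaler0 mem0v.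
have cR : (<[c]> <= R)%VS.
  apply: maxR => //; exists 1%N; apply/eqP; rewrite -subv0; apply: brs_subP.
  by move=> x _ _ /vlineP [d ->]; rewrite linearZ /= cc scaler0 mem0v.
pose n := (brs B fullv R + <[c]>)%VS.
have gRn x y : y \in R -> B x y \in n.
  by move=> hy; apply: (subvP (addvSl _ _)); apply: mem_brs; rewrite ?memvf.
have idn : ideal B n.
  by apply: ideal_sum => //; apply: ideal_brs => //; exact: ideal_full.
have nR : (n <= R)%VS by rewrite subv_add cR andbT; exact: ideal_brsr.
have [k nk] : exists k, nilact n B k.
  have [k hk] := radical_nilact HB (ad_rep HB (a := fullv)) iR sR.
  exists k; apply: nilact_add_kernel => //; apply/lfunP => x.
  by rewrite zero_lfunE (brC HB) cc oppr0.
have cn : c \in n by apply: (subvP (addvSr _ _)); exact: memv_line.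
have rn := represents_nilpotent HB idn nk c0 cn cc.
(* Brackets with elements of R fall into n, so n is a valid N for every a between n and R. Nothing
   is asked of b beyond being a subalgebra that meets a in 0, which admits lines of R as well as
   s. *)
have ext (a b : {vspace g}) : (n <= a)%VS -> (a <= R)%VS -> brsub B b b b -> (a :&: b = 0)%VS ->
    represents B a n c -> represents B (a + b)%VS n c.
  move=> na aR bb ab [V [r [rr [k0 nk0] [v rv]]]].
  have [|||V' [r' [rr' nk' rc' _]]] := @zassenhaus_extension K g B HB a b n V r _ bb _ na _ ab rr k0 nk0.
  - by move=> x y hx hy; apply: (subvP na); apply: gRn; exact: (subvP aR).
  - by move=> x y hx hy; apply: gRn; exact: (subvP aR).
  - by move=> x y hx hy; apply: gRn; exact: (subvP nR).
  by exists V', r'; split=> //; [exists k0 | apply: rc' rv; exact: (subvP na)].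
have rR : represents B R n c.
  suff main d (a : {vspace g}) : (\dim R - \dim a <= d)%N -> (n <= a)%VS -> (a <= R)%VS ->
      represents B a n c -> represents B R n c by exact: (main _ n (leqnn _)).
  elim: d a => [|d IH] a hd na aR ra.
    suff -> : R = a by [].
    by apply/eqP; rewrite eq_sym eqEdim aR; move: hd; rewrite leqn0 subn_eq0.
  have [Ra|/subvPn [y hy ya]] := boolP (R <= a)%VS.
    by suff -> : R = a by []; apply/eqP; rewrite eqEsubv Ra aR.
  apply: (IH (a + <[y]>)%VS).
  - by rewrite dim_add_line //; move: hd; lia.
  - exact: subv_trans na (addvSl _ _).
  - by rewrite subv_add aR; apply/subvP => _ /vlineP [t ->]; exact: memvZ.
  - apply: ext => //; last exact: cap_line0.
    by move=> _ _ /vlineP [t ->] /vlineP [u ->]; rewrite lfun2Z linearZ /= (brxx HB) !scaler0 mem0v.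
have [V [r [rr _ hv]]] : represents B (R + s)%VS n c.
  by apply: ext => //; rewrite ?subvv // capvC.
by exists V, r; split=> //; rewrite -sRf addvC.
Qed.

(** A representation with minimal kernel is faithful: its direct sum with one that is nonzero at x
    has a smaller kernel. Starting from the adjoint representation is just a way to have one. *)
Lemma ado : exists (V : vectType K) (r : 'Hom(g, 'End(V))),
  is_rep B fullv r /\ forall x, r x = 0 -> x = 0.
Proof.
pose P (W : {vspace g}) := exists (V : vectType K) (r : 'Hom(g, 'End(V))), is_rep B fullv r /\ lker r = W.
have [|W [[V [r [rr kr]]] _ minW]] := @sub_minimal K g P (lker B).
  by exists g, B; split=> //; exact: ad_rep.
exists V, r; split=> // x rx; apply: contrapT => /eqP x0.
have [V' [r' [rr' [v' rv']]]] : exists (V' : vectType K) (r' : 'Hom(g, 'End(V'))),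
    is_rep B fullv r' /\ exists v, r' x v != 0.
  have [h|/existsNP [y /eqP hy]] := pselect (forall y, B y x = 0); first exact: ado_central.
  by exists g, B; split; [exact: ad_rep | exists y; rewrite (brC HB) oppr_eq0].
have [||r2 r2E] := @bilinear_lfun K g (V * V')%type (V * V')%type (fun y w => (r y w.1, r' y w.2)).
- by move=> a y z w; rewrite !lfun2D !lfun2Z.
- by move=> a y w w'; rewrite !linearP.
have : lker r2 = W.
  apply: minW.
    exists (V * V')%type, r2; split=> // y z _ _ w.
    by rewrite !r2E rr ?memvf // rr' ?memvf.
  apply/subvP => y; rewrite -kr !memv_ker => /eqP r2y; apply/eqP/lfunP => v.
  by have := r2E y (v, 0); rewrite r2y zero_lfunE => /(congr1 fst) /= <-; rewrite zero_lfunE.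
move=> k2; have : x \in lker r2 by rewrite k2 -kr memv_ker rx.
rewrite memv_ker => /eqP r2x; have := r2E x (0, v'); rewrite r2x zero_lfunE => /(congr1 snd) /= h.
by rewrite -h eqxx in rv'.
Qed.

End Ado.

(** * Ado's theorem for structure constants *)

(** Structure constants, with [c i j k] the coefficient of e_k in [e_i, e_j]. Complexification
    becomes a map on constants, and the quotient g / I needs no type. Faithfulness in [struct_rep]
    is the linear independence of the matrices. *)
Definition struct_lie (K : nzRingType) n (c : 'I_n -> 'I_n -> 'I_n -> K) :=
  [/\ forall i k, c i i k = 0, forall i j k, c i j k = - c j i k &
      forall i j k m, \sum_l c j k l * c i l m =
        \sum_l c i j l * c l k m + \sum_l c i k l * c j l m].

Definition struct_rep (K : nzRingType) n (c : 'I_n -> 'I_n -> 'I_n -> K) d (M : 'I_n -> 'M[K]_d) :=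
  (forall i j, M i *m M j - M j *m M i = \sum_k c i j k *: M k) /\
  (forall a : 'I_n -> K, \sum_i a i *: M i = 0 -> forall i, a i = 0).

Lemma ado_struct_closed (K : numClosedFieldType) n (c : 'I_n -> 'I_n -> 'I_n -> K) :
  struct_lie c -> exists d (M : 'I_n -> 'M[K]_d), struct_rep c M.
Proof.
move=> [c0 cC cJ].
pose h (u v : 'rV[K]_n) : 'rV[K]_n := \row_k \sum_i \sum_j u 0 i * v 0 j * c i j k.
have [||B BE] := @bilinear_lfun K 'rV[K]_n 'rV[K]_n 'rV[K]_n h.
- move=> a x y w; apply/rowP => k; rewrite !mxE mulr_sumr -big_split; apply: eq_bigr => i _ /=.
  by rewrite mulr_sumr -big_split; apply: eq_bigr => j _; rewrite !mxE /=; ring.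
- move=> a x y w; apply/rowP => k; rewrite !mxE mulr_sumr -big_split; apply: eq_bigr => i _ /=.
  by rewrite mulr_sumr -big_split; apply: eq_bigr => j _; rewrite !mxE /=; ring.
pose e i : 'rV[K]_n := delta_mx 0 i.
have Be i j : B (e i) (e j) = \sum_k c i j k *: e k.
  apply/rowP => k; rewrite BE mxE summxE.
  rewrite (bigD1 i) //= [X in _ + X]big1 => [|i' ii]; last first.
    by apply: big1 => j' _; rewrite !mxE (negPf ii) andbF !mul0r.
  rewrite (bigD1 j) //= [X in _ + X + _]big1 => [|j' jj]; last first.
    by rewrite !mxE (negPf jj) andbF mulr0 mul0r.
  rewrite [RHS](bigD1 k) //= [X in _ = _ + X]big1 => [|k' kk]; last first.
    by rewrite !mxE eq_sym (negPf kk) andbF mulr0.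
  by rewrite !mxE !eqxx /= !addr0 !mul1r mulr1.
have rv_ind (P : 'rV[K]_n -> Prop) : P 0 -> (forall a u v, P u -> P v -> P (a *: u + v)) ->
    (forall i, P (e i)) -> forall u, P u.
  move=> P0 PL Pe u; rewrite [u]row_sum_delta; apply: (big_ind P) => // [x y Px Py|i _].
    by rewrite -[x]scale1r; exact: PL.
  by rewrite -[_ *: _]addr0; apply: PL.
have HB : lie_alg B.
  split=> [x|x y z].
    have bb i j : B (e i) (e j) = - B (e j) (e i).
      by rewrite !Be -sumrN; apply: eq_bigr => k _; rewrite cC scaleNr.
    have bb0 i : B (e i) (e i) = 0 by rewrite Be big1 // => k _; rewrite c0 scale0r.
    apply/rowP => k; rewrite BE !mxE.
    have sw : \sum_i \sum_j x 0 i * x 0 j * c i j k = - \sum_i \sum_j x 0 i * x 0 j * c i j k.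
      rewrite [LHS]exchange_big -sumrN; apply: eq_bigr => i _; rewrite -sumrN; apply: eq_bigr => j _.
      by rewrite [in LHS]cC; ring.
    by apply/eqP; move/eqP: sw; rewrite -addr_eq0 -mulr2n mulrn_eq0.
  have Jee i j k : B (e i) (B (e j) (e k)) = B (B (e i) (e j)) (e k) + B (e j) (B (e i) (e k)).
    have d1 a b d : B (e a) (B (e b) (e d)) = \sum_m (\sum_l c b d l * c a l m) *: e m.
      rewrite (Be b d) linear_sum (eq_bigr (fun l => \sum_m (c b d l * c a l m) *: e m)).
        by rewrite exchange_big; apply: eq_bigr => m _; rewrite scaler_suml.
      by move=> l _; rewrite linearZ /= Be scaler_sumr; apply: eq_bigr => m _; rewrite scalerA.
    have d2 : B (B (e i) (e j)) (e k) = \sum_m (\sum_l c i j l * c l k m) *: e m.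
      rewrite (Be i j) lfun2_sum (eq_bigr (fun l => \sum_m (c i j l * c l k m) *: e m)).
        by rewrite exchange_big; apply: eq_bigr => m _; rewrite scaler_suml.
      by move=> l _; rewrite lfun2Z Be scaler_sumr; apply: eq_bigr => m _; rewrite scalerA.
    rewrite !d1 d2 -big_split; apply: eq_bigr => m _ /=.
    by rewrite cJ scalerDl.
  have BL w a u v : B w (a *: u + v) = a *: B w u + B w v by rewrite linearP.
  move: x; apply: (rv_ind) => [|a u v hu hv|i]; first by rewrite !(lfun20, linear0, addr0).
    by rewrite !lfun2D !lfun2Z hu hv BL scalerDr; zmod.
  move: y; apply: (rv_ind) => [|a u v hu hv|j]; first by rewrite !(lfun20, linear0, addr0).
    by rewrite !(lfun2D, lfun2Z, BL) hu hv scalerDr; zmod.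
  move: z; apply: (rv_ind) => [|a u v hu hv|k]; first by rewrite !(lfun20, linear0, addr0).
    by rewrite !BL hu hv scalerDr; zmod.
  exact: Jee.
have [V [r [rr rinj]]] := ado HB.
(* The sign compensates for the reversal of products in passing to matrices. *)
exists (dim V), (fun i => - VectorInternalTheory.f2mx (r (e i))).
split=> [i j|a].
- rewrite mulNmx mulmxN opprK mulNmx mulmxN opprK -!f2mxM -f2mxB -(rep_lfun rr) ?memvf //.
  rewrite Be linear_sum (eq_bigr (fun k => c j i k *: r (e k))); last by move=> k _; rewrite linearZ.
  rewrite f2mx_sum; apply: eq_bigr => k _; by rewrite cC scalerN scaleNr.
- move=> ha i.
  have h' : \sum_i a i *: VectorInternalTheory.f2mx (r (e i)) = 0.
    apply/eqP; rewrite -oppr_eq0 -sumrN -[X in _ == X]ha; apply/eqP; apply: eq_bigr => k _.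
    by rewrite scalerN.
  have : \sum_i a i *: e i = 0.
    apply: rinj; rewrite linear_sum; apply/lfunP => v; rewrite zero_lfunE.
    rewrite (eq_bigr (fun k => a k *: r (e k))); last by move=> k _; rewrite linearZ.
    rewrite -f2mx_sum in h'.
    exact: (lpow_nil (k := 1) h' v).
  move=> /(congr1 (fun u : 'rV[K]_n => u 0 i)); rewrite summxE (bigD1 i) //= big1 => [|k ki].
    by rewrite !mxE !eqxx mulr1 addr0.
  by rewrite !mxE eq_sym (negPf ki) andbF mulr0.
Qed.

(** Restriction of scalars: [Phi] is the action of a complex matrix on C^d regarded as R^(2d). It is
    multiplicative, real linear and injective, so independence over C gives independence over R. *)
Lemma ado_struct_real (R : rcfType) n (c : 'I_n -> 'I_n -> 'I_n -> R) :
  struct_lie c -> exists d (M : 'I_n -> 'M[R]_d), struct_rep c M.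
Proof.
move=> [c0 cC cJ].
pose C : numClosedFieldType := R[i]%C.
pose i_ (x : R) : C := (x%:C)%C.
have iM x y : i_ (x * y) = i_ x * i_ y by rewrite /i_ rmorphM.
have iD x y : i_ (x + y) = i_ x + i_ y by rewrite /i_ rmorphD.
have iS (I : finType) (G : I -> R) : i_ (\sum_i G i) = \sum_i i_ (G i) by rewrite /i_ rmorph_sum.
have [|d [M [MB Mfree]]] := @ado_struct_closed C n (fun i j k => i_ (c i j k)).
  split=> [i k|i j k|i j k m].
  - by rewrite c0 /i_ rmorph0.
  - by rewrite cC /i_ rmorphN.
  - under eq_bigr => l _ do rewrite -iM.
    under [X in _ = X + _]eq_bigr => l _ do rewrite -iM.
    under [X in _ = _ + X]eq_bigr => l _ do rewrite -iM.
    by rewrite -!iS cJ iD.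
pose re (A : 'M[C]_d) : 'M[R]_d := map_mx (@complex.Re R) A.
pose im (A : 'M[C]_d) : 'M[R]_d := map_mx (@complex.Im R) A.
have ReS (I : finType) (G : I -> C) : complex.Re (\sum_i G i) = \sum_i complex.Re (G i).
  by rewrite raddf_sum.
have ImS (I : finType) (G : I -> C) : complex.Im (\sum_i G i) = \sum_i complex.Im (G i).
  by rewrite raddf_sum.
have reM A A' : re (A *m A') = re A *m re A' - im A *m im A'.
  apply/matrixP => i j; rewrite !mxE ReS -sumrB; apply: eq_bigr => k _.
  by rewrite !mxE; case: (A i k) => a b; case: (A' k j) => a' b'.
have imM A A' : im (A *m A') = re A *m im A' + im A *m re A'.
  apply/matrixP => i j; rewrite !mxE ImS -big_split; apply: eq_bigr => k _.
  by rewrite !mxE; case: (A i k) => a b; case: (A' k j) => a' b'.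
pose Phi A : 'M[R]_(d + d) := block_mx (re A) (- im A) (im A) (re A).
have PhiM A A' : Phi (A *m A') = Phi A *m Phi A'.
  rewrite /Phi mulmx_block reM imM; congr block_mx.
  - by rewrite mulNmx.
  - by rewrite mulmxN mulNmx opprD.
  - by rewrite addrC.
  - by rewrite mulmxN addrC.
have PhiL (a : R) A A' : Phi (i_ a *: A + A') = a *: Phi A + Phi A'.
  have reL : re (i_ a *: A + A') = a *: re A + re A'.
    apply/matrixP => i j; rewrite !mxE; case: (A i j) => x y; case: (A' i j) => x' y' /=.
    by rewrite mul0r subr0.
  have imL : im (i_ a *: A + A') = a *: im A + im A'.
    apply/matrixP => i j; rewrite !mxE; case: (A i j) => x y; case: (A' i j) => x' y' /=.
    by rewrite mul0r addr0.
  by rewrite /Phi reL imL scale_block_mx add_block_mx opprD -scalerN.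
have Phi0 : Phi 0 = 0.
  by have := PhiL (-1) 0 0; rewrite scaleN1r addNr scaler0 addr0.
have PhiS (a : 'I_n -> R) (G : 'I_n -> 'M[C]_d) :
    Phi (\sum_i i_ (a i) *: G i) = \sum_i a i *: Phi (G i).
  by elim/big_rec2: _ => [//|i x y _ <-]; rewrite PhiL.
exists (d + d)%N, (fun i => Phi (M i)); split=> [i j|a ha i].
  rewrite -!PhiM -PhiS -MB.
  have -> : M i *m M j - M j *m M i = i_ (-1) *: (M j *m M i) + M i *m M j.
    by rewrite /i_ rmorphN rmorph1 scaleN1r addrC.
  by rewrite PhiL scaleN1r addrC.
have : \sum_i i_ (a i) *: M i = 0.
  move: ha; rewrite -PhiS; set A := \sum_i _; rewrite -[0]/(0 : 'M[R]_(d + d)) -block_mx0.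
  move=> /eq_block_mx [re0 _ im0 _]; apply/matrixP => k l; rewrite mxE.
  have := congr1 (fun N : 'M[R]_d => N k l) re0; have := congr1 (fun N : 'M[R]_d => N k l) im0.
  by rewrite !mxE; case: (A k l) => x y /= -> ->.
move=> /Mfree /(_ i) h; have := congr1 (@complex.Re R) h; by [].
Qed.

Lemma ado_struct (R : realType) (isC : bool) n (c : 'I_n -> 'I_n -> 'I_n -> Kof R isC) :
  struct_lie c -> exists d (M : 'I_n -> 'M[Kof R isC]_d), struct_rep c M.
Proof.
case: isC c => c; [exact: (@ado_struct_closed R[i]%C) | exact: ado_struct_real].
Qed.

(** * Weakly complete algebras *)

Section PointwiseTopology.
Variables (T : topologicalType) (J : Type) (X : topologicalType).

Lemma ptws_proj_continuous (j : J) : continuous (fun f : {ptws J -> X} => f j).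
Proof.
move=> f; have /cvg_sup/(_ j)/cvg_image : nbhs f --> f by apply: cvg_id.
move=> h; apply: cvg_trans (h _) => {h}.
  by move=> Q /= [W nbdW <-]; apply: filterS nbdW; exact: preimage_image.
by rewrite eqEsubset; split => y //; exists (fun=> y).
Qed.

Lemma ptws_continuous (h : T -> {ptws J -> X}) :
  (forall j, continuous (fun t => h t j)) -> continuous h.
Proof.
move=> hc t; apply/cvg_sup => j; apply/cvg_image.
  by rewrite eqEsubset; split => y //; exists (fun=> y).
move=> W /(hc j t) nW; exists [set g : J -> X | W (g j)]; first exact: nW.
by rewrite eqEsubset; split => [y [g /= Wg <-]//|y Wy]; exists (fun=> y).
Qed.

End PointwiseTopology.

Definition lin_coords (K : fieldType) (A : lmodType K) (J : Type) (f : A -> J -> K) :=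
  forall a x y j, f (a *: x + y) j = a * f x j + f y j.

(** An alias of A carrying the initial topology of the coordinates f. Their linearity is a parameter
    of the type because it makes addition and scaling continuous. *)
Definition coord_top (K : numFieldType) (A : algType K) (J : Type) (f : A -> J -> K)
  (fL : lin_coords f) : Type := A.

Section CoordTopology.
Variables (K : numFieldType) (A : algType K) (J : Type) (f : A -> J -> K) (fL : lin_coords f).

HB.instance Definition _ := GRing.Algebra.copy (coord_top fL) A.
HB.instance Definition _ := Topological.copy (coord_top fL)
  (initial_topology (f : A -> {ptws J -> K})).

Local Notation W := (coord_top fL).

Lemma coord_top_continuous j : continuous (fun x : W => f x j).
Proof.
move=> x; apply: (@continuous_comp W {ptws J -> K} K f (fun g => g j)).
  exact: (@initial_continuous _ _ (f : A -> {ptws J -> K})).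
exact: ptws_proj_continuous.
Qed.

Lemma to_coord_top_continuous (T : topologicalType) (h : T -> W) :
  (forall j, continuous (fun t => f (h t) j)) -> continuous h.
Proof.
move=> hc; apply/continuousP => _ [B oB <-].
have /continuousP := @ptws_continuous T J K (fun t => f (h t)) hc.
exact.
Qed.

Let coord_top_add : continuous (fun x : W * W => x.1 + x.2).
Proof.
apply: to_coord_top_continuous => j x.
have -> : (fun t : W * W => f (t.1 + t.2) j) = (fun t : W * W => f t.1 j + f t.2 j).
  by apply: funext => t; have := fL 1 t.1 t.2 j; rewrite scale1r mul1r.
apply: (@continuousD K K^o) => /=.
  apply: (@continuous_comp (W * W)%type W K fst (fun y => f y j)); first exact: cvg_fst.
  exact: coord_top_continuous.
apply: (@continuous_comp (W * W)%type W K snd (fun y => f y j)); first exact: cvg_snd.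
exact: coord_top_continuous.
Qed.

HB.instance Definition _ :=
  PreTopologicalNmodule_isTopologicalNmodule.Build W coord_top_add.

Let coord_top_scale : continuous (fun z : K^o * W => z.1 *: z.2).
Proof.
apply: to_coord_top_continuous => j x.
have -> : (fun t : K^o * W => f (t.1 *: t.2) j) = (fun t : K^o * W => t.1 * f t.2 j).
  apply: funext => t; have f0 : f 0 j = 0.
    by have := fL 1 0 0 j; rewrite scale1r mul1r addr0 => /eqP; rewrite -subr_eq subrr eq_sym => /eqP.
  by have := fL t.1 t.2 0 j; rewrite f0 !addr0.
apply: (@continuousM K (K^o * W)%type); first exact: cvg_fst.
apply: (@continuous_comp (K^o * W)%type W K snd (fun y => f y j)); first exact: cvg_snd.
exact: coord_top_continuous.
Qed.

HB.instance Definition _ :=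
  TopologicalNmodule_isTopologicalLmodule.Build K W coord_top_scale.

End CoordTopology.

Lemma coord_top_wc (K : numFieldType) (A : algType K) (J : Type) (f : A -> J -> K)
    (fL : lin_coords f) (h : (J -> K) -> A) : cancel f h -> cancel h f ->
  weakly_complete (coord_top fL : topAlgType K).
Proof.
move=> fh hf; exists J, (f : coord_top fL -> {ptws J -> K}), (h : {ptws J -> K} -> coord_top fL).
split=> //.
- by apply: ptws_continuous => j; exact: coord_top_continuous.
- apply: to_coord_top_continuous => j.
  have -> : (fun t => f (h t) j) = (fun t : {ptws J -> K} => t j) by apply: funext => t; rewrite hf.
  exact: ptws_proj_continuous.
Qed.

Section MatrixAlgebra.
Variables (K : numFieldType) (d : nat).

Definition mx_coords (M : 'M[K]_d.+1) (p : 'I_d.+1 * 'I_d.+1) : K := M p.1 p.2.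

Lemma mx_coordsL : lin_coords mx_coords.
Proof. by move=> a x y p; rewrite /mx_coords !mxE. Qed.

Definition mx_top : topAlgType K := coord_top mx_coordsL.

Lemma to_mx_top_continuous (T : topologicalType) (h : T -> 'M[K]_d.+1) :
  (forall i j, continuous (fun t => h t i j)) -> continuous (h : T -> mx_top).
Proof. by move=> hc; apply: to_coord_top_continuous => -[i j]; exact: hc. Qed.

Lemma continuous_sum (T : topologicalType) n (F : 'I_n -> T -> K) :
  (forall i, continuous (F i)) -> continuous (fun t => \sum_i F i t).
Proof.
move=> Fc; elim: n F Fc => [|n IH] F Fc.
  by under eq_fun do rewrite big_ord0; exact: cst_continuous.
under eq_fun do rewrite big_ord_recl; move=> t.
apply: (@continuousD K K^o); [exact: Fc | apply: (IH (fun i => F (lift ord0 i)))].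
by move=> i; exact: Fc.
Qed.

Lemma mx_top_wc : wc_algebra mx_top.
Proof.
split.
  apply: (@coord_top_wc _ _ _ _ mx_coordsL (fun g => \matrix_(i, j) g (i, j))).
  - by move=> M; apply/matrixP => i j; rewrite mxE.
  - by move=> g; apply: funext => -[i j]; rewrite /mx_coords mxE.
apply: to_coord_top_continuous => -[i j].
have -> : (fun t : mx_top * mx_top => mx_coords (t.1 * t.2) (i, j)) =
    (fun t : mx_top * mx_top => \sum_k mx_coords t.1 (i, k) * mx_coords t.2 (k, j)).
  by apply: funext => t; rewrite /mx_coords mxE.
apply: continuous_sum => k t; apply: (@continuousM K (mx_top * mx_top)%type) => /=.
  apply: (@continuous_comp (mx_top * mx_top)%type mx_top K fst (fun y => mx_coords y (i, k))).
    exact: cvg_fst.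
  exact: (@coord_top_continuous _ _ _ _ mx_coordsL).
apply: (@continuous_comp (mx_top * mx_top)%type mx_top K snd (fun y => mx_coords y (k, j))).
  exact: cvg_snd.
exact: (@coord_top_continuous _ _ _ _ mx_coordsL).
Qed.

End MatrixAlgebra.

(** * Closed subspaces of a power of K *)

(** The sets containing all functions that agree with z on some finite set form a filter. It
    converges to z in every coordinate, hence in the product. *)
Lemma ptws_nbhs_finite (J : Type) (X : topologicalType) (z : {ptws J -> X}) (O : set {ptws J -> X}) :
  nbhs z O -> exists s : seq {classic J}, forall z', (forall i, i \in s -> z' i = z i) -> O z'.
Proof.
pose F : set_system {ptws J -> X} :=
  fun O => exists s : seq {classic J}, forall z', (forall i, i \in s -> z' i = z i) -> O z'.
have FF : Filter F.
  split=> [|A B [s hs] [t ht]|A B AB [s hs]]; first by exists [::].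
    exists (s ++ t) => z' h; split; [apply: hs|apply: ht] => i hi; apply: h;
      by rewrite mem_cat hi ?orbT.
  by exists s => z' /hs /AB.
suff : F --> (z : {ptws J -> X}) by apply.
apply/cvg_sup => j; apply/cvg_image.
  by rewrite eqEsubset; split => y //; exists (fun=> y).
move=> W Wz; exists [set g : J -> X | W (g j)].
  exists [:: (j : {classic J})] => z' h /=; rewrite h ?mem_head //; exact: nbhs_singleton Wz.
by rewrite eqEsubset; split => [y [g /= Wg <-]//|y Wy]; exists (fun=> y).
Qed.

Section IndependentCoordinates.
Variables (K : fieldType) (J : eqType) (U : Type) (W : set U) (phi : U -> J -> K).

Definition indep_on (S : set J) := forall (s : seq J) (a : J -> K),
  uniq s -> (forall i, i \in s -> S i) ->
  (forall w, W w -> \sum_(i <- s) a i * phi w i = 0) -> forall i, i \in s -> a i = 0.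

(** Zorn's lemma: finite supports make independence pass to unions of chains. Adding a coordinate to
    a maximal S creates a relation, in which the new coordinate has a nonzero coefficient. *)
Lemma indep_maximal : exists S, indep_on S /\
  forall j, ~ S j -> exists (s : seq J) (b : J -> K),
    (forall i, i \in s -> S i) /\ forall w, W w -> phi w j = \sum_(i <- s) b i * phi w i.
Proof.
have [F FP Ftot|S [Sind Smax]] := @Zorn_bigcup J indep_on.
  move=> s a us sF h i si.
  have [X [FX sX]] : exists X, F X /\ forall i, i \in s -> X i.
    have [X0 FX0 _] := sF _ si.
    move: sF; elim: s {us h si} => [|j s IH] sF; first by exists X0.
    have [X [FX sX]] : exists X, F X /\ forall i, i \in s -> X i.
      by apply: IH => k ks; apply: sF; rewrite inE ks orbT.
    have [Y FY Yj] := sF j (mem_head _ _).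
    have [XY|YX] := Ftot _ _ FX FY.
      exists Y; split=> // k; rewrite inE => /orP[/eqP ->//|/sX]; exact: XY.
    by exists X; split=> // k; rewrite inE => /orP[/eqP ->|/sX //]; exact: YX.
  exact: (FP _ FX) us sX h i si.
exists S; split=> // j Sj.
have /Smax : S `<` S `|` [set j].
  split; first by move=> x; left.
  by move=> /(_ j) h; apply: Sj; apply: h; right.
move=> /existsNP[s] /existsNP[a] /not_implyP[us] /not_implyP[sS] /not_implyP[h] /existsNP[k].
move=> /not_implyP[ks ak].
have js : j \in s.
  apply: contrapT => /negP js; apply: ak; apply: (Sind s a us _ h) => // i si.
  by have [//|/= ij] := sS _ si; move: js; rewrite -ij si.
have sS' i : i \in rem j s -> S i.
  rewrite mem_rem_uniq // !inE => /andP[ij /sS[//|/= ji]].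
  by rewrite ji eqxx in ij.
have h' w : W w -> a j * phi w j + \sum_(i <- rem j s) a i * phi w i = 0.
  by move=> Ww; rewrite -[RHS](h w Ww) [RHS](perm_big _ (perm_to_rem js)) big_cons.
have aj : a j != 0.
  apply/eqP => aj; apply: ak.
  have := Sind (rem j s) a (rem_uniq _ us) sS'; case: (eqVneq k j) => [-> //|kj].
  move=> /(_ _ k); apply; last by rewrite mem_rem_uniq // !inE kj.
  by move=> w /h'; rewrite aj mul0r add0r.
exists (rem j s), (fun i => - (a j)^-1 * a i); split=> // w /h' /eqP.
rewrite addr_eq0 => /eqP E; under eq_bigr do rewrite -mulrA.
by rewrite -mulr_sumr mulNr -mulrN -E mulKf.
Qed.

End IndependentCoordinates.

Section LinearCoordinates.
Variables (K : fieldType) (U : lmodType K) (J : Type) (phi : U -> J -> K).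
Hypothesis phiL : lin_coords phi.

Lemma lin_coords0 j : phi 0 j = 0.
Proof. by have := phiL (-1) 0 0 j; rewrite scaler0 addr0 mulN1r addNr. Qed.

Lemma lin_coordsD x y j : phi (x + y) j = phi x j + phi y j.
Proof. by rewrite -[x in LHS]scale1r phiL mul1r. Qed.

Lemma lin_coordsZ a x j : phi (a *: x) j = a * phi x j.
Proof. by rewrite -[_ *: _]addr0 phiL lin_coords0 addr0. Qed.

Lemma lin_coordsB x y j : phi (x - y) j = phi x j - phi y j.
Proof. by rewrite addrC -scaleN1r phiL mulN1r addrC. Qed.

Lemma lin_coords_sum (I : Type) (s : seq I) (F : I -> U) j :
  phi (\sum_(i <- s) F i) j = \sum_(i <- s) phi (F i) j.
Proof.
by elim: s => [|i s IH]; rewrite ?big_nil ?lin_coords0 // !big_cons lin_coordsD IH.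
Qed.

End LinearCoordinates.

Section Subspace.
Variables (K : fieldType) (U : lmodType K).

Definition subspace (W : set U) := W 0 /\ forall a x y, W x -> W y -> W (a *: x + y).

Lemma subspaceD W x y : subspace W -> W x -> W y -> W (x + y).
Proof. by move=> [W0 WL] Wx Wy; rewrite -[x]scale1r; exact: WL. Qed.

Lemma subspaceZ W a x : subspace W -> W x -> W (a *: x).
Proof. by move=> [W0 WL] Wx; rewrite -[_ *: _]addr0; exact: WL. Qed.

Lemma subspaceB W x y : subspace W -> W x -> W y -> W (x - y).
Proof. by move=> [W0 WL] Wx Wy; rewrite addrC -scaleN1r; exact: WL. Qed.

Lemma subspace_sum W (I : Type) (s : seq I) (P : pred I) (F : I -> U) :
  subspace W -> (forall i, P i -> W (F i)) -> W (\sum_(i <- s | P i) F i).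
Proof.
move=> SW WF; apply: (big_ind W) => //; first by case: SW.
by move=> x y; exact: subspaceD.
Qed.

End Subspace.

(** Finitely many independent functionals are jointly onto. If the new one vanished wherever the old
    ones do, it would be a combination of them. This also produces the dual matrices and dual
    coefficients below. *)
Lemma indep_surj (K : fieldType) (J : eqType) (U : lmodType K) (W : set U)
    (phi : U -> J -> K) (S : set J) : subspace W -> lin_coords phi ->
  indep_on W phi S -> forall (s : seq J) (z : J -> K), uniq s -> (forall i, i \in s -> S i) ->
  exists w, W w /\ forall i, i \in s -> phi w i = z i.
Proof.
move=> SW phiL ind; elim=> [|i0 s IH] z; first by exists 0; split=> //; case: SW.
move=> us sS; have /= /andP[i0s us'] := us.
have sS' i : i \in s -> S i by move=> si; apply: sS; rewrite inE si orbT.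
have /boolp.choice[d dP] : forall k, exists w, W w /\ forall i, i \in s -> phi w i = (i == k)%:R.
  by move=> k; exact: (IH (fun i => (i == k)%:R)).
have [w0 [Ww0 w0s w0n]] : exists w, [/\ W w, forall i, i \in s -> phi w i = 0 & phi w i0 != 0].
  apply: contrapT => H.
  pose a i := if i == i0 then 1 else - phi (d i) i0.
  suff /(_ i0 (mem_head _ _)) /eqP : forall i, i \in i0 :: s -> a i = 0 by rewrite /a eqxx oner_eq0.
  apply: ind => // w Ww; rewrite big_cons {1}/a eqxx mul1r.
  pose w' := w - \sum_(k <- s) phi w k *: d k.
  have Ww' : W w'.
    apply: subspaceB => //; apply: subspace_sum => // k _.
    by apply: subspaceZ => //; case: (dP k).
  have w'E i : phi w' i = phi w i - \sum_(k <- s) phi w k * phi (d k) i.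
    rewrite lin_coordsB // lin_coords_sum //; congr (_ - _).
    by apply: eq_bigr => k _; rewrite lin_coordsZ.
  have w's i : i \in s -> phi w' i = 0.
    move=> si; rewrite w'E (bigD1_seq i) //= big1 ?addr0 => [|k ki].
      by have [_ ->] := dP i; rewrite // eqxx mulr1 subrr.
    by have [_ ->] := dP k; rewrite // eq_sym (negPf ki) mulr0.
  have : phi w' i0 = 0 by apply/eqP; apply: contrapT => /negP h; apply: H; exists w'.
  rewrite w'E => /eqP; rewrite subr_eq0 => /eqP ->; rewrite -big_split big1_seq //= => i si.
  rewrite /a; case: eqP => [ii|_]; first by rewrite -ii si in i0s.
  by rewrite mulNr mulrC subrr.
have [w1 [Ww1 w1s]] := IH z us' sS'.
exists (((z i0 - phi w1 i0) / phi w0 i0) *: w0 + w1); split; first by case: SW => _; apply.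
move=> i; rewrite inE phiL => /orP[/eqP ->|si]; first by rewrite divfK // subrK.
by rewrite (w0s i si) mulr0 add0r w1s.
Qed.

(* A maximal family S of coordinates independent on W embeds W into K^S. Any finitely
   many of them take arbitrary values on W, so W is dense in K^S; being closed, it is
   all of K^S. *)
Lemma closed_subspace_coords (K : numFieldType) (U : topologicalLmodType K) (W : set U) :
  weakly_complete U -> subspace W -> closed W ->
  exists (S : Type) (f : U -> S -> K),
  [/\ lin_coords f, forall i, continuous (fun x => f x i),
      forall x, W x -> (forall i, f x i = 0) -> x = 0,
      forall z : S -> K, exists2 w, W w & f w = z &
      forall (T : topologicalType) (h : T -> U), (forall t, W (h t)) ->
        (forall i, continuous (fun t => f (h t) i)) -> continuous h].
Proof.
move=> [J [phi [psi [phiL phiK psiK phiC psiC]]]] SW cW.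
have phiL' : lin_coords (phi : U -> {classic J} -> K) by [].
have [S [Sind Smax]] := @indep_maximal K {classic J} U W phi.
have /boolp.choice[sb sbP] : forall j : {classic J}, exists sb : seq {classic J} * ({classic J} -> K),
    (forall i, i \in sb.1 -> S i) /\ forall w, W w -> phi w j = \sum_(i <- sb.1) sb.2 i * phi w i.
  move=> j; have [Sj|Sj] := pselect (S j).
    by exists ([:: j], fun=> 1); split=> [i|w _] /=; [rewrite inE => /eqP ->|rewrite big_seq1 mul1r].
  by have [s [b h]] := Smax j Sj; exists (s, b).
pose f (x : U) (i : {i : {classic J} | S i}) := phi x (sval i).
have phiCj j : continuous (fun x => phi x j).
  by move=> x; apply: (@continuous_comp U {ptws J -> K} K phi (fun g => g j));
    [exact: phiC|exact: ptws_proj_continuous].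
have fS x y : (forall i, S i -> phi x i = phi y i) -> W x -> W y -> forall j, phi x j = phi y j.
  move=> xy Wx Wy j; have [sS E] := sbP j; rewrite !E // big_seq [RHS]big_seq.
  by apply: eq_bigr => i /sS /xy ->.
exists {i : {classic J} | S i}, f; split=> //.
- by move=> a x y i; exact: phiL.
- by move=> i; exact: phiCj.
- move=> x Wx fx; apply: (can_inj phiK); apply: funext => j.
  apply: fS => //; last by case: SW.
  by move=> i Si; rewrite (lin_coords0 phiL'); exact: (fx (exist _ i Si)).
- move=> z.
  pose z0 (i : {classic J}) : K := if pselect (S i) is left Si then z (exist _ i Si) else 0.
  pose zt (j : {classic J}) : K := if pselect (S j) is left _ then z0 j
     else \sum_(i <- (sb j).1) (sb j).2 i * z0 i.
  have Wz : W (psi zt).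
    apply: cW => B /= nB.
    have [s hs] : exists s : seq {classic J}, forall z', (forall i, i \in s -> z' i = zt i) -> B (psi z').
      by apply: (@ptws_nbhs_finite J K zt (psi @^-1` B)); exact: psiC.
    (* The finitely many members of S that determine the coordinates in s on W. *)
    pose t := undup ([seq i <- s | `[<S i>]] ++ flatten [seq (sb j).1 | j <- s]).
    have tS i : i \in t -> S i.
      rewrite mem_undup mem_cat mem_filter => /orP[/andP[/asboolP //]|/flattenP [l /mapP[j _ ->]]].
      by case: (sbP j) => + _; apply.
    have [w [Ww wt]] := indep_surj SW phiL' Sind z0 (undup_uniq _) tS.
    exists w; split=> //; rewrite -(phiK w); apply: hs => j js; rewrite /zt.
    case: pselect => [Sj|nSj].
      by apply: wt; rewrite mem_undup mem_cat mem_filter js (asboolT Sj).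
    case: (sbP j) => _ ->//; apply: eq_big_seq => i ij; rewrite wt // mem_undup mem_cat.
    by apply/orP; right; apply/flattenP; exists (sb j).1 => //; exact: map_f.
  exists (psi zt) => //; apply: funext => -[i Si]; rewrite /f psiK /zt /=.
  case: pselect => // Si'; rewrite /z0; case: pselect => // Si''.
  by congr (z (exist _ _ _)); exact: Prop_irrelevance.
- move=> T h Wh hc.
  have -> : h = psi \o (phi \o h) by apply: funext => t /=; rewrite phiK.
  have c1 : continuous (phi \o h : T -> {ptws J -> K}).
    apply: ptws_continuous => j /=; have [sS E] := sbP j.
    have -> : (fun t => phi (h t) j) = (fun t => \sum_(i <- (sb j).1) (sb j).2 i * phi (h t) i).
      by apply: funext => t; rewrite E.
    elim: (sb j).1 sS => [|i l IH] lS.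
      by under eq_fun do rewrite big_nil; exact: cst_continuous.
    have -> : (fun t => \sum_(i0 <- i :: l) (sb j).2 i0 * phi (h t) i0) =
        (fun t => (sb j).2 i * phi (h t) i + \sum_(i0 <- l) (sb j).2 i0 * phi (h t) i0).
      by apply: funext => t; rewrite big_cons.
    have c2 : continuous (fun t => \sum_(i0 <- l) (sb j).2 i0 * phi (h t) i0).
      by apply: (IH _); move=> k kl; apply: lS; rewrite inE kl orbT.
    have c1 : continuous (fun t => (sb j).2 i * phi (h t) i).
      move=> t; apply: (@continuousM K T (fun=> (sb j).2 i) (fun t => phi (h t) i)).
        exact: cst_continuous.
      exact: (hc (exist _ i (lS _ (mem_head _ _)))).
    by move=> t; exact: (@continuousD K K^o T _ _ t (c1 t) (c2 t)).
  by move=> t; apply: continuous_comp; [exact: c1|exact: psiC].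
Qed.

(** * Subalgebras, generation and density *)

Section Subalgebra.
Variables (K : numFieldType) (A : algType K) (B : set A) (hB : unital_subalg B).

(* The unused proof argument makes [hB] recoverable from the predicate, as the
   canonical structures below need it. *)
Definition subalg_pred of unital_subalg B : {pred A} := fun x => `[<B x>].
Local Notation S := (subalg_pred hB).

Let subalg_closedS : subalg_closed S.
Proof.
case: hB => B1 BL BM; split=> [|a x y|x y]; rewrite !unfold_in ?asboolE //.
- exact: BL.
- exact: BM.
Qed.

HB.instance Definition _ := GRing.isSubalgClosed.Build K A S subalg_closedS.

Record subalg := SubAlg {subalg_val : A; _ : subalg_val \in S}.
HB.instance Definition _ := [isSub for subalg_val].
HB.instance Definition _ := [Choice of subalg by <:].
HB.instance Definition _ := [SubChoice_isSubAlgebra of subalg by <:].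

Lemma subalg_valP x : B (subalg_val x).
Proof. by case: x => x /= /asboolP. Qed.

Lemma subalg_val_inj : injective subalg_val. Proof. exact: val_inj. Qed.

Lemma subalg_val_morph : unital_alg_morph (subalg_val : subalg -> A).
Proof. by split. Qed.

Definition to_subalg x (Bx : B x) : subalg := @SubAlg x (introT (asboolP _) Bx).

End Subalgebra.

Lemma unital_alg_morph_comp (K : numFieldType) (A B C : algType K) (f : A -> B) (h : B -> C) :
  unital_alg_morph f -> unital_alg_morph h -> unital_alg_morph (h \o f).
Proof.
by move=> [fL f1 fM] [hL h1 hM]; split=> [a x y||x y] /=; rewrite ?fL ?hL ?f1 ?h1 ?fM ?hM.
Qed.

Lemma unital_alg_morph_id (K : numFieldType) (A : algType K) : unital_alg_morph (@id A).
Proof. by split. Qed.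

Lemma lie_morph_to_subalg (K : numFieldType) (L : lmodType K) (br : L -> L -> L) (A : algType K)
    (B : set A) (hB : unital_subalg B) (f : L -> A) (fB : forall x, B (f x)) :
  lie_morph br f -> lie_morph br (fun x => to_subalg hB (fB x)).
Proof.
by move=> [fL fM]; split=> [a x y|x y]; apply: (@subalg_val_inj _ _ _ hB); [exact: fL|exact: fM].
Qed.

(** Corestrict [iota] to B, extend to UL and compose with the inclusion of B: this endomorphism of
    UL fixes [iota], so by uniqueness it is the identity. *)
Lemma UEA_generated (K : numFieldType) (L : lmodType K) (br : L -> L -> L)
    (UL : algType K) (iota : L -> UL) (B : set UL) : classical_UEA br iota ->
  unital_subalg B -> (forall x, B (iota x)) -> forall u, B u.
Proof.
move=> [li univ] hB Bi u.
have [f [[fm fi] _]] := univ _ _ (lie_morph_to_subalg hB Bi li).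
have [h [_ huniq]] := univ _ _ li.
have e1 := huniq id (conj (unital_alg_morph_id UL) erefl).
have e2 : h = @subalg_val _ _ _ hB \o f.
  apply: huniq; split; first exact: (unital_alg_morph_comp fm (subalg_val_morph hB)).
  by apply: funext => x; have := congr1 (fun k => subalg_val (k x)) fi.
have -> : u = subalg_val (f u) by rewrite -[LHS]/(id u) -e1 e2.
exact: subalg_valP.
Qed.

Lemma gen_subalg_unital (K : numFieldType) (A : algType K) (S : set A) :
  unital_subalg (gen_subalg S).
Proof.
split=> [B [[]] //|a x y Sx Sy B|x y Sx Sy B] [HB SB]; case: (HB) => B1 BL BM.
  by apply: BL; [apply: Sx|apply: Sy].
by apply: BM; [apply: Sx|apply: Sy].
Qed.

Lemma sub_gen_subalg (K : numFieldType) (A : algType K) (S : set A) : S `<=` gen_subalg S.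
Proof. by move=> x Sx B [_]; apply. Qed.

Lemma range_gen_subalg (K : numFieldType) (L : lmodType K) (br : L -> L -> L)
    (UL A : algType K) (iota : L -> UL) (eps : UL -> A) : classical_UEA br iota ->
  unital_alg_morph eps -> range eps = gen_subalg (range (eps \o iota)).
Proof.
move=> HUL [eL e1 eM]; apply/seteqP; split=> x.
  move=> [u _ <-]; move: u; apply: (UEA_generated HUL).
    have [G1 GL GM] := gen_subalg_unital (range (eps \o iota)).
    split=> [|a u v Gu Gv|u v Gu Gv]; first by rewrite /= e1.
      by rewrite eL; exact: GL.
    by rewrite eM; exact: GM.
  by move=> y; apply: sub_gen_subalg; exists y.
apply; split; last by move=> _ [y _ <-]; exists (iota y).
split=> [|a _ _ [u _ <-] [v _ <-]|_ _ [u _ <-] [v _ <-]]; first by exists 1.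
  by exists (a *: u + v).
by exists (u * v).
Qed.

Section ClosedSubalgebra.
Variables (K : numFieldType) (U : topAlgType K).

Lemma closure_stable (h : U * U -> U) (B : set U) : continuous h ->
  (forall x y, B x -> B y -> B (h (x, y))) ->
  forall x y, closure B x -> closure B y -> closure B (h (x, y)).
Proof.
move=> hc hB x y cx cy N nN.
have [[P Q] /= [nP nQ] PQ] := hc (x, y) N nN.
have [x' [Bx Px]] := cx P nP; have [y' [By Qy]] := cy Q nQ.
exists (h (x', y')); split; first exact: hB.
by apply: (PQ (x', y')).
Qed.

Lemma lincomb_continuous (a : K) : continuous (fun p : U * U => a *: p.1 + p.2).
Proof.
move=> p; have c1 : {for p, continuous (fun p : U * U => (a *: p.1, p.2))}.
  apply: (@cvg_pair _ _ _ _ (nbhs (a *: p.1)) (nbhs p.2)); last exact: cvg_snd.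
  apply: (@continuous_comp (U * U)%type (K^o * U)%type U (fun q => (a, q.1)) (fun q => q.1 *: q.2)).
    apply: (@cvg_pair _ _ _ _ (nbhs (a : K^o)) (nbhs p.1)); [exact: cvg_cst|exact: cvg_fst].
  exact: scale_continuous.
by apply: (@continuous_comp _ _ _ (fun p : U * U => (a *: p.1, p.2)) (fun q => q.1 + q.2) _ c1); exact: add_continuous.
Qed.

Hypothesis wcU : wc_algebra U.

Lemma closure_unital_subalg (B : set U) : unital_subalg B -> unital_subalg (closure B).
Proof.
move=> [B1 BL BM]; split; first exact: subset_closure.
  move=> a x y; apply: (closure_stable (lincomb_continuous (a := a))) => u v; exact: BL.
by move=> x y; case: wcU => _ mc; apply: (closure_stable mc) => u v; exact: BM.
Qed.

(** The corestriction [r] takes the membership proof as an argument, so a continuous map into U with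
    values in B can be lifted to A. *)
Lemma closed_subalg_wc (B : set U) (hB : unital_subalg B) : closed B ->
  exists A : topAlgType K, exists (v : A -> U) (r : forall x, B x -> A),
  [/\ wc_algebra A, unital_alg_morph v, continuous v,
     injective v /\ (forall a, B (v a)) &
     (forall x Bx, v (r x Bx) = x) /\ forall (T : topologicalType) (h : T -> U) (Bh : forall t, B (h t)), continuous h ->
       continuous (fun t => r _ (Bh t))].
Proof.
move=> cB; case: (wcU) => wU mc.
have SB : subspace B.
  case: hB => B1 BL _; split=> //; have := BL (-1) 1 1 B1 B1.
  by rewrite scaleN1r addNr.
have [S [f [fL fc f0 fsurj fcont]]] := closed_subspace_coords wU SB cB.
pose f' (x : subalg hB) := f (subalg_val x).
have f'L : lin_coords f' by move=> a x y j; exact: fL.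
pose A : topAlgType K := coord_top f'L.
have vc : continuous (fun x : A => subalg_val (x : subalg hB)).
  apply: fcont; first by move=> t; exact: subalg_valP.
  by move=> i; exact: (@coord_top_continuous _ _ _ _ f'L).
have Ac (T : topologicalType) (h : T -> A) : continuous (fun t => subalg_val (h t : subalg hB)) -> continuous h.
  move=> hc; apply: to_coord_top_continuous => j t.
  by apply: (@continuous_comp T U K (fun t => subalg_val (h t : subalg hB)) (fun x => f x j));
    [exact: hc|exact: fc].
exists A, (fun x : A => subalg_val (x : subalg hB)), (fun x Bx => to_subalg hB Bx : A); split=> //.
- split; last first.
    apply: Ac => p.
    apply: (@continuous_comp (A * A)%type (U * U)%type U
      (fun p => (subalg_val (p.1 : subalg hB), subalg_val (p.2 : subalg hB))) (fun q => q.1 * q.2)).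
      apply: (@cvg_pair _ _ _ _ (nbhs _) (nbhs _)).
        apply: (@continuous_comp (A * A)%type A U fst _); [exact: cvg_fst|exact: vc].
      apply: (@continuous_comp (A * A)%type A U snd _); [exact: cvg_snd|exact: vc].
    exact: mc.
  have /boolp.choice[h hP] : forall z : S -> K, exists x : subalg hB, f' x = z.
    by move=> z; have [w Bw <-] := fsurj z; exists (to_subalg hB Bw).
  apply: (@coord_top_wc _ _ _ _ f'L h) => [x|z]; last exact: hP.
  apply: subalg_val_inj; apply/eqP; rewrite -subr_eq0; apply/eqP; apply: f0.
    by apply: subspaceB => //; exact: subalg_valP.
  by move=> i; rewrite (lin_coordsB fL) -[f (subalg_val (h _)) i]/(f' (h (f' x)) i) hP subrr.
- by split; [exact: subalg_val_inj|exact: subalg_valP].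
- by split=> // T h Bh hc; apply: Ac.
Qed.

End ClosedSubalgebra.

Lemma wc_UEA_dense (K : numFieldType) (L : topologicalLmodType K) (br : L -> L -> L)
    (U : topAlgType K) (lam : L -> U) : wc_UEA br lam ->
  closure (gen_subalg (range lam)) = [set: U].
Proof.
move=> [wU ll lc univ]; apply/seteqP; split=> // u _.
set B := closure _.
have hB : unital_subalg B by apply: closure_unital_subalg => //; exact: gen_subalg_unital.
have [A [v [r [wA vm vc [vi vB] [vr rc]]]]] := closed_subalg_wc wU hB (@closed_closure _ _).
have Bl x : B (lam x) by apply: subset_closure; apply: sub_gen_subalg; exists x.
have lr : lie_morph br (fun x => r _ (Bl x)).
  case: ll => lL lM; case: vm => vL v1 vM.
  split=> [a x y|x y]; apply: vi; first by rewrite vL !vr lL.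
  by rewrite /commutator -[- (_ * _)]scaleN1r addrC vL !vM !vr lM /commutator scaleN1r addrC.
have [f [[fm fc fi] _]] := univ _ wA _ lr (rc _ _ Bl lc).
have [h [_ huniq]] := univ _ wU _ ll lc.
have e1 : h = id.
  by apply: huniq; split; [exact: unital_alg_morph_id|move=> x; exact: cvg_id|].
have e2 : h = v \o f.
  apply: huniq; split; first exact: unital_alg_morph_comp fm vm.
    by move=> x; apply: continuous_comp; [exact: fc|exact: vc].
  by apply: funext => x; have := congr1 (fun k => v (k x)) fi; rewrite /= vr.
have -> : u = v (f u) by rewrite -[LHS]/(id u) -e1 e2.
exact: vB.
Qed.

(** * Closed subspaces of finite codimension *)

(** The order of K may be partial, but moduli are real and hence comparable. *)
Lemma finite_max (K : numFieldType) (n : nat) (a : 'I_n -> K) (j : 'I_n) :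
  exists k, forall i, `|a i| <= `|a k|.
Proof.
elim: n a j => [|n IH] a j; first by case: j.
have [[m]|none] := pselect (inhabited 'I_n); last first.
  exists 0 => i; case: (unliftP 0 i) => [k _|->] //.
  by case: none; constructor.
have [k kP] := IH (fun i => a (lift 0 i)) m.
have [h|h] := @real_leP K `|a 0| `|a (lift 0 k)| (normr_real _) (normr_real _).
  by exists (lift 0 k) => i; case: (unliftP 0 i) => [i' ->|->].
exists 0 => i; case: (unliftP 0 i) => [i' ->|->] //.
exact: le_trans (kP _) (ltW h).
Qed.

Lemma continuous_op2 (T A B C : topologicalType) (op : A * B -> C) (f : T -> A) (h : T -> B) :
  continuous op -> continuous f -> continuous h -> continuous (fun t => op (f t, h t)).
Proof.
move=> oc fc hc t; apply: (@continuous_comp T (A * B)%type C (fun t => (f t, h t)) op); last exact: oc.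
by apply: (@cvg_pair _ _ _ _ (nbhs (f t)) (nbhs (h t))); [exact: fc|exact: hc].
Qed.

Section CofiniteCoordinates.
Variables (K : numFieldType) (g : topologicalLmodType K) (n : nat) (I : set g).
Variables (v : 'I_n -> g) (q : g -> 'I_n -> K).
Hypotheses (disc_compact : compact [set a : K | `|a| <= 1]) (cI : closed I) (SI : subspace I).
Hypotheses (qL : lin_coords q) (qI : forall x, I x -> forall i, q x i = 0).
Hypotheses (qv : forall i j, q (v i) j = (i == j)%:R).
Hypothesis (q_dec : forall x, I (x - \sum_i q x i *: v i)).

Lemma lin_comb_continuous (T : topologicalType) m (c : 'I_m -> T -> K) (x : 'I_m -> T -> g) :
  (forall i, continuous (c i)) -> (forall i, continuous (x i)) ->
  continuous (fun t => \sum_i c i t *: x i t).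
Proof.
elim: m c x => [|m IH] c x cc xc.
  have -> : (fun t => \sum_(i < 0) c i t *: x i t) = cst 0 by apply: funext => t; rewrite big_ord0.
  exact: cst_continuous.
have -> : (fun t => \sum_i c i t *: x i t) =
  (fun t => c 0 t *: x 0 t + \sum_(i < m) c (lift 0 i) t *: x (lift 0 i) t).
  by apply: funext => t; rewrite big_ord_recl.
have c1 : continuous (fun t => c 0 t *: x 0 t).
  exact: (@continuous_op2 T K^o g g (fun p => p.1 *: p.2) (c 0) (x 0) (@scale_continuous _ _) (cc 0) (xc 0)).
have c2 := IH (fun i => c (lift 0 i)) (fun i => x (lift 0 i)) (fun i => cc _) (fun i => xc _).
exact: (@continuous_op2 T g g g (fun p => p.1 + p.2) _ _ (@add_continuous _) c1 c2).
Qed.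

Let cube (k : 'I_n) : set {ptws 'I_n -> K} :=
  [set c | forall i, (if i == k then [set 1] else [set a | `|a| <= 1]) (c i)].

Let cube_compact k : compact (cube k).
Proof.
apply: (@tychonoff _ (fun=> K) (fun i => if i == k then [set 1] else [set a | `|a| <= 1])) => i; case: eqP => _ //; exact: compact_set1.
Qed.

(** A point c of the cube has k-th coordinate 1, so its combination of the v_i is outside I. As I is
    closed this persists near (c, 0), and compactness of the cube makes the neighborhood of 0
    uniform. *)
Let cube_avoids k : \forall w \near (0 : g), forall c, cube k c -> ~ I (\sum_i c i *: v i - w).
Proof.
have /compact_near_coveringP := cube_compact (k := k).
apply => c kc.
pose h (p : {ptws 'I_n -> K} * g) : g := \sum_i p.1 i *: v i - p.2.
suff hc : continuous h.
  have : ~ I (h (c, 0)).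
    move=> /qI/(_ k); rewrite /h /= subr0 lin_coords_sum // (bigD1 k) //= big1 => [|i ik].
      rewrite lin_coordsZ // qv eqxx mulr1 addr0; have := kc k; rewrite eqxx /= => ->.
      by move/eqP; rewrite oner_eq0.
    by rewrite lin_coordsZ // qv (negPf ik) mulr0.
  have oI : open (~` I) by apply: closed_openC.
  by move=> nI; apply: (hc (c, 0) (~` I)); apply: open_nbhs_nbhs.
have -> : h = (fun p => (\sum_i p.1 i *: v i) + \sum_(i < 1) (-1) *: p.2).
  by apply: funext => p; rewrite /h big_ord1 scaleN1r.
pose Z : topologicalType := ({ptws 'I_n -> K} * g)%type.
have c1 : continuous (fun p : Z => \sum_i p.1 i *: v i).
  apply: (@lin_comb_continuous Z n (fun i p => p.1 i) (fun i p => v i)) => i; last exact: cst_continuous.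
  by move=> z; apply: (@continuous_comp Z {ptws 'I_n -> K} K fst (fun f => f i));
    [exact: cvg_fst|exact: ptws_proj_continuous].
have c2 : continuous (fun p : Z => \sum_(i < 1) (-1) *: p.2).
  apply: (@lin_comb_continuous Z 1 (fun i _ => -1) (fun i p => p.2)) => i; first exact: cst_continuous.
  by move=> z; exact: cvg_snd.
exact: (@continuous_op2 Z g g g (fun p => p.1 + p.2) _ _ (@add_continuous _) c1 c2).
Qed.

(* Scaling so that a coordinate of largest modulus is 1 puts the coordinates in one
   of the compact sets [cube k], on which the distance to I is bounded below. *)
Lemma cofinite_coords_bounded : \forall w \near (0 : g), forall i, `|q w i| < 1.
Proof.
pose W w := forall k c, cube k c -> ~ I (\sum_i c i *: v i - w).
have nW : \forall w \near (0 : g), W w.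
  by apply: filter_forall => k; exact: cube_avoids.
have : \forall w \near (0 : g), forall a : K, `|a| <= 1 -> W (a *: w).
  move/compact_near_coveringP: disc_compact; apply => a _.
  have sc := @scale_continuous K g (a, 0).
  by apply: sc; rewrite /= scaler0.
apply: filterS => w hw j; apply: contrapT => /negP nlt.
have [k kP] := finite_max (q w) j.
have k1 : 1 <= `|q w k|.
  apply: le_trans (kP j).
  by rewrite real_leNgt ?normr_real ?real1 //; apply/negP.
have k0 : q w k != 0 by rewrite -normr_gt0; exact: lt_le_trans k1.
have a1 : `|(q w k)^-1| <= 1 by rewrite normfV invf_le1 // normr_gt0.
apply: (hw _ a1 k (fun i => (q w k)^-1 * q w i)).
  move=> i; case: eqP => [->|_] /=; first by rewrite mulVf.
  by rewrite normrM normfV mulrC ler_pdivrMr ?normr_gt0 // mul1r.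
under eq_bigr do rewrite -scalerA.
rewrite -scaler_sumr -scalerBr -[_ - w]opprB scalerN -scaleNr.
by apply: subspaceZ.
Qed.

(** By linearity a bound by 1 near 0 rescales to a bound by e. *)
Lemma cofinite_coords_continuous j : continuous (fun x => q x j).
Proof.
move=> x; apply/cvgrPdist_lt => e e0.
have hb := cofinite_coords_bounded.
have : \forall y \near x, forall i, `|q (e^-1 *: (x - y)) i| < 1.
  suff hc : continuous (fun y : g => e^-1 *: (x - y)).
    have hx : nbhs (e^-1 *: (x - x)) [set w : g | forall i, `|q w i| < 1].
      by rewrite subrr scaler0; exact: hb.
    exact: (hc x _ hx).
  have -> : (fun y : g => e^-1 *: (x - y)) = (fun y : g => \sum_(i < 2) (if i == 0 then e^-1 else - e^-1) *: (if i == 0 then x else y)).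
    by apply: funext => y; rewrite !big_ord_recl big_ord0 addr0 /= scaleNr scalerBr.
  apply: (@lin_comb_continuous _ 2 (fun i _ => if i == 0 then e^-1 else - e^-1) (fun i y => if i == 0 then x else y)) => i.
    exact: cst_continuous.
  by case: (i == 0); [exact: cst_continuous|move=> y; exact: cvg_id].
apply: filterS => y /(_ j); rewrite lin_coordsZ // lin_coordsB // normrM normfV (gtr0_norm e0).
by rewrite mulrC ltr_pdivrMr // mul1r.
Qed.

End CofiniteCoordinates.

Lemma Kof_disc_compact (R : realType) (isC : bool) :
  compact [set a : Kof R isC | `|a| <= 1].
Proof.
case: isC => /=; last first.
  have -> : [set a : R | `|a| <= 1] = `[-1, 1]%classic.
    by apply/seteqP; split=> a /=; rewrite in_itv /= ler_norml.
  exact: segment_compact.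
pose C : numFieldType := R[i]%C.
pose f (p : R * R) : C := (p.1%:C + p.2%:C * 'i)%C.
have iC : continuous (fun x : R => x%:C%C : C).
  move=> x; apply/cvgrPdist_lt => -[e e'] /[dup] ee; rewrite ltcE /= => /andP[/eqP e'0 e0].
  rewrite e'0 in ee *.
  have : \forall y \near x, `|x - y| < e.
    by have /cvgrPdist_lt := @cvg_id _ (nbhs x); apply.
  apply: filterS => y; rewrite -rmorphB normc_def /= expr0n addr0 sqrtr_sqr => h.
  by rewrite ltcR.
have fc : continuous f.
  move=> p; apply: (@continuousD C C^o (R * R)%type (fun p => p.1%:C%C) (fun p => (p.2%:C * 'i)%C)).
    by apply: (@continuous_comp (R * R)%type R C fst); [exact: cvg_fst|exact: iC].
  apply: (@continuousM C (R * R)%type (fun p => p.2%:C%C) (fun=> 'i%C)); last exact: cst_continuous.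
  by apply: (@continuous_comp (R * R)%type R C snd); [exact: cvg_snd|exact: iC].
apply: (@subclosed_compact C _ (f @` (`[-1, 1] `*` `[-1, 1]))).
- move=> a ca /=; rewrite real_leNgt ?normr_real ?real1 //; apply/negP => a1.
  have /ca [b [/= b1 ab]] : nbhs a [set b : C | `|a - b| < `|a| - 1].
    have /cvgrPdist_lt := @cvg_id _ (nbhs a); apply; by rewrite subr_gt0.
  have : `|a| < `|a|; last by rewrite ltxx.
  rewrite -{1}[a](subrK b); apply: le_lt_trans (ler_normD _ _) _.
  by rewrite -ltrBrDr; apply: lt_le_trans ab _; rewrite lerB.
- apply: continuous_compact; first exact: continuous_subspaceT.
  by apply: compact_setX; exact: segment_compact.
- move=> [a b] /= ab; exists (a, b) => /=; last first.
    by rewrite /f; apply/eqP; rewrite eq_complex /=; apply/andP; split; apply/eqP; ring.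
  have : a ^+ 2 + b ^+ 2 <= 1.
    have := add_Re2_Im2 (a +i* b)%C => /= h.
    by rewrite -lecR h expr_le1.
  by move=> ab2; split; rewrite /= in_itv /=; apply/andP; split; nra.
Qed.

(** A spanning family modulo I of least size is independent modulo I, since a relation would allow
    one vector to be dropped. Coordinates are then unique, hence linear. *)
Lemma codim_basis (K : numFieldType) (L : lmodType K) (I : set L) :
  subspace I -> finite_codim I -> exists n (v : 'I_n -> L) (q : L -> 'I_n -> K),
  [/\ lin_coords q, forall x, I x -> forall i, q x i = 0,
      forall i j, q (v i) j = (i == j)%:R & forall x, I (x - \sum_i q x i *: v i)].
Proof.
move=> SI [n0 [v0 h0]].
pose spans n := `[< exists v : 'I_n -> L, forall x, exists c : 'I_n -> K, I (x - \sum_(i < n) c i *: v i) >].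
have ex : exists n, spans n by exists n0; apply/asboolP; exists v0.
case: (ex_minnP ex) => n /asboolP[v hv] nmin {ex n0 v0 h0}.
have free (c : 'I_n -> K) : I (\sum_i c i *: v i) -> forall i, c i = 0.
  move=> Ic k; apply: contrapT => /eqP ck.
  case: n v hv nmin c Ic k ck => [|n] v hv nmin c Ic k ck; first by case: k ck.
  suff /nmin : spans n by rewrite ltnn.
  apply/asboolP; exists (fun i => v (lift k i)) => x; have [b hb] := hv x.
  exists (fun i => b (lift k i) - b k / c k * c (lift k i)).
  have -> : x - \sum_(i < n) (b (lift k i) - b k / c k * c (lift k i)) *: v (lift k i) =
      (x - \sum_i b i *: v i) + (b k / c k) *: \sum_i c i *: v i.
    rewrite !(bigD1_ord k) //= scalerDr scalerA divfK // scaler_sumr.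
    under eq_bigr do rewrite scalerBl -scalerA.
    by rewrite sumrB; zmod.
  by apply: subspaceD => //; exact: subspaceZ.
have /boolp.choice[q hq] := hv.
have uniq x c : I (x - \sum_i c i *: v i) -> q x = c.
  move=> hc; apply: funext => i; apply/eqP; rewrite -subr_eq0; apply/eqP; move: i.
  apply: free; under eq_bigr do rewrite scalerBl.
  rewrite sumrB; have := subspaceB SI hc (hq x).
  by rewrite opprB addrC addrA subrK.
exists n, v, q; split=> //.
- move=> a x y j; rewrite (@uniq _ (fun j => a * q x j + q y j)) //.
  have -> : a *: x + y - \sum_i (a * q x i + q y i) *: v i =
      a *: (x - \sum_i q x i *: v i) + (y - \sum_i q y i *: v i).
    under eq_bigr do rewrite scalerDl -scalerA.
    by rewrite big_split /= -scaler_sumr scalerBr opprD addrACA.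
  by case: SI => _; apply.
- move=> x Ix i; rewrite (@uniq _ (fun=> 0)) //.
  by rewrite big1 ?subr0 // => j _; rewrite scale0r.
- move=> i j; rewrite (@uniq _ (fun j => (i == j)%:R)) //.
  rewrite (bigD1 i) //= eqxx scale1r big1 ?addr0 ?subrr; first by case: SI.
  by move=> k ki; rewrite eq_sym (negPf ki) scale0r.
Qed.

(** * Matrix coefficients of the enveloping algebra *)

Section MatrixPairing.
Variable K : numFieldType.

(** A functional on matrices is coded by a matrix T, so that sums and products of coefficients
    become block sums and tensor products. *)
Definition mxdot n (A T : 'M[K]_n) : K := \sum_i \sum_j A i j * T i j.

Lemma mxdotL n (a : K) (A B T : 'M[K]_n) : mxdot (a *: A + B) T = a * mxdot A T + mxdot B T.
Proof.
rewrite /mxdot mulr_sumr -big_split; apply: eq_bigr => i _ /=.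
by rewrite mulr_sumr -big_split; apply: eq_bigr => j _ /=; rewrite !mxE mulrDl mulrA.
Qed.

Lemma mxdot0 n (T : 'M[K]_n) : mxdot 0 T = 0.
Proof. by rewrite /mxdot big1 // => i _; rewrite big1 // => j _; rewrite mxE mul0r. Qed.

Lemma mxdot_sum n (I : Type) (s : seq I) (F : I -> 'M[K]_n) T :
  mxdot (\sum_(i <- s) F i) T = \sum_(i <- s) mxdot (F i) T.
Proof.
elim: s => [|i s IH]; first by rewrite !big_nil mxdot0.
by rewrite !big_cons -IH -[F i]scale1r mxdotL mul1r scale1r.
Qed.

Lemma mxdotZr n (a : K) (A T : 'M[K]_n) : mxdot A (a *: T) = a * mxdot A T.
Proof.
rewrite /mxdot mulr_sumr; apply: eq_bigr => i _ /=.
by rewrite mulr_sumr; apply: eq_bigr => j _ /=; rewrite !mxE mulrCA.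
Qed.

Lemma mxdot_block m n (A A' : 'M[K]_m) (B B' : 'M[K]_n) :
  mxdot (block_mx A 0 0 B) (block_mx A' 0 0 B') = mxdot A A' + mxdot B B'.
Proof.
rewrite /mxdot big_split_ord; congr (_ + _); apply: eq_bigr => i _; rewrite big_split_ord /=.
  under eq_bigr do rewrite !block_mxEul.
  by rewrite [X in _ + X]big1 ?addr0 // => j _; rewrite !block_mxEur mxE mul0r.
under [X in _ + X]eq_bigr do rewrite !block_mxEdr.
by rewrite [X in X + _]big1 ?add0r // => j _; rewrite !block_mxEdl mxE mul0r.
Qed.

Lemma big_mxtens m n (G : 'I_m -> 'I_n -> K) :
  \sum_(k < m * n) G (mxtens_unindex k).1 (mxtens_unindex k).2 = \sum_i \sum_j G i j.
Proof.
rewrite pair_bigA (reindex (@mxtens_index m n)); last first.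
  by exists (@mxtens_unindex m n) => k _; rewrite (mxtens_indexK, mxtens_unindexK).
by apply: eq_bigr => p _; rewrite mxtens_indexK.
Qed.

Lemma mxdot_tens m n (A A' : 'M[K]_m) (B B' : 'M[K]_n) :
  mxdot (tensmx A B) (tensmx A' B') = mxdot A A' * mxdot B B'.
Proof.
transitivity (\sum_i \sum_i' \sum_j \sum_j' (A i j * B i' j') * (A' i j * B' i' j')).
  rewrite -(@big_mxtens m n (fun i i' => \sum_j \sum_j' (A i j * B i' j') * (A' i j * B' i' j'))).
  apply: eq_bigr => k _.
  rewrite -(@big_mxtens m n (fun j j' => (A _ j * B _ j') * (A' _ j * B' _ j'))).
  by apply: eq_bigr => l _; rewrite !mxE.
rewrite /mxdot mulr_suml; apply: eq_bigr => i _; rewrite mulr_sumr; apply: eq_bigr => i' _.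
rewrite mulr_suml; apply: eq_bigr => j _; rewrite mulr_sumr; apply: eq_bigr => j' _.
by rewrite mulrACA.
Qed.

Lemma tensmxDl m n p q (A A' : 'M[K]_(m, n)) (B : 'M[K]_(p, q)) :
  tensmx (A + A') B = tensmx A B + tensmx A' B.
Proof. by apply/matrixP => i j; rewrite !mxE mulrDl. Qed.

Lemma tensmxDr m n p q (A : 'M[K]_(m, n)) (B B' : 'M[K]_(p, q)) :
  tensmx A (B + B') = tensmx A B + tensmx A B'.
Proof. by apply/matrixP => i j; rewrite !mxE mulrDr. Qed.

Lemma tensmxZl m n p q a (A : 'M[K]_(m, n)) (B : 'M[K]_(p, q)) :
  tensmx (a *: A) B = a *: tensmx A B.
Proof. by apply/matrixP => i j; rewrite !mxE mulrA. Qed.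

Lemma tensmxZr m n p q a (A : 'M[K]_(m, n)) (B : 'M[K]_(p, q)) :
  tensmx A (a *: B) = a *: tensmx A B.
Proof. by apply/matrixP => i j; rewrite !mxE mulrCA. Qed.

Lemma tensmx11 m n : tensmx (1%:M : 'M[K]_m) (1%:M : 'M[K]_n) = 1%:M.
Proof.
apply/matrixP => i j; rewrite !mxE -natrM mulnb; congr (_%:R).
rewrite -(inj_eq (can_inj (@mxtens_unindexK m n))) -pair_eqE /=; congr nat_of_bool.
Qed.

Variables m n : nat.

(** The size (m + 1)(n + 1) is displayed as a successor, so that the square matrices form a ring. *)
Definition tens (A : 'M[K]_m.+1) (B : 'M[K]_n.+1) : 'M[K]_((n + m * n.+1).+1) := tensmx A B.

Lemma tensM A A' B B' : tens A B * tens A' B' = tens (A * A') (B * B').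
Proof. exact: (tensmx_mul A B A' B'). Qed.

Lemma tens1 : tens 1 1 = 1. Proof. exact: (tensmx11 m.+1 n.+1). Qed.

End MatrixPairing.

(* The pairs (a, b) of complementary subwords of s: the terms of the coproduct of a
   product of primitive elements. *)
Fixpoint splits (T : Type) (s : seq T) : seq (seq T * seq T) :=
  if s is y :: s' then
    [seq (y :: ab.1, ab.2) | ab <- splits s'] ++ [seq (ab.1, y :: ab.2) | ab <- splits s']
  else [:: ([::], [::])].

Lemma unital_alg_morph0 (K : numFieldType) (A B : algType K) (f : A -> B) :
  unital_alg_morph f -> f 0 = 0.
Proof. by move=> [fL _ _]; have := fL (-1) 0 0; rewrite scaler0 addr0 scaleN1r addNr. Qed.

Lemma unital_alg_morphB (K : numFieldType) (A B : algType K) (f : A -> B) x y :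
  unital_alg_morph f -> f (x - y) = f x - f y.
Proof. by move=> [fL _ _]; rewrite addrC -scaleN1r fL scaleN1r addrC. Qed.

Lemma lie_morph_comp (K : numFieldType) (L : lmodType K) (br : L -> L -> L) (A B : algType K)
    (h : L -> A) (f : A -> B) : lie_morph br h -> unital_alg_morph f -> lie_morph br (f \o h).
Proof.
move=> [hL hM] fm; case: (fm) => fL f1 fM; split=> [a x y|x y] /=; first by rewrite hL fL.
by rewrite hM /commutator (unital_alg_morphB _ _ fm) !fM.
Qed.
Lemma eq_continuous_fun (T S : topologicalType) (f h : T -> S) :
  continuous f -> (forall y, h y = f y) -> continuous h.
Proof. by move=> fc /funext ->. Qed.

Section Coefficients.
Variables (K : numFieldType) (g : topologicalLmodType K) (br : g -> g -> g).
Variables (UL : algType K) (iota : g -> UL).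
Hypothesis HUL : classical_UEA br iota.

Definition word (s : seq g) : UL := \prod_(y <- s) iota y.

Lemma word_cons y s : word (y :: s) = iota y * word s.
Proof. by rewrite /word big_cons. Qed.

(** Matrix coefficients of the representations of U(g) whose restriction to g is continuous. *)
Definition coeff (w : UL -> K) := exists d (F : UL -> 'M[K]_d.+1) (T : 'M[K]_d.+1),
  [/\ unital_alg_morph F, forall i j, continuous (fun y => F (iota y) i j) &
      forall u, w u = mxdot (F u) T].

Lemma coeff_ker (U : topAlgType K) (lam : g -> U) (eps : UL -> U) (w : UL -> K) u :
  wc_UEA br lam -> unital_alg_morph eps -> eps \o iota = lam -> coeff w -> eps u = 0 -> w u = 0.
Proof.
move=> [wU ll lc univ] em el [d [F [T [Fm Fc ->]]]] u0.
case: HUL => li univL; case: (Fm) (li) => FL F1 FM [iL iM].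
pose f y : mx_top K d := F (iota y).
have lf : lie_morph br f.
  split=> [a x y|x y]; rewrite /f; first by rewrite iL FL.
  by rewrite iM /commutator -[- (_ * _)]scaleN1r addrC FL !FM scaleN1r addrC.
have [|f' [[fm fc ff] _]] := univ _ (mx_top_wc K d) f lf.
  exact: (to_mx_top_continuous (h := f) Fc).
have [h [_ huniq]] := univL _ _ lf.
have e1 : h = F by exact: huniq.
have e2 : h = f' \o eps.
  apply: huniq; split; first exact: unital_alg_morph_comp.
  by rewrite -compA el.
have -> : F u = 0 by rewrite -e1 e2 /= u0 (unital_alg_morph0 fm).
exact: mxdot0.
Qed.

Lemma coeff_lin a w1 w2 : coeff w1 -> coeff w2 -> coeff (fun u => a * w1 u + w2 u).
Proof.
move=> [d1 [F1 [T1 [[FL1 F11 FM1] Fc1 E1]]]] [d2 [F2 [T2 [[FL2 F12 FM2] Fc2 E2]]]].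
exists (d1 + d2.+1)%N, (fun u => block_mx (F1 u) 0 0 (F2 u) : 'M[K]_(d1.+1 + d2.+1)),
  (block_mx (a *: T1) 0 0 T2 : 'M[K]_(d1.+1 + d2.+1)); split.
- split=> [b x y||x y].
  + have h A A' B B' : block_mx (b *: A + A') 0 0 (b *: B + B') =
        b *: block_mx A 0 0 B + block_mx A' 0 0 B' :> 'M[K]_(d1.+1 + d2.+1).
      by rewrite scale_block_mx add_block_mx !scaler0 !addr0.
    by rewrite FL1 FL2; exact: h.
  + rewrite F11 F12; exact: (esym (@scalar_mx_block _ d1.+1 d2.+1 1)).
  + rewrite FM1 FM2; have := mulmx_block (F1 x) 0 0 (F2 x) (F1 y) 0 0 (F2 y).
    by rewrite !mulmx0 !mul0mx !addr0 !add0r => /esym.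
- have c0 : continuous (fun _ : g => 0 : K) by exact: cst_continuous.
  move=> i j; case: (@split_ordP d1.+1 d2.+1 i) => i' ->; case: (@split_ordP d1.+1 d2.+1 j) => j' ->.
  + refine (eq_continuous_fun (Fc1 i' j') _) => y; exact: (@block_mxEul K d1.+1 d2.+1 d1.+1 d2.+1).
  + by refine (eq_continuous_fun c0 _) => y; rewrite (@block_mxEur K d1.+1 d2.+1 d1.+1 d2.+1) mxE.
  + by refine (eq_continuous_fun c0 _) => y; rewrite (@block_mxEdl K d1.+1 d2.+1 d1.+1 d2.+1) mxE.
  + refine (eq_continuous_fun (Fc2 i' j') _) => y; exact: (@block_mxEdr K d1.+1 d2.+1 d1.+1 d2.+1).
- move=> u; rewrite E1 E2 -mxdotZr; exact: (esym (@mxdot_block K d1.+1 d2.+1 _ _ _ _)).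
Qed.

(** The counit: the coefficient of the one-dimensional zero representation. *)
Lemma coeff_counit : exists w, [/\ coeff w, w 1 = 1 & forall y, w (iota y) = 0].
Proof.
have l0 : lie_morph br (fun _ : g => 0 : 'M[K]_1).
  by split=> *; rewrite ?scaler0 ?addr0 // /commutator mul0r subrr.
case: HUL => li univL; have [F [[Fm FE] _]] := univL _ _ l0.
have E y : F (iota y) = 0 by have := congr1 (fun f => f y) FE.
exists (fun u => mxdot (F u) 1); split.
- exists 0, F, 1; split=> // i j; under eq_fun do rewrite E mxE; exact: cst_continuous.
- by case: Fm => _ -> _; rewrite /mxdot !big_ord1 mxE mulr1.
- by move=> y; rewrite E mxdot0.
Qed.

(** In the tensor product representation each letter of a word acts on one of the two factors; the
    choices are the splittings of the word. *)
Lemma coeff_shuffle w1 w2 : coeff w1 -> coeff w2 -> exists w, coeff w /\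
  forall s, w (word s) = \sum_(ab <- splits s) w1 (word ab.1) * w2 (word ab.2).
Proof.
move=> [d1 [F1 [T1 [Fm1 Fc1 E1]]]] [d2 [F2 [T2 [Fm2 Fc2 E2]]]].
case: HUL => li univL.
have [fL1 fM1] := lie_morph_comp li Fm1; have [fL2 fM2] := lie_morph_comp li Fm2.
pose f y := tens (F1 (iota y)) 1 + tens 1 (F2 (iota y)).
have lf : lie_morph br f.
  split=> [a x y|x y]; rewrite /f.
    have := fL1 a x y; have := fL2 a x y; rewrite /= => -> ->.
    by rewrite /tens tensmxDl tensmxDr tensmxZl tensmxZr scalerDr addrACA.
  have := fM1 x y; have := fM2 x y; rewrite /= => -> ->; rewrite /commutator.
  rewrite !mulrDl !mulrDr !tensM !mulr1 !mul1r.
  have tB1 A B : tens (A - B) 1 = tens A 1 - tens B 1 :> 'M[K]_((d2 + d1 * d2.+1).+1).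
    by rewrite -[- B]scaleN1r /tens tensmxDl tensmxZl scaleN1r.
  have tB2 A B : tens 1 (A - B) = tens 1 A - tens 1 B :> 'M[K]_((d2 + d1 * d2.+1).+1).
    by rewrite -[- B]scaleN1r /tens tensmxDr tensmxZr scaleN1r.
  by rewrite tB1 tB2; zmod.
have [F [[Fm FE] _]] := univL _ _ lf.
have FEy y : F (iota y) = f y by have := congr1 (fun f => f y) FE.
exists (fun u => mxdot (F u) (tens T1 T2)); split.
  exists (d2 + d1 * d2.+1)%N, F, (tens T1 T2); split=> // i j.
  pose k1 := @mxtens_unindex d1.+1 d2.+1 i; pose k2 := @mxtens_unindex d1.+1 d2.+1 j.
  have c1 : continuous (fun y => F1 (iota y) k1.1 k2.1 * (1 : 'M[K]_d2.+1) k1.2 k2.2).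
    by move=> y; apply: (@continuousM K g); [exact: Fc1|exact: cst_continuous].
  have c2 : continuous (fun y => (1 : 'M[K]_d1.+1) k1.1 k2.1 * F2 (iota y) k1.2 k2.2).
    by move=> y; apply: (@continuousM K g); [exact: cst_continuous|exact: Fc2].
  refine (eq_continuous_fun (fun y => @continuousD K K^o g _ _ y (c1 y) (c2 y)) _) => y.
  by rewrite FEy !mxE.
move=> s.
have Fs : F (word s) = \sum_(ab <- splits s) tens (F1 (word ab.1)) (F2 (word ab.2)).
  case: Fm => FL F1' FM; case: Fm1 => FL1 F11 FM1'; case: Fm2 => FL2 F12 FM2'.
  elim: s => [|y s IH] /=; first by rewrite big_seq1 /word !big_nil F1' F11 F12 tens1.
  rewrite word_cons FM FEy IH big_cat !big_map mulrDl !mulr_sumr; congr (_ + _);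
    by apply: eq_bigr => ab _; rewrite /= word_cons tensM mul1r ?FM1' ?FM2'.
rewrite Fs mxdot_sum; apply: eq_bigr => ab _.
by rewrite E1 E2; exact: (@mxdot_tens K d1.+1 d2.+1).
Qed.

End Coefficients.

Lemma mxdot_delta (K : numFieldType) n (A : 'M[K]_n) i j : mxdot A (delta_mx i j) = A i j.
Proof.
rewrite /mxdot (bigD1 i) //= (bigD1 j) //= !mxE !eqxx mulr1 big1 ?addr0 => [|j' h].
  rewrite big1 ?addr0 // => i' h; rewrite big1 // => j' _.
  by rewrite mxE (negPf h) mulr0.
by rewrite mxE (negPf h) andbF mulr0.
Qed.

(** Pairing with the elementary matrices reads off entries, so independent matrices are independent
    functionals of T and take prescribed values. *)
Lemma mxdot_dual (K : numFieldType) n d (M : 'I_n -> 'M[K]_d) (k : 'I_n) :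
  (forall a : 'I_n -> K, \sum_i a i *: M i = 0 -> forall i, a i = 0) ->
  exists T, forall i, mxdot (M i) T = (i == k)%:R.
Proof.
move=> Mfree; pose phi (T : 'M[K]_d) (i : 'I_n) := mxdot (M i) T.
have phiL : lin_coords phi.
  move=> a x y i; rewrite /phi /mxdot mulr_sumr -big_split; apply: eq_bigr => i' _ /=.
  by rewrite mulr_sumr -big_split; apply: eq_bigr => j' _; rewrite !mxE /=; ring.
have ind : indep_on setT phi setT.
  move=> s a us _ h i si.
  suff : (if i \in s then a i else 0) = 0 by rewrite si.
  apply: (Mfree (fun i => if i \in s then a i else 0)).
  apply/matrixP => i' j'; rewrite -mxdot_delta mxdot_sum mxE -[RHS](h (delta_mx i' j')) //.
  rewrite [RHS]big_uniq //= [RHS]big_mkcond /=; apply: eq_bigr => l _.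
  by case: ifP => _; rewrite -[_ *: _]addr0 mxdotL mxdot0 ?mul0r addr0.
have SU : subspace (setT : set 'M[K]_d) by split.
have [//|T [_ hT]] := indep_surj SU phiL ind (s := enum 'I_n) (fun i => (i == k)%:R) (enum_uniq _).
by exists T => i; apply: hT; rewrite // mem_enum.
Qed.

(* Adding a trivial summand lets a functional dual to M k vanish at the identity. *)
Lemma pad_rep (K : numFieldType) n (c : 'I_n -> 'I_n -> 'I_n -> K) d (M : 'I_n -> 'M[K]_d) (k : 'I_n) :
  struct_rep c M -> exists (M' : 'I_n -> 'M[K]_d.+1) T,
  [/\ forall i j, M' i * M' j - M' j * M' i = \sum_k c i j k *: M' k,
      mxdot 1 T = 0 & forall i, mxdot (M' i) T = (i == k)%:R].
Proof.
move=> [MB /(mxdot_dual k) [T0 T0P]].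
pose P (A : 'M[K]_d) : 'M[K]_(1 + d) := block_mx 0 0 0 A.
have PM A B : P A *m P B = P (A *m B) by rewrite /P mulmx_block !mulmx0 !mul0mx !addr0 !add0r.
have PL a A B : P (a *: A + B) = a *: P A + P B.
  by rewrite /P scale_block_mx !scaler0 (add_block_mx 0 0 0 _ 0 0 0) !addr0.
have P0 : P 0 = 0 by apply/matrixP => i j; rewrite /P block_mx0.
have PS (c' : 'I_n -> K) : P (\sum_l c' l *: M l) = \sum_l c' l *: P (M l).
  elim/big_rec2: _ => [//|l A B _ <-]; exact: PL.
exists (fun i => P (M i)), (block_mx (- mxdot 1%:M T0)%:M 0 0 T0 : 'M[K]_(1 + d)); split.
- move=> i j; rewrite -[RHS]PS -MB; have := PL (-1) (M j *m M i) (M i *m M j).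
  by rewrite !scaleN1r addrC => ->; rewrite -!PM addrC.
- have := @mxdot_block K 1 d 1%:M (- mxdot 1%:M T0)%:M 1%:M T0.
  rewrite -scalar_mx_block => ->; rewrite {1}/mxdot !big_ord1 !mxE /= mul1r mulr1n.
  by rewrite addNr.
- move=> i; apply: etrans (@mxdot_block K 1 d 0 (- mxdot 1%:M T0)%:M (M i) T0) _.
  by rewrite T0P mxdot0 add0r.
Qed.

Lemma coeff_linear (K : numFieldType) (g : topologicalLmodType K) (UL : algType K) (iota : g -> UL)
  (w : UL -> K) : coeff iota w -> forall a x y, w (a *: x + y) = a * w x + w y.
Proof. by move=> [d [F [T [[FL _ _] _ E]]]] a x y; rewrite !E FL mxdotL. Qed.

Section Separation.
Variables (K : numFieldType) (g : topologicalLmodType K) (br : g -> g -> g).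
Hypothesis disc_compact : compact [set a : K | `|a| <= 1].
Hypothesis ado_K : forall n (c : 'I_n -> 'I_n -> 'I_n -> K), struct_lie c ->
  exists d (M : 'I_n -> 'M[K]_d), struct_rep c M.
Hypotheses (Hlie : lie_bracket_axioms br).
Variables (UL : algType K) (iota : g -> UL).
Hypothesis HUL : classical_UEA br iota.

Lemma brA_opp x y : br x y = - br y x.
Proof.
case: Hlie => bl brr b0 _; have := b0 (x + y).
have := bl 1 x y (x + y); rewrite !scale1r => ->.
have := brr 1 x x y; have := brr 1 y x y; rewrite !scale1r => -> ->; rewrite !b0 add0r addr0.
by move=> /eqP; rewrite addr_eq0 => /eqP.
Qed.

Lemma coeff_ideal I y : cofinite_ideals br I -> ~ I y ->
  exists w, [/\ coeff iota w, w 1 = 0 & w (iota y) != 0].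
Proof.
move=> [[I0 IL Ibr] cI fI] Iy.
have SI : subspace I by split.
have [n [v [q [qL qI qv q_dec]]]] := codim_basis SI fI.
have qc := cofinite_coords_continuous disc_compact cI SI qL qI qv q_dec.
(* The coefficient will be dual to the k-th matrix, so its value at y is the coordinate [q y k]. *)
have [k qk] : exists k, q y k != 0.
  apply: contrapT => h; apply: Iy; have := q_dec y; rewrite big1 ?subr0 // => i _.
  have -> : q y i = 0 by apply: contrapT => /eqP qi; apply: h; exists i.
  by rewrite scale0r.
case: (Hlie) => bl brr b0 bJ.
have qr x z m : q (br x z) m = \sum_l q z l * q (br x (v l)) m.
  have brS : br x (\sum_l q z l *: v l) = \sum_l q z l *: br x (v l).
    elim/big_rec2: _ => [|l a b _ <-]; last exact: brr.
    by have := brr (-1) x 0 0; rewrite scaler0 addr0 scaleN1r addNr.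
  have h := qI _ (Ibr x _ (q_dec z)) m.
  have : br x z = br x (z - \sum_l q z l *: v l) + br x (\sum_l q z l *: v l).
    by have := brr 1 x (z - \sum_l q z l *: v l) (\sum_l q z l *: v l); rewrite !scale1r subrK.
  move=> ->; rewrite lin_coordsD // h add0r brS lin_coords_sum //.
  by apply: eq_bigr => l _; rewrite lin_coordsZ.
have ql x z m : q (br x z) m = \sum_l q x l * q (br (v l) z) m.
  have qN a b : q (br a b) m = - q (br b a) m.
    by rewrite (brA_opp a) -scaleN1r lin_coordsZ // mulN1r.
  by rewrite qN qr -sumrN; apply: eq_bigr => l _; rewrite -mulrN -qN.
(* The structure constants of g / I in the basis of the classes of the v_i. *)
pose c i j k := q (br (v i) (v j)) k.
have cL : struct_lie c.
  split=> [i l|i j l|i j l m].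
  - by rewrite /c b0 lin_coords0.
  - by rewrite /c brA_opp -scaleN1r lin_coordsZ // mulN1r.
  - rewrite /c -qr -ql -qr -lin_coordsD //; congr (q _ m).
    have := bJ (v i) (v j) (v l).
    rewrite (brA_opp (v l) (br (v i) _)) => /eqP; rewrite subr_eq0 => /eqP <-.
    rewrite -addrA -[LHS]addr0; congr (_ + _).
    have := brr 1 (v j) (br (v l) (v i)) (br (v i) (v l)); rewrite !scale1r => <-.
    rewrite (brA_opp (v l)) addNr; apply: esym.
    by have := brr (-1) (v j) 0 0; rewrite scaler0 addr0 scaleN1r addNr.
have [d [M /(pad_rep k) [M' [T [MB T1 TM]]]]] := ado_K cL.
pose f x := \sum_l q x l *: M' l.
have lf : lie_morph br f.
  split=> [a x z|x z]; rewrite /f.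
    rewrite scaler_sumr -big_split; apply: eq_bigr => l _ /=.
    by rewrite qL scalerDl scalerA.
  have -> : commutator (\sum_l q x l *: M' l) (\sum_l q z l *: M' l) =
      \sum_i \sum_j (q x i * q z j) *: \sum_l c i j l *: M' l.
    rewrite /commutator [X in _ - X]mulr_suml mulr_suml.
    transitivity (\sum_i \sum_j ((q x i *: M' i) * (q z j *: M' j) - (q z j *: M' j) * (q x i *: M' i))).
      under [RHS]eq_bigr do rewrite sumrB.
      rewrite sumrB; congr (_ - _); first by apply: eq_bigr => i _; rewrite mulr_sumr.
      by rewrite exchange_big; apply: eq_bigr => j _; rewrite mulr_sumr.
    apply: eq_bigr => i _; apply: eq_bigr => j _; rewrite -MB.
    by rewrite -!scalerAl -!scalerAr !scalerA scalerBr [q z j * _]mulrC.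
  transitivity (\sum_i \sum_j \sum_l (q x i * q z j * c i j l) *: M' l); last first.
    apply: eq_bigr => i _; apply: eq_bigr => j _; rewrite scaler_sumr.
    by apply: eq_bigr => l _; rewrite scalerA.
  under [RHS]eq_bigr do rewrite exchange_big.
  rewrite [RHS]exchange_big; apply: eq_bigr => l _ /=.
  rewrite ql scaler_suml; apply: eq_bigr => i _; rewrite qr mulr_sumr scaler_suml.
  by apply: eq_bigr => j _; rewrite mulrA.
case: HUL => li univ; have [F [[Fm FE] _]] := univ _ _ lf.
have FEy x : F (iota x) = f x by have := congr1 (fun f => f x) FE.
exists (fun u => mxdot (F u) T); split.
- exists d, F, T; split=> // i j.
  have cc : continuous (fun x => \sum_l q x l * M' l i j).
    apply: continuous_sum => l x; apply: (@continuousM K g); first exact: qc.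
    exact: cst_continuous.
  refine (eq_continuous_fun cc _) => x; rewrite FEy /f summxE.
  by apply: eq_bigr => l _; rewrite mxE.
- by case: Fm => _ -> _.
- rewrite FEy /f mxdot_sum (bigD1 k) //= big1 ?addr0 => [|l lk].
    by rewrite -[_ *: _]addr0 mxdotL mxdot0 addr0 TM eqxx mulr1.
  by rewrite -[_ *: _]addr0 mxdotL mxdot0 addr0 TM (negPf lk) mulr0.
Qed.

Definition coeff0 (w : UL -> K^o) := coeff iota w /\ w 1 = 0.

Lemma coeff0_subspace : subspace coeff0.
Proof.
split; last first.
  move=> a x y [cx x1] [cy y1]; split; first exact: coeff_lin.
  by change (a * (x 1 : K) + (y 1 : K) = 0); rewrite x1 y1 mulr0 addr0.
have [w [cw _ _]] := coeff_counit HUL.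
split=> //; have := coeff_lin (-1) cw cw.
by congr coeff; apply: funext => u; rewrite mulN1r addNr.
Qed.

(** Evaluations at independent e_i are independent on the coefficients vanishing at 1: a nontrivial
    combination of the e_i is nonzero, so it lies outside some closed ideal of finite codimension,
    and a coefficient from the quotient detects it. *)
Lemma coeff_dual (Hpro : profinite_dim br) m (e : 'I_m -> g) :
  (forall a : 'I_m -> K, \sum_i a i *: e i = 0 -> forall i, a i = 0) ->
  exists w : 'I_m -> UL -> K,
    forall j, [/\ coeff iota (w j), w j 1 = 0 & forall i, w j (iota (e i)) = (i == j)%:R].
Proof.
move=> efree; pose phi (w : UL -> K^o) (i : 'I_m) : K := w (iota (e i)).
have phiL : lin_coords phi by [].
have ind : indep_on coeff0 phi setT.
  move=> s a us _ h i si.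
  suff : (if i \in s then a i else 0) = 0 by rewrite si.
  move: i {si}; apply: (efree (fun i => if i \in s then a i else 0)).
  case: Hpro => sep _ _; apply: contrapT => /eqP n0.
  set y := \sum_i _ in n0.
  have [I II Iy] : exists2 I, cofinite_ideals br I & ~ I y.
    apply: contrapT => hI; move/eqP: n0; apply; apply: sep => I II.
    by apply: contrapT => Iy; apply: hI; exists I.
  have [w [cw w1 /eqP wy]] := coeff_ideal II Iy; apply: wy.
  have iS (b : 'I_m -> K) : w (iota (\sum_i b i *: e i)) = \sum_i b i * w (iota (e i)).
    case: HUL => -[iL _] _.
    have l0 : w (iota 0) = 0.
      by have := iL (-1) 0 0; rewrite scaler0 addr0 scaleN1r addNr => ->; have := coeff_linear cw (-1) 1 1;
        rewrite scaleN1r addNr mulN1r addNr.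
    by elim/big_rec2: _ => [//|l A B _ <-]; rewrite iL (coeff_linear cw).
  rewrite /y iS -[RHS](h w) // [RHS]big_uniq //= [RHS]big_mkcond /=.
  by apply: eq_bigr => l _; case: ifP => _; rewrite ?mul0r.
have /boolp.choice[w wP] : forall j : 'I_m, exists w, coeff0 w /\ forall i, phi w i = (i == j)%:R.
  move=> j; have [//|w [cw wE]] := indep_surj coeff0_subspace phiL ind (s := enum 'I_m) (fun i => (i == j)%:R) (enum_uniq _).
  by exists w; split=> // i; apply: wE; rewrite mem_enum.
by exists w => j; have [[cw w1] wE] := wP j.
Qed.

End Separation.

(** * Words modulo shorter words *)

Section Splits.
Variable T : eqType.
Implicit Types s a b : seq T.

Lemma splits_map (S : Type) (f : T -> S) s :
  splits (map f s) = [seq (map f ab.1, map f ab.2) | ab <- splits s].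
Proof. by elim: s => //= y s ->; rewrite map_cat -!map_comp. Qed.

Lemma splits_perm s ab : ab \in splits s -> perm_eq (ab.1 ++ ab.2) s.
Proof.
elim: s ab => [|y s IH] ab /=; first by rewrite inE => /eqP ->.
rewrite mem_cat => /orP[|] /mapP[cd /IH h ->] /=; first by rewrite perm_cons.
by rewrite -[y :: cd.2]cat1s perm_catCA /= perm_cons.
Qed.

Lemma mem_splits1 a x b : ([:: x], a ++ b) \in splits (a ++ x :: b).
Proof.
have nils s : ([::], s) \in splits s.
  by elim: s => [|y s IH] //=; rewrite mem_cat (map_f (fun ab => (ab.1, y :: ab.2)) IH) orbT.
elim: a => [|y a IH] /=; rewrite mem_cat.
  by rewrite (map_f (fun ab => (x :: ab.1, ab.2)) (nils b)).
by rewrite (map_f (fun ab => (ab.1, y :: ab.2)) IH) orbT.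
Qed.

End Splits.

Section WordFiltration.
Variables (K : numFieldType) (g : topologicalLmodType K) (br : g -> g -> g).
Variables (UL : algType K) (iota : g -> UL).
Hypothesis HUL : classical_UEA br iota.

Local Notation W := (word iota).

(** The standard filtration of U(g), with the span of the words of length at most n in impredicative
    form. *)
Definition fil n (u : UL) := forall P : set UL, subspace P ->
  (forall s, (size s <= n)%N -> P (W s)) -> P u.

Lemma fil_subspace n : subspace (fil n).
Proof.
split=> [P [P0 _] _ //|a x y fx fy P SP PW].
by case: (SP) => _; apply; [exact: fx|exact: fy].
Qed.

Lemma fil_word n s : (size s <= n)%N -> fil n (W s).
Proof. by move=> h P SP; apply. Qed.

Lemma word_cat s t : W (s ++ t) = W s * W t.
Proof. by rewrite /word big_cat. Qed.

Lemma fil_mul n m u v : fil n u -> fil m v -> fil (n + m) (u * v).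
Proof.
have [f0 fL] := fil_subspace (n + m) => fu fv.
apply: (fv (fun v => fil (n + m) (u * v))) => [|t tm].
  by split=> [|a x y fx fy]; rewrite ?mulr0 // mulrDr -scalerAr; exact: fL.
apply: (fu (fun u => fil (n + m) (u * W t))) => [|s sn].
  by split=> [|a x y fx fy]; rewrite ?mul0r // mulrDl -scalerAl; exact: fL.
by rewrite -word_cat; apply: fil_word; rewrite size_cat leq_add.
Qed.

Lemma fil_cons n y u : fil n u -> fil n.+1 (iota y * u).
Proof. by have -> : iota y = W [:: y]; [rewrite /word big_seq1|apply: (@fil_mul 1); exact: fil_word]. Qed.

Lemma fil_le n m u : (n <= m)%N -> fil n u -> fil m u.
Proof. by move=> nm fu; apply: fu => [|s sn]; [exact: fil_subspace|apply: fil_word; exact: leq_trans nm]. Qed.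

Lemma fil_exhaustive u : exists n, fil n u.
Proof.
apply: (UEA_generated HUL (B := fun u => exists n, fil n u)) u => [|y]; last first.
  by exists 1%N; have := @fil_word 1 [:: y] isT; rewrite /word big_seq1.
split=> [|a x y [n fx] [m fy]|x y [n fx] [m fy]].
- by exists 0%N; have := @fil_word 0 [::] isT; rewrite /word big_nil.
- exists (maxn n m); have [_] := fil_subspace (maxn n m); apply.
    exact: fil_le (leq_maxl _ _) fx.
  exact: fil_le (leq_maxr _ _) fy.
- by exists (n + m)%N; exact: fil_mul.
Qed.

Lemma fil_move n x a b : (size (a ++ b) <= n)%N -> fil n (W (x :: a ++ b) - W (a ++ x :: b)).
Proof.
elim: a n => [|y a IH] n /=; first by rewrite subrr => _; case: (fil_subspace n).
case: n => [//|n]; rewrite ltnS => h.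
have -> : W (x :: y :: a ++ b) - W (y :: a ++ x :: b) =
    W (br x y :: a ++ b) + iota y * (W (x :: a ++ b) - W (a ++ x :: b)).
  case: HUL => -[_ iM] _; rewrite !word_cons iM /commutator mulrBr mulrBl !mulrA; zmod.
apply: (subspaceD (fil_subspace n.+1)); first exact: fil_word.
by apply: fil_cons; exact: IH.
Qed.

(** The associated graded algebra is commutative: each exchange of neighbours costs a word with one
    letter less, containing their bracket. *)
Lemma fil_perm n s t : perm_eq s t -> (size s <= n.+1)%N -> fil n (W s - W t).
Proof.
elim: s t n => [|x s IH] t n; first by rewrite perm_sym => /perm_nilP -> _; rewrite subrr; case: (fil_subspace n).
move=> st; have xt : x \in t by rewrite -(perm_mem st) mem_head.
case/splitPr: xt st => a b; rewrite -[x :: b]cat1s perm_sym perm_catCA /= perm_cons perm_sym => st sn.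
have -> : W (x :: s) - W (a ++ x :: b) =
   iota x * (W s - W (a ++ b)) + (W (x :: a ++ b) - W (a ++ x :: b)).
  by rewrite !word_cons mulrBr addrA subrK.
apply: (subspaceD (fil_subspace n)); last first.
  by apply: fil_move; rewrite -(perm_size st).
case: n sn => [|n] sn; last by apply: fil_cons; exact: IH.
move: sn st; rewrite /= ltnS leqn0 => /nilP ->; rewrite perm_sym => /perm_nilP ->.
by rewrite subrr mulr0; case: (fil_subspace 0).
Qed.

End WordFiltration.

(** * Detecting sorted monomials *)

Section SymbolDetection.
Variables (K : numFieldType) (g : topologicalLmodType K) (br : g -> g -> g).
Variables (UL : algType K) (iota : g -> UL).
Hypothesis HUL : classical_UEA br iota.

Local Notation W := (word iota).

Lemma coeff_at0 w : coeff iota w -> w 0 = 0.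
Proof. by move=> cw; have := coeff_linear cw (-1) 1 1; rewrite scaleN1r addNr mulN1r addNr. Qed.

Lemma coeff_kill n w u : coeff iota w -> (forall s, (size s <= n)%N -> w (W s) = 0) ->
  fil iota n u -> w u = 0.
Proof.
move=> cw ws fu; apply: (fu (fun u => w u = 0)) => //.
split=> [|a x y x0 y0]; last by rewrite (coeff_linear cw) x0 y0 mulr0 addr0.
exact: coeff_at0.
Qed.

Lemma fil0_coeff u : fil iota 0 u -> (forall w, coeff iota w -> w u = 0) -> u = 0.
Proof.
move=> fu h; have [k uk] : exists k, u = k *: 1.
  apply: (fu (fun u => exists k, u = k *: 1)).
    split=> [|a _ _ [k ->] [l ->]]; first by exists 0; rewrite scale0r.
    by exists (a * k + l); rewrite scalerDl scalerA.
  by move=> s; rewrite leqn0 => /nilP ->; exists 1; rewrite /word big_nil scale1r.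
have [w [cw w1 _]] := coeff_counit HUL.
have := h w cw; rewrite uk -[_ *: _]addr0 (coeff_linear cw) (coeff_at0 cw) w1 mulr1 !addr0 => ->.
by rewrite scale0r.
Qed.

Section Detection.
Variables (m : nat) (E : 'I_m -> g) (wd : 'I_m -> UL -> K).
Hypothesis wdP : forall j, [/\ coeff iota (wd j), wd j 1 = 0 & forall i, wd j (iota (E i)) = (i == j)%:R].

(* The shuffle product of the functionals [wd j], j in J: each kills 1, so only the
   splittings of a word into single letters contribute. *)
Lemma coeff_monomial (J : seq 'I_m) : exists w, [/\ coeff iota w,
  forall s, (size s < size J)%N -> w (W s) = 0 &
  forall p, size p = size J -> exists2 N : nat, w (W (map E p)) = N%:R & (N != 0%N) = perm_eq p J].
Proof.
elim: J => [|j J [w' [cw' w'0 w'J]]].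
  have [w [cw w1 _]] := coeff_counit HUL.
  exists w; split=> // p /size0nil ->; exists 1%N => //.
  by rewrite /word big_nil w1.
have [cj j1 jE] := wdP j.
have [w [cw wW]] := coeff_shuffle HUL cj cw'.
have /boolp.choice[N NP] : forall p, exists N : nat, size p = size J ->
    w' (W (map E p)) = N%:R /\ (N != 0%N) = perm_eq p J.
  by move=> p; have [/w'J[N h1 h2]|h] := eqVneq (size p) (size J); [exists N|exists 0%N => /eqP; rewrite (negPf h)].
exists w; split=> // [s sJ|p pJ].
  rewrite wW big1_seq // => -[a b] /= ab.
  have := perm_size (splits_perm ab); rewrite size_cat /= => abs.
  case: a ab abs => [|y a] _ abs; first by rewrite {1}/word big_nil j1 mul0r.
  by rewrite w'0 ?mulr0 //; move: sJ abs => /=; lia.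
(* Only the splittings that take out a single letter j contribute. The total is a natural number,
   with no cancellation, so in characteristic 0 it vanishes only if all its terms do. *)
exists (\sum_(ab <- splits p | ab.1 == [:: j]) N ab.2)%N.
  rewrite wW splits_map big_map natr_sum [RHS]big_mkcond /=.
  apply: eq_big_seq => -[a b] /= ab.
  have := perm_size (splits_perm ab); rewrite size_cat /= pJ /= => abs.
  case: a ab abs => [|i [|i' a]] ab abs.
  - by rewrite {1}/word big_nil j1 mul0r.
  - have bJ : size b = size J by move: abs => /=; lia.
    have [-> _] := NP b bJ.
    rewrite {1}/word /= big_seq1 jE eqseq_cons andbT.
    by case: eqP => _; rewrite ?mul1r ?mul0r.
  - rewrite w'0 ?mulr0 //; last by rewrite size_map; move: abs => /=; lia.
    by rewrite eqseq_cons andbF.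
apply/idP/idP => [|pj].
  rewrite sum_nat_seq_neq0 => /hasP[[a b] ab /= /andP[/eqP aj]].
  have := splits_perm ab; rewrite aj /= => pab.
  have bJ : size b = size J by have := perm_size pab; rewrite pJ => -[].
  have [_ ->] := NP b bJ => bJ'.
  by rewrite perm_sym; apply: perm_trans pab; rewrite perm_cons perm_sym.
have /splitPr sp : j \in p by rewrite (perm_mem pj) mem_head.
case: sp pj pJ => a b; rewrite -[j :: b]cat1s perm_catCA /= perm_cons => pj pJ.
rewrite sum_nat_seq_neq0; apply/hasP; exists ([:: j], a ++ b); first exact: mem_splits1.
by rewrite /= eqxx /=; have [|_ ->] := NP (a ++ b); first exact: perm_size.
Qed.

End Detection.

(** An element involves finitely many letters, which reduces the problem to a finite-dimensional
    subspace of g. *)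
Lemma fil_support n u : fil iota n u -> exists l : seq g, forall P : set UL, subspace P ->
  (forall s, (size s <= n)%N -> {subset s <= l} -> P (W s)) -> P u.
Proof.
move=> fu; apply: (fu (fun u => exists l : seq g, forall P : set UL, subspace P ->
  (forall s, (size s <= n)%N -> {subset s <= l} -> P (W s)) -> P u)); last first.
  by move=> s sn; exists s => P SP; apply.
split=> [|a x y [l hx] [l' hy]]; first by exists [::] => P [].
exists (l ++ l') => P SP PW; case: (SP) => _; apply.
  by apply: hx => // s sn sl; apply: PW => // z /sl; rewrite mem_cat => ->.
by apply: hy => // s sn sl; apply: PW => // z /sl; rewrite mem_cat orbC => ->.
Qed.

Definition ordle m : rel 'I_m := fun i j => (i <= j)%N.

(** The easy half of Poincare-Birkhoff-Witt in degree n + 1: sorted monomials span modulo shorter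
    words. Coefficients are indexed by all tuples and vanish on unsorted ones, which keeps the sum
    over a finite type. *)
Lemma fil_normal_form n m (E : 'I_m -> g) u :
  (exists l : seq g, (forall y, y \in l -> exists a : 'I_m -> K, y = \sum_i a i *: E i) /\
    forall P : set UL, subspace P ->
  (forall s, (size s <= n.+1)%N -> {subset s <= l} -> P (W s)) -> P u) ->
  exists c : n.+1.-tuple 'I_m -> K, (forall t : n.+1.-tuple 'I_m, ~~ sorted (@ordle m) t -> c t = 0) /\
    fil iota n (u - \sum_t c t *: W (map E t)).
Proof.
move=> [l [lE hu]].
pose Q u := exists c : n.+1.-tuple 'I_m -> K, (forall t : n.+1.-tuple 'I_m, ~~ sorted (@ordle m) t -> c t = 0) /\
    fil iota n (u - \sum_t c t *: W (map E t)).
have [f0 fL] := fil_subspace iota n.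
have SQ : subspace Q.
  split=> [|a x y [c [c0 fx]] [d [d0 fy]]].
    by exists (fun=> 0); split=> //; rewrite big1 ?subr0 // => t _; rewrite scale0r.
  exists (fun t => a * c t + d t); split=> [t nt|]; first by rewrite c0 // d0 // mulr0 addr0.
  have -> : a *: x + y - \sum_t (a * c t + d t) *: W (map E t) =
     a *: (x - \sum_t c t *: W (map E t)) + (y - \sum_t d t *: W (map E t)).
    under eq_bigr do rewrite scalerDl -scalerA.
    by rewrite big_split /= -scaler_sumr scalerBr opprD addrACA.
  exact: fL.
have ordT : total (@ordle m) by move=> i j; exact: leq_total.
apply: (hu Q SQ) => s sn sl.
have [sn'|] := leqP (size s) n.
  exists (fun=> 0); split=> //; rewrite big1 ?subr0 => [|t _]; last by rewrite scale0r.
  exact: fil_word.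
move=> sn'; have {sn sn'} sn : size s = n.+1 by lia.
(* The prefix p holds letters already expanded in the E_i; the remaining letters are expanded one by
   one, and p is sorted at the end. *)
suff main p : (size p + size s = n.+1)%N -> Q (W (map E p ++ s)) by exact: (main [::]).
elim: s p sl {sn} => [|y s IH] p sl ps.
  rewrite cats0; have szp : size (sort (@ordle m) p) == n.+1 by rewrite size_sort -ps /= addn0.
  exists (fun t => (t == Tuple szp)%:R); split.
    by move=> t; case: eqP => // ->; rewrite /= sort_sorted.
  rewrite (bigD1 (Tuple szp)) //= eqxx scale1r big1 ?addr0 => [|t /negPf ->]; last by rewrite scale0r.
  apply: (fil_perm HUL); last by rewrite size_map -ps /= addn0.
  by apply: perm_map; rewrite perm_sym perm_sort.
have [a ->] := lE y (sl _ (mem_head _ _)).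
have -> : W (map E p ++ \sum_i a i *: E i :: s) = \sum_i a i *: W (map E (rcons p i) ++ s).
  case: HUL => -[iL _] _.
  have iS : iota (\sum_i a i *: E i) = \sum_i a i *: iota (E i).
    have i0 : iota 0 = 0 by have := iL (-1) 0 0; rewrite scaler0 addr0 scaleN1r addNr.
    by elim/big_rec2: _ => [//|k A B _ <-].
  rewrite word_cat word_cons iS mulr_suml mulr_sumr; apply: eq_bigr => i _.
  by rewrite map_rcons cat_rcons word_cat word_cons -scalerAl -scalerAr.
refine (@subspace_sum _ _ Q _ _ _ _ SQ _) => i _; refine (@subspaceZ _ _ Q _ _ SQ _); apply: IH.
  by move=> z zs; apply: sl; rewrite inE zs orbT.
by rewrite size_rcons -ps /= addSnnS.
Qed.

End SymbolDetection.

(** * Faithfulness of the matrix coefficients, and the theorem *)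

Lemma coeff_faithful (K : numFieldType) (g : topologicalLmodType K) (br : g -> g -> g)
    (UL : algType K) (iota : g -> UL) (u : UL) :
  compact [set a : K | `|a| <= 1] ->
  (forall n (c : 'I_n -> 'I_n -> 'I_n -> K), struct_lie c ->
    exists d (M : 'I_n -> 'M[K]_d), struct_rep c M) ->
  lie_bracket_axioms br -> profinite_dim br -> classical_UEA br iota ->
  (forall w, coeff iota w -> w u = 0) -> u = 0.
Proof.
move=> disc_compact ado_K Hlie Hpro HUL hu.
have [n] := fil_exhaustive HUL u.
elim: n => [|n IH] fu; first exact: (fil0_coeff HUL fu hu).
apply: IH; have [l hl] := fil_support fu.
have [m [e [eL einj eP]]] := inspan_coords l.
pose E i := e (delta_mx 0 i).
have e0 : e 0 = 0 by have := eL (-1) 0 0; rewrite scaler0 addr0 scaleN1r addNr.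
have eS (a : 'I_m -> K) : e (\sum_i a i *: delta_mx 0 i) = \sum_i a i *: E i.
  by elim/big_rec2: _ => [//|i A B _ <-]; rewrite eL.
have [wd wdP] : exists w : 'I_m -> UL -> K,
    forall j, [/\ coeff iota (w j), w j 1 = 0 & forall i, w j (iota (E i)) = (i == j)%:R].
  apply: (coeff_dual disc_compact ado_K Hlie HUL Hpro) => a; rewrite -eS -[RHS]e0 => /einj a0 i.
  have := congr1 (fun v : 'rV[K]_m => v 0 i) a0; rewrite summxE (bigD1 i) //= big1 => [|k ki].
    by rewrite !mxE !eqxx mulr1 addr0.
  by rewrite !mxE eq_sym (negPf ki) andbF mulr0.
have [c [c0 fc]] : exists c : n.+1.-tuple 'I_m -> K,
    (forall t : n.+1.-tuple 'I_m, ~~ sorted (@ordle m) t -> c t = 0) /\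
    fil iota n (u - \sum_t c t *: word iota (map E t)).
  apply: (fil_normal_form HUL); exists l; split=> [y yl|P SP PW]; last exact: hl.
  have /eP [v ->] : inspan l y by exact: inspan_mem.
  by exists (fun i => v 0 i); rewrite -eS -row_sum_delta.
suff c_eq0 t : c t = 0.
  by move: fc; rewrite big1 ?subr0 // => t _; rewrite c_eq0 scale0r.
have [st|/c0 //] := boolP (sorted (@ordle m) t).
(* This w kills u by hypothesis and everything of degree at most n by construction, so it kills the
   leading part of u; there only the monomials that permute t survive. *)
have [w [cw wn wt]] := coeff_monomial HUL wdP t.
have := coeff_kill cw (n := n) _ fc; rewrite size_tuple in wn wt *.
have -> : u - \sum_t c t *: word iota (map E t) = (-1) *: (\sum_t c t *: word iota (map E t)) + u.
  by rewrite scaleN1r addrC.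
rewrite (coeff_linear cw) (hu w cw) addr0 mulN1r.
have -> : w (\sum_t c t *: word iota (map E t)) = \sum_t c t * w (word iota (map E t)).
  by elim/big_rec2: _ => [|i A B _ <-]; [exact: (coeff_at0 cw)|rewrite (coeff_linear cw)].
have [N wN Nt] := wt t (size_tuple t); rewrite perm_refl in Nt.
rewrite (bigD1 t) //= big1 ?addr0 => [|t' tt'].
  move=> /(_ wn) /eqP; rewrite wN oppr_eq0 mulf_eq0 pnatr_eq0 (negPf Nt) orbF => /eqP //.
have [st'|/c0 ->] := boolP (sorted (@ordle m) t'); last by rewrite mul0r.
have [N' -> N't] := wt t' (size_tuple t').
have [->|N0] := eqVneq N' 0%N; first by rewrite mulr0.
(* Two sorted tuples that are permutations of each other coincide, so no other sorted monomial
   contributes. *)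
move: tt'; rewrite -val_eqE; case/eqP.
apply: (sorted_eq _ _ st' st); last by rewrite -N't.
- by move=> a b d; exact: leq_trans.
- by move=> a b h; apply: val_inj; apply/eqP; rewrite eqn_leq.
Qed.

Unset Implicit Arguments.

Theorem theorem2p6 (R : realType) (isC : bool)
    (g : topologicalLmodType (Kof R isC)) (br : g -> g -> g)
    (Hlie : top_lie_algebra br) (Hpro : profinite_dim br)
    (U : topAlgType (Kof R isC)) (lam : g -> U) (HU : wc_UEA br lam)
    (UL : algType (Kof R isC)) (iota : g -> UL) (HUL : classical_UEA br iota)
    (eps : UL -> U) (Heps : unital_alg_morph eps) (Hext : eps \o iota = lam) :
  [/\ injective eps,
      range eps = gen_subalg (range lam) &
      closure (gen_subalg (range lam)) = [set: U]].
Proof.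
case: (HU) => wU ll lc univ; split.
- move=> u v uv; apply/eqP; rewrite -subr_eq0; apply/eqP.
  refine (@coeff_faithful _ _ _ _ _ (u - v) (@Kof_disc_compact R isC) (@ado_struct R isC) (proj1 Hlie) Hpro HUL _) => w cw.
  apply: (coeff_ker HUL HU Heps Hext cw).
  by rewrite (unital_alg_morphB _ _ Heps) uv subrr.
- by rewrite (range_gen_subalg HUL Heps) Hext.
- exact: wc_UEA_dense HU.
Qed.
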